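(* Let $\Omega\subset\mathbb{R}^2$ be a bounded open polygon. Suppose $u_0\in C_b^4(\Omega)$ is the solution of the local problem $-\Delta u_0=f_0$ on $\Omega$, $u_0=g_0$ on $\partial\Omega$; the family of kernels $\{\gamma_\delta\}$ satisfies the kernel conditions (K1)--(K3) given in the context with $\Phi'(1)\neq0$ (so that $\lambda=2$), and $$G(\gamma_\delta):=\sup_{\mathbf{x}\in\widehat\Omega_\delta}\int_{B_\delta(\mathbf{x})\cap\widehat\Omega_\delta}\gamma_\delta(\mathbf{x},\mathbf{y})\,d\mathbf{y}\lesssim\delta^{-2}.$$ Let $\{B_{\delta,n_\delta^{\mathbf{x}}}\}$ be a weakly quasi-uniform family of inscribed polygons with $n_\delta\sim\delta/h$, let $\widetilde u_0$ be a $C^4$ extension of $u_0$, and let $u_{\delta,n_\delta}^h$ be the linear conforming DG (CDG) approximation (defined in the context) of the nonlocal problem $-\mathcal{L}_{\delta,n_\delta}u_{\delta,n_\delta}=f_\delta$ on $\Omega$, $u_{\delta,n_\delta}=g_\delta$ on $\Omega_\delta^c$, under the condition that, for $\mu=0$ or $\mu=1$, $$\|f_\delta-f_0\|_{C(\Omega)}=O(\delta^2),\qquad\|g_\delta-\widetilde u_0\|_{C(\Omega_\delta^c)}=O(\delta^{2+\mu}).$$ If $$|\sigma_{n_\delta}^{i,1}(\mathbf{x})|\to0,\quad i=1,2,\quad\text{as }\delta\to0,\qquad\text{where }\ \sigma_{n_\delta}^{i,1}(\mathbf{x})=\int_{\widehat\Omega_\delta}(y_i-x_i)\gamma_{\delta,n_\delta}(\mathbf{x},\mathbf{y})\,d\mathbf{y},$$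 then, with $\lambda=2$, $$\|\widetilde u_0-u_{\delta,n_\delta}^h\|_{\delta,n_\delta}\lesssim\delta^{(3+\mu)/2}+\delta^{-1}h^2+\delta^{-\lambda-1}h^\lambda\sim\delta^{(3+\mu)/2}+\delta^{-3}h^2,$$ $$\|u_0-u_{\delta,n_\delta}^h\|_{L^2(\Omega)}\lesssim\delta^{(3+\mu)/2}+\delta^{-1}h^2+\delta^{-\lambda-1}h^\lambda\sim\delta^{(3+\mu)/2}+\delta^{-3}h^2.$$
   Context: Notation. $\Omega_\delta^c=\{\mathbf{y}\in\mathbb{R}^2\setminus\Omega:\mathrm{dist}(\mathbf{y},\partial\Omega)<\delta\}$, $\widehat\Omega_\delta=\Omega\cup\Omega_\delta^c$, $B_\delta(\mathbf{x})$ is the Euclidean disc, $\|\cdot\|_{C(D)}$ is the supremum norm on $D$, and $C_b^n(D)$ is the space of functions with continuous bounded derivatives of orders $0,\dots,n$ on $D$. $O(\cdot)$, $\lesssim$ and $\sim$ (two-sided bound) hold for small $\delta,h$ with constants independent of $\delta$ and $h$. A $C^n$ extension of $u$ is a function $\widetilde u\in C^n_b(\widehat\Omega_\delta)$ with $\widetilde u|_\Omega=u$ (a single function, not varying with $\delta$). Kernel conditions. $\gamma_\delta\ge0$ is symmetric and (K1) $\gamma_\delta(\mathbf{x},\mathbf{y})=0$ for $\mathbf{y}\notin B_\delta(\mathbf{x})$; (K2) $\gamma_\delta(\mathbf{x},\mathbf{y})=\widetilde\gamma_\delta(|\mathbf{y}-\mathbf{x}|)$ with $\widetilde\gamma_\delta(s)>0$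 for $0<s<\delta$, $\widetilde\gamma_\delta\in L^1(0,\delta)$, and $2\pi\int_0^\delta s^3\widetilde\gamma_\delta(s)\,ds=2$; (K3) (rescaled form) $\widetilde\gamma_\delta(s)=\delta^{-4}\gamma(s/\delta)$ for a nonnegative function $\gamma$ on $(0,1)$. Define $\Phi(t)=\pi\int_0^t\rho^3\gamma(\rho)\,d\rho$, so $\Phi(1)=1$ and $\Phi'(t)=\pi t^3\gamma(t)$ for $t\in(0,1]$; $\Phi$ is understood to be regular enough near $t=1$ for a Taylor expansion there. In general $\lambda=2$ if $\Phi'(1)\ne0$, and $\lambda=4$ if $\Phi'(1)=0\ne\Phi''(1)$. The constant kernel $\gamma(\rho)=4/\pi$ is an example with $\lambda=2$. Polygons. For each $\mathbf{x}\in\widehat\Omega_\delta$, $B_{\delta,n_\delta^{\mathbf{x}}}$ is a polygon inscribed in the circle bounding $B_\delta(\mathbf{x})$, with $n_\delta^{\mathbf{x}}$ sides; $n_\delta=\sup_{\mathbf{x}}n_\delta^{\mathbf{x}}$. $H_{n_\delta^{\mathbf{x}}}$ is the length of its longest side and $r_{\delta,\mathbf{x}}$ is the radius of the largest circle centered at $\mathbf{x}$ contained in it. The family is weakly quasi-uniform if there are constants $C_1,C_2>0$ such that for all $\delta>0$, $\sup_{\mathbf{x}}\frac{H_{n_\delta^{\mathbf{x}}}}{2\sin(\pi/n_\delta^{\mathbf{x}})}\le C_1\delta$ and $\inf_{\mathbf{x}}r_{\delta,\mathbf{x}}\ge C_2\delta$, with sup/inf over $\mathbf{x}\in\widehat\Omega_\delta$.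 Kernel, operator and norm: with $B'_{\delta,n_\delta^{\mathbf{x}}}=\{\mathbf{y}\in B_\delta(\mathbf{x}):\mathbf{x}\in B_{\delta,n_\delta^{\mathbf{y}}}\}$ and $\chi$ denoting indicator functions, $$\gamma_{\delta,n_\delta}(\mathbf{x},\mathbf{y})=\tfrac12\gamma_\delta(\mathbf{x},\mathbf{y})\big(\chi_{B_{\delta,n_\delta^{\mathbf{x}}}}(\mathbf{y})+\chi_{B'_{\delta,n_\delta^{\mathbf{x}}}}(\mathbf{y})\big);$$ $\mathcal{L}_{\delta,n_\delta}u(\mathbf{x})=2\int_{\mathbb{R}^2}(u(\mathbf{y})-u(\mathbf{x}))\gamma_{\delta,n_\delta}(\mathbf{x},\mathbf{y})\,d\mathbf{y}$ for $\mathbf{x}\in\Omega$; and $\|u\|_{\delta,n_\delta}=\big(\int_{\widehat\Omega_\delta}\int_{\widehat\Omega_\delta}(u(\mathbf{y})-u(\mathbf{x}))^2\gamma_{\delta,n_\delta}(\mathbf{x},\mathbf{y})\,d\mathbf{y}\,d\mathbf{x}\big)^{1/2}$. CDG approximation. $\mathcal{T}_\delta^h$ is a triangulation of $\widehat\Omega_\delta$ that simultaneously triangulates $\Omega$, quasi-uniform with mesh size $h<\delta$. $V_\delta^{0,h}$ is the space of functions that are continuous piecewise linear on the triangulation of $\overline\Omega$ and zero on the rest (possibly jumping across $\partial\Omega$). $V_\delta^{c,h}$ is the space of functions that are continuous piecewise linear on the triangulation of $\overline{\Omega_\delta^c}$ and zero on $\Omega$. $g_\delta^h\in V_\delta^{c,h}$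 is an approximation of $g_\delta$ with $\|g_\delta-g_\delta^h\|_{C(\Omega_\delta^c)}\lesssim h^2$. Find $u_{\delta,n_\delta}^{0,h}\in V_\delta^{0,h}$ such that for all $w_h\in V_\delta^{0,h}$, $$-2\int_\Omega w_h(\mathbf{x})\int_\Omega\big(u_{\delta,n_\delta}^{0,h}(\mathbf{y})-u_{\delta,n_\delta}^{0,h}(\mathbf{x})\big)\gamma_{\delta,n_\delta}(\mathbf{x},\mathbf{y})\,d\mathbf{y}\,d\mathbf{x}=\int_\Omega f_\delta w_h\,d\mathbf{x}+2\int_\Omega w_h(\mathbf{x})\int_{\Omega_\delta^c}\big(g_\delta^h(\mathbf{y})-u_{\delta,n_\delta}^{0,h}(\mathbf{x})\big)\gamma_{\delta,n_\delta}(\mathbf{x},\mathbf{y})\,d\mathbf{y}\,d\mathbf{x},$$ and set $u_{\delta,n_\delta}^h=u_{\delta,n_\delta}^{0,h}+g_\delta^h$.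
   Formalization: The condition n_δ ~ δ/h is required uniformly in x (the smallest as well as the largest number of sides), since with the supremum alone the claim fails; elements of the collar, whose outer boundary has arcs, are the parts of straight triangles lying in it. *)

(* Defs.v *)
From HB Require Import structures.
From mathcomp Require Import all_boot all_order all_algebra.
From mathcomp Require Import all_classical all_reals all_analysis.

Set Implicit Arguments.
Unset Strict Implicit.
Unset Printing Implicit Defensive.

Import Order.TTheory GRing.Theory Num.Theory.
Import numFieldNormedType.Exports.

Local Open Scope classical_set_scope.
Local Open Scope ring_scope.

(* The library norm on R * R is the max norm: it induces the right topology,
   but all distances below are Euclidean. *)
Notation plane R := (measurableTypeR R * measurableTypeR R)%type.

Section Plane.
Context {R : realType}.
Implicit Types (p q x y : plane R) (A D Omega : set (plane R)).

Definition leb2 : {measure set (plane R) -> \bar R} :=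
  (@lebesgue_measure R \x @lebesgue_measure R)%E.

(* The two coordinates are indexed by bool: false is x_1, true is x_2. *)
Definition coord (i : bool) p : R := if i then p.2 else p.1.
Definition unit_vec (i : bool) : plane R := ((~~ i)%:R, i%:R).

Definition norm2 p : R := Num.sqrt (p.1 ^+ 2 + p.2 ^+ 2).
Definition dist2 p q : R := norm2 (q - p).
Definition disc p (r : R) : set (plane R) := [set q | dist2 p q < r].

Definition boundary A : set (plane R) := closure A `\` interior A.
Definition dist_set p A : R := inf [set dist2 p q | q in A].

Definition collar Omega (d : R) : set (plane R) :=
  [set y | ~ Omega y /\ dist_set y (boundary Omega) < d].
Definition enlarged Omega (d : R) : set (plane R) := Omega `|` collar Omega d.

Definition supnorm D (f : plane R -> R) : \bar R :=
  ereal_sup [set (`|f x|)%:E | x in D].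

(* The iterated partial derivative d_{s_1} d_{s_2} ... f. *)
Definition partial (s : seq bool) (f : plane R -> R) : plane R -> R :=
  foldr (fun i g => 'D_(unit_vec i) g) f s.
Definition laplacian (f : plane R -> R) x : R :=
  partial [:: false; false] f x + partial [:: true; true] f x.

(* C_b^n(D), for an open set D; the values of f outside D play no role. *)
Definition Cb (n : nat) D (f : plane R -> R) : Prop :=
  (forall s i x, (size s < n)%N -> D x ->
     derivable (partial s f) x (unit_vec i)) /\
  (forall s, (size s <= n)%N ->
     (forall x, D x -> {for x, continuous (partial s f)}) /\
     exists M : R, forall x, D x -> `|partial s f x| <= M).

End Plane.

Section Asymptotics.
Context {R : realType}.
Implicit Types P : set (R * R).

(* F <~ G for small delta, over a set P of admissible pairs (delta, h); the
   pairs used below satisfy 0 < h < delta, so h is then small as well. *)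
Definition lesssim P (F : R -> R -> \bar R) (G : R -> R -> R) : Prop :=
  exists C d0 : R, [/\ 0 < C, 0 < d0 &
    forall d h, P (d, h) -> d < d0 -> (F d h <= (C * G d h)%:E)%E].

Definition similar P (F G : R -> R -> R) : Prop :=
  lesssim P (fun d h => (F d h)%:E) G /\ lesssim P (fun d h => (G d h)%:E) F.

End Asymptotics.

Section Polygons.
Context {R : realType}.
Implicit Types (s : seq (plane R)) (Omega : set (plane R)).

Definition conv_hull (A : set (plane R)) : set (plane R) :=
  [set x | exists (n : nat) (v : 'I_n -> plane R) (w : 'I_n -> R),
    [/\ forall i, A (v i), forall i, 0 <= w i, \sum_i w i = 1 &
        x = \sum_i w i *: v i]].

(* A closed polygonal line is given by the cyclic sequence of its vertices;
   its i-th edge is taken without its endpoint. *)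
Definition next_vertex s i : plane R := s`_(i.+1 %% size s).
Definition edge s i : set (plane R) :=
  [set s`_i + t *: (next_vertex s i - s`_i) | t in `[0, 1[].
Definition polyline s : set (plane R) :=
  [set x | exists2 i, (i < size s)%N & edge s i x].

(* With half-open edges, simplicity is pairwise disjointness of the edges;
   this forces at least three vertices. *)
Definition simple_polyline s : Prop :=
  [/\ (0 < size s)%N,
      forall i, (i < size s)%N -> s`_i != next_vertex s i &
      forall i j, (i < size s)%N -> (j < size s)%N -> i <> j ->
        edge s i `&` edge s j = set0].

(* By the Jordan curve theorem the last two conditions and connectedness say
   that Omega is the region enclosed by a simple closed polygonal line. *)
Definition bounded_open_polygon Omega : Prop :=
  [/\ open Omega, Omega !=set0, connected Omega, bounded_set Omega &
      exists2 s, simple_polyline s & boundary Omega = polyline s].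

(* A simple closed polygonal line with all its vertices on a circle bounds the
   convex hull of its vertices. *)
Definition inscribed x (d : R) s : Prop :=
  simple_polyline s /\ forall v, v \in s -> dist2 x v = d.
Definition region s : set (plane R) := conv_hull [set` s].

Definition longest_side s : R :=
  \big[Num.max/0]_(i < size s) dist2 s`_i (next_vertex s i).
Definition inner_radius x s : R :=
  sup [set r : R | 0 <= r /\ disc x r `<=` region s].

End Polygons.

Section Kernels.
Context {R : realType}.

Definition Phi (gamma : R -> R) (t : R) : R :=
  pi * \int[lebesgue_measure]_(rho in `]0, t[) (rho ^+ 3 * gamma rho).

(* gam d x y, gamt d s and gamma rho are gamma_delta(x, y),
   gammatilde_delta(s) and gamma(rho). *)
Definition kernel_conditions (gam : R -> plane R -> plane R -> R)
    (gamt : R -> R -> R) (gamma : R -> R) : Prop :=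
  (forall rho, 0 < rho < 1 -> 0 <= gamma rho) /\
  forall d, 0 < d ->
  [/\ forall x y, 0 <= gam d x y /\ gam d x y = gam d y x,
      forall x y, ~ disc x d y -> gam d x y = 0,
      forall x y, gam d x y = gamt d (norm2 (y - x)),
      [/\ forall s, 0 < s < d -> 0 < gamt d s,
          (@lebesgue_measure R).-integrable `]0, d[ (EFin \o gamt d) &
          2 * pi * (\int[lebesgue_measure]_(s in `]0, d[)
                      (s ^+ 3 * gamt d s)) = 2] &
      forall s, 0 < s < d -> gamt d s = d ^- 4 * gamma (s / d)].

Definition kernel_mass (gam : plane R -> plane R -> R) (d : R)
    (D : set (plane R)) : \bar R :=
  ereal_sup [set (\int[leb2]_(y in disc x d `&` D) (gam x y)%:E)%E | x in D].

(* The polygon centred at x is given by its sequence of vertices poly x, so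
   that its number of sides is size (poly x). *)
Definition poly_kernel (gam : plane R -> plane R -> R) (d : R)
    (poly : plane R -> seq (plane R)) (x y : plane R) : R :=
  2^-1 * gam x y *
  (\1_(region (poly x)) y +
   \1_[set z | disc x d z /\ region (poly z) x] y).

Definition first_moment (ker : plane R -> plane R -> R) (D : set (plane R))
    (i : bool) (x : plane R) : R :=
  \int[leb2]_(y in D) ((coord i y - coord i x) * ker x y).

Definition energy_norm (ker : plane R -> plane R -> R) (D : set (plane R))
    (u : plane R -> R) : \bar R :=
  ((\int[leb2]_(x in D) \int[leb2]_(y in D)
      ((u y - u x) ^+ 2 * ker x y)%:E) `^ 2^-1)%E.

Definition L2norm (D : set (plane R)) (u : plane R -> R) : \bar R :=
  ('N[leb2]_(2%:E)[EFin \o (u \_ D)])%E.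

Definition max_sides (D : set (plane R)) (poly : plane R -> seq (plane R)) : R :=
  sup [set (size (poly x))%:R | x in D].
Definition min_sides (D : set (plane R)) (poly : plane R -> seq (plane R)) : R :=
  inf [set (size (poly x))%:R | x in D].

Definition weakly_quasi_uniform (P : set (R * R)) (Omega : set (plane R))
    (poly : R -> R -> plane R -> seq (plane R)) : Prop :=
  exists C1 C2 : R, [/\ 0 < C1, 0 < C2 &
    forall d h x, P (d, h) -> enlarged Omega d x ->
      longest_side (poly d h x) / (2 * sin (pi / (size (poly d h x))%:R))
        <= C1 * d /\
      C2 * d <= inner_radius x (poly d h x)].

End Kernels.

Section FiniteElements.
Context {R : realType}.

Definition tri : Type := (plane R * plane R * plane R)%type.
Implicit Types (t : tri) (T : seq tri) (Omega D : set (plane R)).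

Definition vertices t : set (plane R) := [set t.1.1; t.1.2; t.2].
Definition tri_set t : set (plane R) := conv_hull (vertices t).
Definition nondegenerate t : Prop :=
  let a := t.1.2 - t.1.1 in let b := t.2 - t.1.1 in
  a.1 * b.2 - a.2 * b.1 != 0.
Definition tri_diam t : R :=
  Num.max (dist2 t.1.1 t.1.2) (Num.max (dist2 t.1.2 t.2) (dist2 t.2 t.1.1)).
Definition covered T : set (plane R) :=
  [set x | exists2 t, t \in T & tri_set t x].

(* Two triangles meet along the face spanned by their common vertices. *)
Definition conforming T : Prop :=
  forall t t', t \in T -> t' \in T -> t <> t' ->
    tri_set t `&` tri_set t' = conv_hull (vertices t `&` vertices t').

(* A triangulation of the enlarged domain that also triangulates Omega:
   T0 triangulates the closure of Omega and Tc its collar.  The collar of a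
   polygon has circular arcs in its outer boundary, so no union of triangles
   is equal to it: an element along the outer boundary is the part of its
   triangle that lies in the collar. *)
Definition triangulation Omega (d : R) (T0 Tc : seq tri) : Prop :=
  [/\ forall t, t \in T0 ++ Tc -> nondegenerate t,
      conforming (T0 ++ Tc),
      covered T0 = closure Omega,
      closure (collar Omega d) `<=` covered Tc &
      forall t, t \in Tc ->
        tri_set t `&` Omega = set0 /\ tri_set t `&` collar Omega d !=set0].

Definition mesh_size T : R := \big[Num.max/0]_(t <- T) tri_diam t.

Definition quasi_uniform (kappa h : R) T : Prop :=
  mesh_size T = h /\
  forall t, t \in T -> exists c, disc c (kappa * h) `<=` tri_set t.

(* The functions that are continuous piecewise linear on the part D of the
   triangulation T, and zero outside D. *)
Definition fe_space T D (w : plane R -> R) : Prop :=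
  exists phi : plane R -> R,
  [/\ {within covered T, continuous phi},
      forall t, t \in T -> exists a b c : R,
        forall x, tri_set t x -> phi x = a + b * x.1 + c * x.2,
      forall x, D x -> w x = phi x &
      forall x, ~ D x -> w x = 0].

Definition CDG_solution Omega (d : R) (ker : plane R -> plane R -> R)
    (f gh : plane R -> R) (T0 : seq tri) (u0h : plane R -> R) : Prop :=
  fe_space T0 Omega u0h /\
  forall w, fe_space T0 Omega w ->
    - 2 * (\int[leb2]_(x in Omega)
       (w x * \int[leb2]_(y in Omega) ((u0h y - u0h x) * ker x y))) =
    \int[leb2]_(x in Omega) (f x * w x) +
    2 * (\int[leb2]_(x in Omega)
       (w x * \int[leb2]_(y in collar Omega d) ((gh y - u0h x) * ker x y))).

End FiniteElements.
Arguments tri : clear implicits.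

(* Main.v *)
(* Write w = v - uh, where v is the nodal interpolant of ut0 on Omega and gh on
   the collar; w is a test function, and w = eta + (ut0 - uh) with eta = v - ut0.
   Galerkin orthogonality gives a(w, w) = a(eta, w) + (r, w) for the energy form
   a, where r is the consistency error of the truncated operator at ut0.  Young's
   inequality and a Poincare inequality |w|^2 <= K a(w, w), uniform in delta,
   bound a(w, w) by a(eta, eta) + |r|^2 up to constants.

   Poincare: discs of radius c delta lie in all the polygons, and for small z a
   telescoping sum of about 1/|z_1| translates by z leaves the bounded set Omega,
   so z_1^2 |w|^2 <= D^2 |w(. + z) - w|^2; integrating against the kernel, whose
   second moment on the disc of radius c delta is Phi(c) > 0, gives the claim.

   Interpolation: eta = O(h^2) on Omega and O(h^2 + delta^(2 + mu)) on the collar,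
   whose area is O(delta), while the kernel has mass O(delta^-2).

   Consistency: the untruncated operator is within O(delta^2) of the Laplacian, by
   the symmetry of the kernel.  The polygons have sides O(h), so they contain the
   disc of radius delta (1 - O(h^2 / delta^2)); since Phi is differentiable at 1,
   the kernel has mass O(h^2 delta^-4) on the remaining annulus, on which
   ut0 varies by O(delta): the truncation costs O(h^2 delta^-3). *)

From HB Require Import structures.
From mathcomp Require Import all_boot all_order all_algebra.
From mathcomp Require Import ring lra.
From mathcomp Require Import all_classical all_reals all_analysis measurable_realfun.
Require Import Defs.

Set Implicit Arguments.
Unset Strict Implicit.
Unset Printing Implicit Defensive.

Import Order.TTheory GRing.Theory Num.Theory.
Import numFieldNormedType.Exports.

Local Open Scope classical_set_scope.
Local Open Scope ring_scope.

(** * Measurability and invariance of the plane Lebesgue measure *)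

Section PlaneMeasure.
Context {R : realType}.
Implicit Types (A B D U : set (plane R)) (x y z : plane R).

Notation mu := (@lebesgue_measure R).

(** The rate comes from two balances. The collar error delta^(2 + mu), squared and multiplied by the
    area delta and the mass delta^-2, contributes delta^(3 + 2 mu) to the squared energy, below the
    square delta^(3 + mu) of the announced term; the squared consistency error delta^4 is below it
    because mu <= 1. The geometric obstacle is the disc inside the polygon: a polygon is a cyclic
    sequence of points of a circle with disjoint edges, and nothing says that the sequence follows
    the circle. The point is that a chord supporting the convex hull is an edge, hence no longer
    than the longest side H, so that its distance to the centre is at least sqrt(delta^2 - H^2 / 4).
    On the diagonal the given kernel is not determined by gamma, but the integrands of the method
    vanish there or never meet it. It can thus be replaced by a measurable, symmetric, integrable
    kernel on the whole plane. Polar coordinates are needed for radial integrands only, and for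
    these it is enough to know the distribution of |z|. *)

Lemma leb2_rect (A B : set (measurableTypeR R)) : measurable A -> measurable B ->
  (leb2 (A `*` B) = mu A * mu B)%E.
Proof. by move=> mA mB; rewrite /leb2/= product_measure1E. Qed.

Lemma sigma_finite_leb2 : sigma_finite setT (@leb2 R).
Proof.
have /sigma_finiteP[F [TF ndF Foo]] := sigma_finiteT mu.
exists (fun n => F n `*` F n).
  rewrite -setXTT TF predeqE => -[x y]; split.
    move=> [/= [n _ Fnx] [k _ Fky]]; exists (maxn n k) => //; split.
      by move: x Fnx; exact/subsetPset/ndF/leq_maxl.
    by move: y Fky; exact/subsetPset/ndF/leq_maxr.
  by move=> [n _ []/= ? ?]; split; exists n.
move=> k; have [? ?] := Foo k.
split; first exact: measurableX.
by rewrite leb2_rect// lte_mul_pinfty// ge0_fin_numE.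
Qed.

(** A copy of [leb2] that carries a registered sigma-finite structure, as the symmetric forms below
    take a sigma-finite measure. The two are convertible. *)
Definition area : set (plane R) -> \bar R := leb2.
HB.instance Definition _ := Measure.copy area (@leb2 R).
HB.instance Definition _ :=
  Measure_isSigmaFinite.Build _ _ _ area sigma_finite_leb2.

Lemma areaE f D : (\int[area]_(x in D) f x = \int[leb2]_(x in D) f x)%E.
Proof. by []. Qed.

End PlaneMeasure.


(** * Borel measurability in the plane *)

Section OpenPlane.
Context {R : realType}.
Implicit Types (A B D U : set (plane R)) (x y z : plane R).

Definition ratbox (q : (rat * rat) * (rat * rat)) : set (plane R) :=
  `]ratr q.1.1, ratr q.1.2[%classic `*` `]ratr q.2.1, ratr q.2.2[%classic.

(** The sigma-algebra of the plane is the product one, so open sets have to be written with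
    rectangles: an open set is the union of the boxes with rational corners that it contains, and
    [unpickle] enumerates these. *)
Lemma open_measurable_plane U : open U -> measurable U.
Proof.
move=> oU.
pose F n := if unpickle n is Some q then
  (if `[< ratbox q `<=` U >] then ratbox q else set0) else set0.
have -> : U = \bigcup_n F n.
  apply/seteqP; split=> [x Ux|x [n _]]; last first.
    rewrite /F; case: unpickle => [q|//]; case: asboolP => [qU /qU//|_ //].
  have /nbhs_ballP[e e0 xeU] := open_nbhs_nbhs (conj oU Ux).
  have e0' : 0 < e by exact: e0.
  have rl (r : R) : exists q : rat * rat,
      `]ratr q.1, ratr q.2[%classic r /\
      (`]ratr q.1, ratr q.2[%classic `<=` ball r e).
    have /rat_in_itvoo[p1] : r - e < r by lra.
    have /rat_in_itvoo[p2] : r < r + e by lra.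
    rewrite !in_itv/= => /andP[a1 a2] /andP[b1 b2].
    exists (p1, p2); split=> /=; first by rewrite in_itv/= b2 a1.
    move=> s/=; rewrite in_itv/= /ball/= => /andP[c1 c2].
    by rewrite ltr_norml; apply/andP; split; lra.
  have [q1 [q1x q1e]] := rl x.1; have [q2 [q2x q2e]] := rl x.2.
  exists (pickle (q1, q2)); [exact: I|rewrite /F pickleK].
  case: asboolP => [_|]; first by split.
  case=> y [/= y1 y2]; apply: xeU; split; [exact: q1e|exact: q2e].
apply: bigcup_measurable => n _; rewrite /F; case: unpickle => // q.
by case: ifPn => // _; apply: measurableX; exact: measurable_itv.
Qed.

Lemma closed_measurable_plane U : closed U -> measurable U.
Proof.
move=> cU; rewrite -(setCK U); apply: measurableC.
by apply: open_measurable_plane; exact: closed_openC.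
Qed.

Lemma continuous_measurable_plane (f : plane R -> R) :
  continuous f -> measurable_fun setT f.
Proof.
move=> cf; apply: (measurability _ (RGenOpens.measurableE R)).
move=> _ [_ [a [b ->] <-]]; rewrite setTI; apply: open_measurable_plane.
by apply: open_comp => // x _; exact: cf.
Qed.

Lemma open_continuous_measurable_plane D (f : plane R -> R) :
  open D -> (forall x, D x -> {for x, continuous f}) -> measurable_fun D f.
Proof.
move=> oD cf; apply: (measurability _ (RGenOpens.measurableE R)).
move=> _ [_ [a [b ->] <-]]; apply: open_measurable_plane.
rewrite openE => x [Dx fx]; rewrite /interior/=; near=> y.
split; first by near: y; exact: open_nbhs_nbhs.
by near: y; apply: (cf x Dx); apply: open_nbhs_nbhs.
Unshelve. all: by end_near. Qed.

Lemma closed_continuous_measurable_plane D (f : plane R -> R) :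
  closed D -> {within D, continuous f} -> measurable_fun D f.
Proof.
move=> cD cf; apply: (measurability _ (RGenOpens.measurableE R)).
move=> _ [_ [a [b ->] <-]].
have /continuousP cf' := cf.
have /open_subspaceP[V oV VE] := cf' `]a, b[%classic (@interval_open R (BRight a) (BLeft b) isT isT).
rewrite setIC -VE; apply: measurableI; [exact: open_measurable_plane | exact: closed_measurable_plane].
Qed.

End OpenPlane.

(** * Invariance of integrals under translations, reflections and the swap of coordinates *)

Section Invariance.
Context {R : realType}.
Notation mu := (@lebesgue_measure R).
Local Open Scope ereal_scope.

(** Lebesgue measure is determined by the lengths of half-open intervals, and a times its image
    under x |-> a x + b gives these the same lengths. *)
Lemma ge0_integral_affine (f : R -> \bar R) (a b : R) : (0 < a)%R ->
  measurable_fun setT f -> (forall x, 0 <= f x) ->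
  \int[mu]_x f (a * x + b)%R = (a^-1)%:E * \int[mu]_x f x.
Proof.
move=> a0 mf f0.
pose phi : measurableTypeR R -> measurableTypeR R := fun x => (a * x + b)%R.
have mphi : measurable_fun [set: measurableTypeR R] phi.
  by apply: measurable_funD => //; apply: measurable_funM.
have ai0 : (0 <= a^-1)%R by rewrite invr_ge0 ltW.
pose k := NngNum ai0.
transitivity (\int[pushforward mu phi]_y f y).
  by rewrite (ge0_integral_pushforward mphi mu measurableT mf).
rewrite -[(a^-1)%:E]/((k%:num)%:E) -ge0_integral_mscale//.
apply: eq_measure_integral => A mA _.
pose m1 : {measure set (measurableTypeR R) -> \bar R} :=
  mscale (NngNum (ltW a0)) (pushforward mu phi).
have E : mu A = m1 mphi A.
  apply: lebesgue_measure_unique => // _ [[u v] _ <-].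
  rewrite /m1/= /mscale/= /pushforward/= (_ : phi @^-1` _ =
      `](u - b) / a, (v - b) / a]%classic)%R; last first.
    apply/seteqP; split=> x; rewrite /phi/= !in_itv/= ltr_pdivrMr// ler_pdivlMr//
      ltrBlDr lerBrDr ![(_ * a)%R]mulrC//.
  rewrite !lebesgue_measure_itv/= !lte_fin ltr_pM2r ?invr_gt0// ltrD2r.
  case: ifPn => _; last by rewrite mule0.
  by rewrite -!EFinB -EFinM; congr EFin; field; rewrite gt_eqF.
change (mu (phi @^-1` A) = (a^-1)%:E * mu A).
rewrite E; change (mu (phi @^-1` A) = (a^-1)%:E * (a%:E * mu (phi @^-1` A))).
by rewrite muleA -EFinM mulVf ?gt_eqF// mul1e.
Qed.

Lemma ge0_integral_opp (f : R -> \bar R) :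
  measurable_fun setT f -> (forall x, 0 <= f x) ->
  \int[mu]_x f (- x)%R = \int[mu]_x f x.
Proof.
move=> mf f0.
have mphi : measurable_fun [set: measurableTypeR R] (-%R : _ -> measurableTypeR R).
  by apply: continuous_measurable_fun; exact: opp_continuous.
transitivity (\int[pushforward mu (-%R : _ -> measurableTypeR R)]_y f y).
  by rewrite (ge0_integral_pushforward mphi mu measurableT mf).
by apply: eq_measure_integral => A mA _; exact: lebesgue_measureN.
Qed.

Section plane.
Variable f : plane R -> \bar R.
Hypotheses (mf : measurable_fun setT f) (f0 : forall x, 0 <= f x).

Lemma integral_leb2_iter : \int[leb2]_z f z = \int[mu]_x \int[mu]_y f (x, y).
Proof. exact: (fubini_tonelli1 (m1 := mu) (m2 := mu)). Qed.

Lemma measurable_section1 x : measurable_fun setT (fun y => f (x, y)).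
Proof. by apply: (measurableT_comp mf); exact: pair1_measurable. Qed.

Lemma measurable_iter : measurable_fun setT (fun x => \int[mu]_y f (x, y)).
Proof. exact: (measurable_fun_fubini_tonelli_F (m2 := mu) f). Qed.

Lemma iter_ge0 x : 0 <= \int[mu]_y f (x, y).
Proof. by apply: integral_ge0 => y _; exact: f0. Qed.

End plane.

Lemma ge0_integral_leb2_shift (f : plane R -> \bar R) (z : plane R) :
  measurable_fun setT f -> (forall x, 0 <= f x) ->
  \int[leb2]_w f (w + z)%R = \int[leb2]_w f w.
Proof.
move=> mf f0.
have shift1 (g : R -> \bar R) b : measurable_fun setT g -> (forall x, 0 <= g x) ->
    \int[mu]_x g (x + b)%R = \int[mu]_x g x.
  move=> mg g0; rewrite -[RHS]mul1e -[1]/(1%:E) -(invr1 R) -(ge0_integral_affine b)//.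
  by apply: eq_integral => x _; rewrite mul1r.
have mg : measurable_fun setT (fun w : plane R => f (w + z)%R).
  apply: (measurableT_comp mf).
  by apply: measurable_fun_pair => /=; exact: measurable_funD.
rewrite (integral_leb2_iter mf f0) (integral_leb2_iter mg (fun w => f0 _)).
transitivity (\int[mu]_x \int[mu]_y f (x + z.1, y)%R).
  apply: eq_integral => x _; rewrite -(shift1 (fun y => f (x + z.1, y)%R) z.2)//.
  exact: measurable_section1.
rewrite (shift1 (fun x => \int[mu]_y f (x, y)))//; first exact: measurable_iter.
by move=> x; exact: iter_ge0.
Qed.

Let mopp : measurable_fun setT (fun x : measurableTypeR R => - x : measurableTypeR R)%R.
Proof. by apply: continuous_measurable_fun; exact: opp_continuous. Qed.

Lemma ge0_integral_leb2_opp1 (f : plane R -> \bar R) :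
  measurable_fun setT f -> (forall x, 0 <= f x) ->
  \int[leb2]_w f (- w.1, w.2)%R = \int[leb2]_w f w.
Proof.
move=> mf f0; have mg : measurable_fun setT (fun w : plane R => f (- w.1, w.2)%R).
  apply: (measurableT_comp mf); apply: measurable_fun_pair => //=.
  exact: (measurableT_comp mopp).
rewrite (integral_leb2_iter mf f0) (integral_leb2_iter mg (fun w => f0 _)).
rewrite -(ge0_integral_opp (f := fun x => \int[mu]_y f (x, y)))//.
  exact: measurable_iter.
by move=> x; exact: iter_ge0.
Qed.

Let mswap : measurable_fun setT (fun w : plane R => (w.2, w.1) : plane R).
Proof. exact: measurable_fun_pair. Qed.

Lemma ge0_integral_leb2_swap (f : plane R -> \bar R) :
  measurable_fun setT f -> (forall x, 0 <= f x) ->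
  \int[leb2]_w f (w.2, w.1) = \int[leb2]_w f w.
Proof.
move=> mf f0; have mg := measurableT_comp mf mswap.
rewrite (integral_leb2_iter mf f0) (integral_leb2_iter mg (fun w => f0 _)).
by rewrite [RHS](fubini_tonelli (m1 := mu) (m2 := mu) f).
Qed.

Lemma ge0_integral_leb2_opp2 (f : plane R -> \bar R) :
  measurable_fun setT f -> (forall x, 0 <= f x) ->
  \int[leb2]_w f (w.1, - w.2)%R = \int[leb2]_w f w.
Proof.
move=> mf f0; have mf' := measurableT_comp mf mswap.
have mg : measurable_fun setT (fun w : plane R => f (w.1, - w.2)%R).
  apply: (measurableT_comp mf); apply: measurable_fun_pair => //=.
  exact: (measurableT_comp mopp).
rewrite -(ge0_integral_leb2_swap mg (fun w => f0 _)).
transitivity (\int[leb2]_w (f \o (fun w : plane R => (w.2, w.1))) w).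
  exact: (ge0_integral_leb2_opp1 mf' (fun w => f0 _)).
exact: ge0_integral_leb2_swap.
Qed.

End Invariance.

(** * Polar coordinates *)

Section Polar.
Context {R : realType}.
Notation mu := (@lebesgue_measure R).

(** The area of the unit disc, by the substitution x = sin theta and the antiderivative theta + sin
    theta cos theta of 2 cos^2 theta. The integrand vanishes off [-1, 1] because [Num.sqrt] is 0 on
    negative numbers. *)
Lemma integral_halfcircle : (\int[mu]_x (2 * Num.sqrt (1 - x ^+ 2))%:E = pi%:E)%E.
Proof.
pose G (x : R) := 2 * Num.sqrt (1 - x ^+ 2).
have cG : continuous G.
  move=> x; apply: cvgM; first exact: cvg_cst.
  apply: (@continuous_comp _ _ _ (fun x : R => 1 - x ^+ 2) Num.sqrt); last exact: sqrt_continuous.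
  by apply: cvgB; [exact: cvg_cst|exact: exprn_continuous].
transitivity (\int[mu]_(x in `[(- 1)%R, 1%R]) (G x)%:E)%E.
  rewrite [RHS]integral_mkcond; apply: eq_integral => x _; rewrite patchE.
  case: ifPn => //; rewrite notin_setE/= in_itv/= => /negP; rewrite -ler_norml -ltNge => x1.
  rewrite ler0_sqrtr ?mulr0// subr_le0 -[x ^+ 2]ger0_norm ?sqr_ge0// normrX.
  by rewrite exprn_ege1// ltW.
have pi0 : 0 < (pi : R) := pi_gt0 R.
have sinN : sin (- (pi / 2)) = - 1 :> R by rewrite sinN sin_pihalf.
rewrite -sinN -[X in `[_, X]](sin_pihalf R).
have dsin : (sin : R -> R)^`()%classic = cos.
  by apply/funext => x; rewrite derive1E derive_val.
rewrite (@integration_by_substitution_increasing _ sin G) ?dsin//; first last.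
- by apply: continuous_subspaceT.
- split; [by move=> x _; exact: ex_derive | apply: cvg_at_right_filter; exact: continuous_sin
   | apply: cvg_at_left_filter; exact: continuous_sin].
- by apply/cvg_ex; exists (cos (pi / 2)); apply: cvg_at_left_filter; exact: continuous_cos.
- by apply/cvg_ex; exists (cos (- (pi / 2))); apply: cvg_at_right_filter; exact: continuous_cos.
- by move=> x _; exact: continuous_cos.
- by move=> x y xI yI; rewrite ltr_sin.
- by lra.
pose F (x : R) := x + sin x * cos x.
have dF (x : R) : is_derive x 1 F (2 * cos x ^+ 2).
  rewrite /F; apply: is_derive_eq.
  have := cos2Dsin2 x; rewrite /GRing.scale/=; nra.
have -> : (\int[mu]_(x in `[(- (pi / 2))%R, (pi / 2)%R]) (((G \o sin) * cos) x)%:E =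
   \int[mu]_(x in `[(- (pi / 2))%R, (pi / 2)%R]) (2 * cos x ^+ 2)%:E)%E.
  apply: eq_integral => x; rewrite inE/= in_itv/= => xI; congr EFin.
  rewrite /G/= -[(_ * cos) x]/(_ * cos x)/= -cos2sin2 sqrtr_sqr ger0_norm ?cos_ge0_pihalf//.
  by rewrite expr2 mulrA.
have cF : continuous F.
  by move=> x; apply: differentiable_continuous; apply/derivable1_diffP; exact: ex_derive.
rewrite (@continuous_FTC2 _ (fun x => 2 * cos x ^+ 2) F)//.
- by rewrite /F sin_pihalf cos_pihalf cosN cos_pihalf !mulr0 !addr0 -EFinB; congr EFin; lra.
- by lra.
- apply: continuous_subspaceT => x; apply: cvgM; first exact: cvg_cst.
  by rewrite /GRing.exp/=; apply: cvgM; exact: continuous_cos.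
- split; [by move=> x _; exact: ex_derive| apply: cvg_at_right_filter; exact: cF
   | apply: cvg_at_left_filter; exact: cF].
- by move=> x _; rewrite derive1E derive_val.
Qed.

Lemma measurable_sqrtr : measurable_fun [set: R] (@Num.sqrt R).
Proof. by apply: continuous_measurable_fun => x; exact: sqrt_continuous. Qed.

Lemma continuous_norm2 : continuous (@norm2 R).
Proof.
move=> z; apply: (@continuous_comp _ _ _ (fun z : plane R => z.1 ^+ 2 + z.2 ^+ 2) Num.sqrt);
  last exact: sqrt_continuous.
apply: cvgD; rewrite /GRing.exp/=; apply: cvgM; first [exact: cvg_fst|exact: cvg_snd].
Qed.

Lemma measurable_norm2 : measurable_fun [set: plane R] norm2.
Proof. by apply: continuous_measurable_plane; exact: continuous_norm2. Qed.

Lemma norm2_ge0 (z : plane R) : 0 <= norm2 z.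
Proof. exact: sqrtr_ge0. Qed.

(** Each vertical section is an interval of half-length sqrt(r^2 - x^2), and scaling by r leads to
    the unit disc. The maximum with 0 covers negative r: the formula is compared below with another
    measure on all rays ]-oo, r[. *)
Lemma leb2_disc0 (r : R) : leb2 [set z : plane R | norm2 z < r] =
  (pi * (Num.max r 0) ^+ 2)%:E.
Proof.
have [r0|r0] := ltP r 0.
  rewrite (_ : mkset _ = set0) ?measure0 ?max_r ?ltW// ?expr0n ?mulr0//.
  apply/seteqP; split=> // z /=; rewrite ltNge (le_trans (ltW r0))//.
  exact: norm2_ge0.
have mA : measurable [set z : plane R | norm2 z < r].
  apply: open_measurable_plane; rewrite (_ : mkset _ = norm2 @^-1` [set t | t < r])//.
  by apply: open_comp; [move=> z _; exact: continuous_norm2|exact: open_lt].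
rewrite /leb2/= /product_measure1/=.
have E x : mu (xsection [set z : plane R | norm2 z < r] x) =
    (2 * Num.sqrt (r ^+ 2 - x ^+ 2))%:E.
  have nE y : (norm2 (x, y) < r) = (x ^+ 2 + y ^+ 2 < r ^+ 2).
    by rewrite /norm2/= -(ltr_sqr (sqrtr_ge0 _) r0) sqr_sqrtr ?addr_ge0 ?sqr_ge0.
  have [xr|xr] := leP (x ^+ 2) (r ^+ 2).
    set s := Num.sqrt _; have s0 : 0 <= s := sqrtr_ge0 _.
    have s2 : s ^+ 2 = r ^+ 2 - x ^+ 2 by rewrite sqr_sqrtr// subr_ge0.
    rewrite (_ : xsection _ _ = `]- s, s[%classic).
      rewrite lebesgue_measure_itv/= lte_fin; case: ltP => [_|ss].
        by rewrite -EFinB; congr EFin; lra.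
      by congr EFin; lra.
    have -> : `]- s, s[%classic = [set y | y ^+ 2 < s ^+ 2].
      by apply/seteqP; split => y;
        rewrite /= in_itv/= -ltr_norml -[y ^+ 2]real_normK ?num_real// ltr_sqr ?nnegrE.
    by apply/seteqP; split => y; rewrite xsectionE/= nE s2; lra.
  rewrite ler0_sqrtr ?subr_le0 ?ltW// mulr0 (_ : xsection _ _ = set0) ?measure0//.
  apply/seteqP; split => y //; rewrite xsectionE/= nE => yx.
  by have := sqr_ge0 y; lra.
transitivity (\int[mu]_x (2 * Num.sqrt (r ^+ 2 - x ^+ 2))%:E)%E.
  by apply: eq_integral => x _; exact: E.
have [->|rn0] := eqVneq r 0.
  rewrite integral0_eq ?expr0n ?mulr0// => x _ /=.
  by rewrite ler0_sqrtr ?mulr0// subr_le0 sqr_ge0.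
have rp : 0 < r by rewrite lt_neqAle eq_sym rn0.
have mh : measurable_fun [set: R] (fun x : R => (2 * Num.sqrt (1 - x ^+ 2))%:E).
  apply/measurable_EFinP; apply: measurable_funM => //.
  apply: (measurableT_comp measurable_sqrtr (g := fun x : R => 1 - x ^+ 2)).
  apply: measurable_funB => //; exact: exprn_measurable.
transitivity (\int[mu]_x (r%:E * (2 * Num.sqrt (1 - (r^-1 * x + 0) ^+ 2))%:E))%E.
  apply: eq_integral => x _; rewrite -EFinM; congr EFin.
  rewrite mulrCA; congr (_ * _); rewrite addr0.
  rewrite -{2}(ger0_norm r0) -sqrtr_sqr -sqrtrM ?sqr_ge0//; congr Num.sqrt.
  by field.
rewrite ge0_integralZl ?lee_fin//=.
- rewrite (ge0_integral_affine 0 (f := fun x => (2 * Num.sqrt (1 - x ^+ 2))%:E)) ?invr_gt0//.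
  by rewrite integral_halfcircle invrK -!EFinM; congr EFin; ring.
- apply: (measurableT_comp mh); apply: measurable_funD => //; exact: measurable_funM.
Qed.


Lemma integral_2pi (x : R) :
  (\int[mu]_(s in `]0%R, x[) (2 * pi * s)%:E = (pi * Num.max x 0 ^+ 2)%:E)%E.
Proof.
have [x0|x0] := leP x 0.
  by rewrite set_itv_ge ?integral_set0 ?expr0n ?mulr0//= bnd_simp -leNgt.
have cf : continuous (fun s : R => 2 * pi * s).
  by move=> s; apply: cvgM; [exact: cvg_cst|exact: cvg_id].
rewrite -(@integral_itv_bndoo _ 0 x _ true false)//; last first.
  apply/measurable_EFinP; apply: measurable_funTS; exact: continuous_measurable_fun.
have dF (s : R) : is_derive s 1 (fun s => pi * s ^+ 2 : R) (2 * pi * s).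
  apply: is_derive_eq; rewrite /GRing.scale/=; ring.
have cF : continuous (fun s : R => pi * s ^+ 2 : R).
  by move=> s; apply: differentiable_continuous; apply/derivable1_diffP; exact: ex_derive.
rewrite (@continuous_FTC2 _ (fun s => 2 * pi * s) (fun s => pi * s ^+ 2))//.
- by rewrite expr0n mulr0 sube0.
- exact: continuous_subspaceT.
- by split; [move=> s _; exact: ex_derive|apply: cvg_at_right_filter; exact: cF
   |apply: cvg_at_left_filter; exact: cF].
- by move=> s _; rewrite derive1E derive_val.
Qed.

(** The set [S] below the line of slope 2 pi has vertical sections of length 2 pi x. Hence [norm2]
    on the plane and the first coordinate on [S] push the area forward to measures that agree on all
    rays ]-oo, x[, both giving pi x^2 for x > 0, and so to the same measure; integration over [S] by
    sections yields the weight 2 pi s. *)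
Lemma ge0_integral_radial (F : R -> \bar R) :
  measurable_fun setT F -> (forall s, 0 <= F s)%E ->
  (\int[leb2]_(z in [set: plane R]) F (norm2 z) =
   \int[mu]_(s in `]0%R, +oo[) ((2 * pi * s)%:E * F s))%E.
Proof.
move=> mF F0.
pose S : set (plane R) := [set z | 0 < z.2 < 2 * pi * z.1].
have mS : measurable S.
  apply: open_measurable_plane.
  rewrite (_ : S = [set z : plane R | 0 < z.2] `&` [set z | 0 < 2 * pi * z.1 - z.2]); last first.
    by apply/seteqP; split => z; rewrite /S/= subr_gt0 => /andP.
  apply: openI.
    rewrite (_ : mkset _ = (snd : plane R -> R) @^-1` [set t | 0 < t])//.
    by apply: open_comp; [move=> z _; exact: cvg_snd|exact: open_gt].
  rewrite (_ : mkset _ = (fun z : plane R => 2 * pi * z.1 - z.2) @^-1` [set t | 0 < t])//.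
  apply: open_comp; last exact: open_gt.
  move=> z _; apply: cvgB; last exact: cvg_snd.
  by apply: cvgM; [exact: cvg_cst|exact: cvg_fst].
have pp : 0 < (pi : R) := pi_gt0 R.
have sec x : xsection S x = `]0, 2 * pi * x[%classic.
  by apply/seteqP; split => y; rewrite xsectionE/= in_itv.
have m1 A : measurable A -> leb2 (norm2 @^-1` A : set (plane R)) = leb2 ((fst @^-1` A) `&` S).
  move=> mA.
  have mn : measurable_fun [set: plane R] (norm2 : _ -> measurableTypeR R) := measurable_norm2.
  have mf : measurable_fun [set: plane R] (fst : _ -> measurableTypeR R) := measurable_fst.
  pose m1 : {measure set (measurableTypeR R) -> \bar R} :=
    pushforward (@leb2 R) (norm2 : _ -> measurableTypeR R).
  pose m2 : {measure set (measurableTypeR R) -> \bar R} :=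
    pushforward (mrestr (@leb2 R) mS) (fst : _ -> measurableTypeR R).
  change (m1 mn A = m2 mf A).

  apply: (@measure_unique _ R (measurableTypeR R) (@RGenInftyO.G R)
    (fun n : nat => `]-oo, (n%:R : R)[%classic) _ _ _ _ (m1 mn) (m2 mf)) => //.

  - exact: RGenInftyO.measurableE.
  - move=> _ _ [x ->] [y ->]; exists (Num.min x y).
    by apply/seteqP; split => z; rewrite /= !in_itv/= lt_min => /andP.
  - by move=> n; exists n%:R.
  - apply/seteqP; split => // x _; exists (Num.truncn `|x|).+1 => //=.
    by rewrite in_itv/= (le_lt_trans (ler_norm _))// truncnS_gt.
  - move=> _ [x ->]; rewrite /m1 /m2/= /pushforward /mrestr.
    rewrite (_ : norm2 @^-1` _ = [set z : plane R | norm2 z < x]); last first.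
      by apply/seteqP; split => z; rewrite /= in_itv.
    rewrite leb2_disc0 /leb2/= /product_measure1/=.
    transitivity (\int[mu]_(s in `]0%R, x[) (2 * pi * s)%:E)%E.
      by rewrite integral_2pi.
    rewrite [LHS]integral_mkcond; apply: eq_integral => t _; rewrite patchE.
    rewrite (_ : xsection _ _ = if t < x then `]0, 2 * pi * t[%classic else set0); last first.
      rewrite -(sec t); apply/seteqP; split => y; rewrite !xsectionE/=.
        by rewrite in_itv/= => -[-> ].
      by case: ifP => // tx Sy; rewrite in_itv.
    rewrite mem_setE/= in_itv/=; case: (ltP 0 t) => t0 /=; case: (ltP t x) => tx //=.
    + by rewrite lebesgue_measure_itv/= lte_fin mulr_gt0 ?mulr_gt0// -EFinB subr0.
    + by rewrite measure0.
    + by rewrite lebesgue_measure_itv/= lte_fin ltNge mulr_ge0_le0// mulr_ge0// ltW.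
    + by rewrite measure0.
  - move=> n; rewrite /m1/= /pushforward (_ : norm2 @^-1` _ = [set z : plane R | norm2 z < n%:R]); last first.
      by apply/seteqP; split => z; rewrite /= in_itv.
    by rewrite leb2_disc0 ltry.
(* The first coordinate on [S], and -1 off [S]: over [0, +oo[ the image of the whole area under
   [psi] is the image of the area restricted to [S]. *)
pose psi (z : plane R) : measurableTypeR R := (z.1 + 1) * \1_S z - 1.
have psiS z : z \in S -> psi z = z.1 by rewrite /psi indicE => ->; rewrite mulr1 addrK.
have psiNS z : z \notin S -> psi z = -1.
  by rewrite /psi indicE => /negbTE ->; rewrite mulr0 sub0r.
have mpsi : measurable_fun setT psi.
  by apply: measurable_funB => //; apply: measurable_funM => //; exact: measurable_funD.
have psiE A : A `<=` `[0%R, +oo[ -> psi @^-1` A = (fst @^-1` A) `&` S.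
  move=> A0; apply/seteqP; split => z /=.
    have [zS|zS] := boolP (z \in S); first by rewrite psiS//; move/set_mem : zS.
    by rewrite psiNS// => /A0/=; rewrite in_itv/= andbT; lra.
  by move=> [Az /mem_set zS]; rewrite psiS.
have mn : measurable_fun [set: plane R] (norm2 : _ -> measurableTypeR R) := measurable_norm2.
have mF' : measurable_fun (`[0%R, +oo[%classic : set (measurableTypeR R)) F by exact: measurable_funTS.
have n2T : norm2 @^-1` `[0%R, +oo[ = [set: plane R].
  by apply/seteqP; split => // z _; rewrite /= in_itv/= norm2_ge0.
have mI : measurable (`[0%R, +oo[%classic : set (measurableTypeR R)) by exact: measurable_itv.
transitivity (\int[pushforward leb2 psi]_(y in `[0%R, +oo[) F y)%E.
  transitivity (\int[pushforward leb2 (norm2 : plane R -> measurableTypeR R)]_(y in `[0%R, +oo[) F y)%E.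
    rewrite (ge0_integral_pushforward mn leb2 mI mF' (fun y _ => F0 y)).
    by rewrite n2T.
  apply: eq_measure_integral => A mA A0.
  change (leb2 (norm2 @^-1` A : set (plane R)) = leb2 (psi @^-1` A)).
  by rewrite (psiE A A0) m1.
rewrite (ge0_integral_pushforward mpsi leb2 mI mF' (fun y _ => F0 y)).
rewrite psiE// (_ : _ `&` S = S); last first.
  apply/seteqP; split => z; first by case.
  move=> Sz; split => //; move: Sz; rewrite /S/= in_itv/= andbT => /andP[z1 z2].
  by have := lt_trans z1 z2; rewrite pmulr_rgt0 ?mulr_gt0// => /ltW.
rewrite integral_mkcond.
transitivity (\int[leb2]_z (F z.1 * (\1_S z)%:E))%E.
  apply: eq_integral => z _; rewrite patchE indicE; case: ifPn => zS.
    by rewrite mule1/= psiS.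
  by rewrite mule0.
have mG : measurable_fun [set: plane R] (fun z => F z.1 * (\1_S z)%:E)%E.
  apply: emeasurable_funM; first exact: (measurableT_comp mF).
  by apply/measurable_EFinP.
have G0 (z : plane R) : (0 <= F z.1 * (\1_S z)%:E)%E by rewrite mule_ge0// lee_fin.
rewrite (integral_leb2_iter mG G0) [RHS]integral_mkcond; apply: eq_integral => x _.
rewrite patchE mem_setE in_itv/= andbT.
rewrite ge0_integralZl//=; last first.
  apply/measurable_EFinP; apply: (measurableT_comp (measurable_indic mS)).
  exact: pair1_measurable.
rewrite (_ : (\int[mu]_y (\1_S (x, y))%:E = mu (xsection S x))%E); last first.
  rewrite -[xsection S x]setIT -integral_indic//; last exact: measurable_xsection.
  by apply: eq_integral => y _; rewrite !indicE mem_xsection.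
rewrite sec lebesgue_measure_itv/= lte_fin pmulr_rgt0 ?mulr_gt0// -EFinB subr0.
by case: ifP => // _; rewrite ?mule0// muleC.
Qed.

End Polar.

(** * Radial kernels *)

Ltac nneg := rewrite ?lee_fin; repeat first [assumption | by apply: ltW | exact: sqr_ge0
  | exact: normr_ge0 | exact: pi_ge0 | exact: norm2_ge0 | exact: sqrtr_ge0 | exact: ler0n
  | exact: exprn_ge0 | apply: addr_ge0 | apply: mulr_ge0 | rewrite invr_ge0 | apply: exprn_ge0 | by [] ].

Section Profile.
Context {R : realType}.
Notation mu := (@lebesgue_measure R).
Variables (gam : R -> plane R -> plane R -> R) (gamt : R -> R -> R) (gamma : R -> R).
Hypothesis KC : kernel_conditions gam gamt gamma.

(* The kernel conditions do not control gamma outside (0, 1). *)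
Definition profile (rho : R) : R := if 0 < rho < 1 then gamma rho else 0.
Definition radial_kernel (d : R) (z : plane R) : R := d ^- 4 * profile (norm2 z / d).

Let gamt1 s : 0 < s < 1 -> gamt 1 s = gamma s.
Proof.
move=> s01; have [_ /(_ 1 ltr01)[_ _ _ _ /(_ s s01)->]] := KC.
by rewrite divr1 expr1n invr1 mul1r.
Qed.

Lemma profile_ge0 rho : 0 <= profile rho.
Proof. by rewrite /profile; case: ifP => // h; have [/(_ _ h)] := KC. Qed.

Lemma profile_gt0 rho : 0 < rho < 1 -> 0 < profile rho.
Proof.
move=> h; rewrite /profile h -gamt1//.
by have [_ /(_ 1 ltr01)[_ _ _ [/(_ rho h)]]] := KC.
Qed.

Lemma radial_kernel_ge0 d z : 0 <= radial_kernel d z.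
Proof. by rewrite /radial_kernel mulr_ge0 ?profile_ge0// invr_ge0 -(mulr1 4%N) exprn_even_ge0. Qed.

(** The scaling law covers the distances 0 < s < d only, which excludes the diagonal; from distance
    d on both sides are 0. *)
Lemma kernelE d x y : 0 < d -> x != y -> gam d x y = radial_kernel d (y - x).
Proof.
move=> d0 xy; have [_ /(_ d d0)[_ far rad _ scal]] := KC.
have n0 : 0 < norm2 (y - x).
  rewrite lt_neqAle norm2_ge0 andbT eq_sym; apply: contra xy.
  rewrite /norm2 sqrtr_eq0 => h; rewrite -subr_eq0 -oppr_eq0 opprB.
  by apply/eqP/pair_equal_spec; split; apply/eqP; rewrite -sqrf_eq0 eq_le sqr_ge0 andbT;
    move: h => /=; have := sqr_ge0 (y.1 - x.1); have := sqr_ge0 (y.2 - x.2) => /=; lra.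
rewrite /radial_kernel /profile.
rewrite divr_gt0//= ltr_pdivrMr// mul1r; case: ltP => nd.
  by rewrite rad scal// n0.
rewrite mulr0; apply: far; rewrite /disc/= /dist2; apply/negP.
by rewrite -leNgt.
Qed.

Let igamma : mu.-integrable `]0, 1[ (EFin \o gamma).
Proof.
have [_ /(_ 1 ltr01)[_ _ _ [_ h _ ] _]] := KC.
apply: eq_integrable h => // s; rewrite inE/= in_itv/= => s01.
by rewrite /= gamt1.
Qed.

Lemma profileE : EFin \o profile = (EFin \o gamma) \_ (`]0, 1[%classic).
Proof.
by apply/funext => s; rewrite patchE mem_setE in_itv/= /profile; case: ifP.
Qed.

Lemma measurable_profile : measurable_fun [set: R] profile.
Proof.
apply/measurable_EFinP; rewrite profileE.
apply/(measurable_restrictT _ _).1 => //.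
exact: measurable_int igamma.
Qed.

Lemma measurable_radial_kernel d : measurable_fun [set: plane R] (radial_kernel d).
Proof.
apply: measurable_funM => //; apply: (measurableT_comp measurable_profile).
by apply: measurable_funM => //; exact: measurable_norm2.
Qed.

Lemma ge0_integral_radial_scaled (G : R -> \bar R) (d : R) : 0 < d ->
  measurable_fun setT G -> (forall s, 0 <= G s)%E ->
  (\int[leb2]_(z in [set: plane R]) G (norm2 z / d)%R =
   (d ^+ 2)%:E * \int[mu]_(s in `]0%R, +oo[) ((2 * pi * s)%:E * G s))%E.
Proof.
move=> d0 mG G0.
have mGd : measurable_fun setT (fun s : R => G (s / d)).
  by apply: (measurableT_comp mG); exact: measurable_funM.
rewrite (ge0_integral_radial mGd (fun s => G0 _)).
pose H s := ((2 * pi * Num.max s 0)%:E * G s)%E.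
have mmax : measurable_fun [set: R] (fun s : R => (2 * pi * Num.max s 0)%:E).
  by apply/measurable_EFinP; apply: measurable_funM => //; exact: measurable_maxr.
have mH : measurable_fun setT H.
  by apply: emeasurable_funM.
have mx0 s : 0 <= 2 * pi * Num.max s 0 :> R.
  by rewrite mulr_ge0 ?le_max ?lexx ?orbT// mulr_ge0// pi_ge0.
have H0 s : (0 <= H s)%E by rewrite mule_ge0// lee_fin.
have E (K : R -> \bar R) : (\int[mu]_(s in `]0%R, +oo[) ((2 * pi * s)%:E * K s) =
    \int[mu]_s ((2 * pi * Num.max s 0)%:E * K s))%E.
  rewrite integral_mkcond; apply: eq_integral => s _; rewrite patchE mem_setE in_itv/= andbT.
  case: ltP => s0 //.
  by rewrite mulr0 mul0e.
rewrite !E.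
transitivity (\int[mu]_s (d%:E * H (d^-1 * s + 0)%R))%E.
  apply: eq_integral => s _; rewrite /H addr0 muleA -EFinM [(d^-1 * s)%R]mulrC; congr (_%:E * _)%E.
  rewrite [d * _]mulrC -!mulrA; congr (_ * (_ * _)).
  by rewrite maxr_pMl ?ltW// mul0r divfK ?gt_eqF.
rewrite ge0_integralZl//; last 2 first.
- apply: (measurableT_comp mH); apply: measurable_funD => //; exact: measurable_funM.
- by rewrite lee_fin ltW.
rewrite ge0_integral_affine ?invr_gt0// invrK muleA; congr (_ * _)%E.
Qed.

Definition mass0 : R := fine (\int[mu]_(s in `]0%R, +oo[) (2 * pi * s * profile s)%:E)%E.

Lemma integrable_profile : mu.-integrable setT (EFin \o profile).
Proof. by rewrite profileE -integrable_mkcond. Qed.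

Let profile_out s : 1 <= s -> profile s = 0.
Proof. by move=> s1; rewrite /profile [s < 1]ltNge s1 andbF. Qed.

(** The point is finiteness: the kernel conditions at delta = 1 make the profile integrable, and the
    weight s is at most 1 on its support. *)
Lemma mass0E : (\int[mu]_(s in `]0%R, +oo[) (2 * pi * s * profile s)%:E)%E = mass0%:E.
Proof.
rewrite /mass0 fineK//; apply/integrable_fin_num => //.
apply: (@le_integrable _ _ _ mu _ _ _ (fun s => ((2 * pi)%:E * (profile s)%:E)%E)) => //.
- apply/measurable_EFinP/measurable_funTS; apply: measurable_funM measurable_profile.
  exact: measurable_funM.
- move=> s /=; rewrite in_itv/= andbT => s0; rewrite lee_fin -mulrA !normrM -!mulrA.
  apply: ler_wpM2l => //; apply: ler_wpM2l => //.
  have [s1|s1] := ltP s 1; last by rewrite profile_out// normr0 mulr0.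
  by rewrite ler_piMl// gtr0_norm// ltW.
- apply: integrableZl => //; apply: integrableS integrable_profile => //.
Qed.

Lemma radial_kernel_integral (G : R -> R) d : 0 < d -> measurable_fun setT G ->
  (forall s, 0 <= G s) ->
  (\int[leb2]_z (G (norm2 z / d) * radial_kernel d z)%:E =
   (d ^- 2)%:E * \int[mu]_(s in `]0%R, +oo[) (2 * pi * s * G s * profile s)%:E)%E.
Proof.
move=> d0 mG G0.
have mGp : measurable_fun setT (fun s => (G s * profile s)%:E).
  by apply/measurable_EFinP; exact: measurable_funM measurable_profile.
have Gp0 s : (0 <= (G s * profile s)%:E)%E by rewrite lee_fin mulr_ge0// profile_ge0.
transitivity (\int[leb2]_(z in [set: plane R]) ((d ^- 4)%:E * (G (norm2 z / d) * profile (norm2 z / d))%:E))%E.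
  by apply: eq_integral => z _; rewrite -EFinM /radial_kernel mulrCA.
rewrite ge0_integralZl//; first last.
- by rewrite lee_fin invr_ge0 exprn_ge0// ltW.
- by apply: (measurableT_comp mGp); apply: measurable_funM => //; exact: measurable_norm2.
rewrite (ge0_integral_radial_scaled d0 mGp Gp0) muleA -EFinM.
rewrite (_ : d ^- 4 * d ^+ 2 = d ^- 2)%R; last by field; rewrite gt_eqF.
congr (_ * _)%E; apply: eq_integral => s _; rewrite -EFinM; congr EFin; ring.
Qed.

Let mind c : measurable_fun [set: R] (\1_(`]-oo, c[%classic) : R -> R).
Proof. by []. Qed.

Let mmom c : measurable_fun [set: R] (fun s : R => (pi * s ^+ 3 * \1_(`]-oo, c[%classic) s * profile s)%:E).
Proof.
apply/measurable_EFinP; apply: measurable_funM measurable_profile.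
by apply: measurable_funM => //; apply: measurable_funM => //; exact: measurable_funX.
Qed.

Let mom_ge0 (s b : R) : 0 < s -> 0 <= b -> 0 <= pi * s ^+ 3 * b * profile s.
Proof.
move=> s0 b0; have s3 : 0 <= s ^+ 3 by rewrite exprn_ge0// ltW.
by have := profile_ge0 s; nneg.
Qed.

Lemma PhiE c : 0 <= c <= 1 ->
  (Phi gamma c)%:E = (\int[mu]_(s in `]0%R, +oo[) (pi * s ^+ 3 * \1_(`]-oo, c[%classic) s * profile s)%:E)%E.
Proof.
move=> /andP[c0 c1].
have cE s : `]0, c[%classic s -> s ^+ 3 * gamma s = s ^+ 3 * profile s.
  by rewrite /= in_itv/= /profile => /andP[-> sc]; rewrite (lt_le_trans sc c1).
have ic : mu.-integrable `]0, c[ (EFin \o (fun s => s ^+ 3 * gamma s)).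
  apply: (@le_integrable _ _ _ mu _ _ _ (EFin \o profile)) => //.
  - apply/measurable_EFinP; apply: (eq_measurable_fun (fun s : R => s ^+ 3 * profile s)).
      by move=> s /set_mem sc; rewrite cE.
    by apply/measurable_funTS; apply: measurable_funM measurable_profile; exact: measurable_funX.
  - move=> s sc /=; rewrite cE//; move: sc; rewrite /= in_itv/= => /andP[s0 sc].
    rewrite lee_fin normrM ler_piMl// normrX exprn_ile1// gtr0_norm//.
    exact: le_trans (ltW sc) c1.
  - by apply: integrableS integrable_profile => //; exact: measurable_itv.
rewrite /Phi /Rintegral EFinM fineK; last exact: integrable_fin_num.
rewrite -ge0_integralZl ?lee_fin ?pi_ge0//; last 2 first.
- exact: measurable_int ic.
- move=> s sc; rewrite cE//; move: sc; rewrite /= in_itv/= => /andP[s0 _].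
  by rewrite lee_fin mulr_ge0 ?profile_ge0// exprn_ge0// ltW.
rewrite integral_mkcond [RHS]integral_mkcond; apply: eq_integral => s _.
rewrite !patchE !mem_setE !in_itv/= andbT indicE mem_setE in_itv/=.
case: ltP => s0 //=; case: ltP => sc; last by rewrite mulr0 mul0r.
by rewrite -EFinM mulr1 cE ?mulrA//= in_itv/= s0.
Qed.

Lemma Phi1 : Phi gamma 1 = 1.
Proof.
have [_ /(_ 1 ltr01)[_ _ _ [_ _ h] _]] := KC.
move: h; rewrite -mulrA => h; rewrite /Phi.
have -> : \int[mu]_(s in `]0, 1[) (s ^+ 3 * gamma s) = \int[mu]_(s in `]0, 1[) (s ^+ 3 * gamt 1 s).
  by apply: eq_Rintegral => s; rewrite inE/= in_itv/= => s01; rewrite gamt1.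
by set J := pi * _ in h *; lra.
Qed.

(** Were the integral zero, its nonnegative integrand would vanish almost everywhere, while it is
    positive on all of ]0, c[. *)
Lemma Phi_gt0 c : 0 < c <= 1 -> 0 < Phi gamma c.
Proof.
move=> /andP[c0 c1].
have c01 : 0 <= c <= 1 by rewrite (ltW c0).
rewrite lt_neqAle; apply/andP; split; last first.
  rewrite -lee_fin PhiE//; apply: integral_ge0 => s; rewrite /= in_itv/= andbT => s0.
  by rewrite lee_fin mom_ge0.
apply/eqP => h.
have : (\int[mu]_(s in `]0%R, +oo[) `|(pi * s ^+ 3 * \1_(`]-oo, c[%classic) s * profile s)%:E| = 0)%E.
  transitivity ((Phi gamma c)%:E); last by rewrite -h.
  rewrite PhiE//; apply: eq_integral => s; rewrite inE/= in_itv/= andbT => s0.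
  by rewrite ger0_norm// mom_ge0.
move/(ae_eq_integral_abs mu (measurable_itv _) (measurable_funTS (mmom c))).
move=> [N [mN N0 NE]].
have : (mu (`]0%R, c[%classic) <= mu N)%E.
  apply: le_measure; rewrite ?inE//; apply: subset_trans NE => s /= sc hs.
  move: sc; rewrite in_itv/= => /andP[s0 sc].
  have := hs; rewrite /= in_itv/= andbT => /(_ s0) []; apply/eqP.
  rewrite indicE mem_setE in_itv/= sc mulr1.
  by rewrite !mulf_neq0 ?gt_eqF ?pi_gt0 ?exprn_gt0 ?profile_gt0// s0 (lt_le_trans sc).
rewrite N0 lebesgue_measure_itv/= lte_fin c0 -EFinB subr0 lee_fin.
by rewrite leNgt c0.
Qed.

(** The swap of the coordinates makes the two moments equal, and their sum has the radial integrand
    |z|^2. The sum is 2 Phi(c), since Phi has the factor pi where the radial formula has 2 pi. *)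
Lemma radial_kernel_moment2 (i : bool) c d : 0 < d -> 0 <= c <= 1 ->
  (\int[leb2]_z (coord i z ^+ 2 * \1_(`]-oo, c[%classic) (norm2 z / d) * radial_kernel d z)%:E =
   (Phi gamma c)%:E)%E.
Proof.
move=> d0 c01.
pose f (z : plane R) := (z.1 ^+ 2 * \1_(`]-oo, c[%classic) (norm2 z / d) * radial_kernel d z)%:E.
have mindz : measurable_fun [set: plane R] (fun z : plane R => \1_(`]-oo, c[%classic) (norm2 z / d) : R).
  apply: (measurableT_comp (f := \1_(`]-oo, c[%classic) : R -> R)) => //.
  by apply: measurable_funM => //; exact: measurable_norm2.
have mf : measurable_fun setT f.
  apply/measurable_EFinP; apply: measurable_funM; last exact: measurable_radial_kernel.
  apply: measurable_funM => //; exact: measurable_funX.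
have f0 z : (0 <= f z)%E.
  by have := radial_kernel_ge0 d z; rewrite /f; nneg.
have nswap (z : plane R) : norm2 (z.2, z.1) = norm2 z by rewrite /norm2 addrC.
have fi : (\int[leb2]_z (coord i z ^+ 2 * \1_(`]-oo, c[%classic) (norm2 z / d) * radial_kernel d z)%:E = \int[leb2]_z f z)%E.
  case: i => //; rewrite -(ge0_integral_leb2_swap mf f0).
  by apply: eq_integral => z _; rewrite /f/= /radial_kernel nswap.
have : (\int[leb2]_z f z + \int[leb2]_z f z = (Phi gamma c)%:E + (Phi gamma c)%:E)%E.
  rewrite -{2}(ge0_integral_leb2_swap mf f0).
  have mf' : measurable_fun setT (fun z : plane R => f (z.2, z.1)).
    by apply: (measurableT_comp mf); exact: measurable_fun_pair.
  rewrite -(ge0_integralD leb2 measurableT (fun z _ => f0 z) mf (fun z _ => f0 _) mf').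
  transitivity (\int[leb2]_z ((d ^+ 2 * (norm2 z / d) ^+ 2 * \1_(`]-oo, c[%classic) (norm2 z / d)) * radial_kernel d z)%:E)%E.
    apply: eq_integral => z _; rewrite /f/= nswap -EFinD; congr EFin.
    have -> : radial_kernel d (z.2, z.1) = radial_kernel d z by rewrite /radial_kernel nswap.
    rewrite -!mulrDl; congr (_ * _ * _); rewrite exprMn mulrCA -exprMn mulfV ?gt_eqF// expr1n mulr1.
    by rewrite /norm2 sqr_sqrtr// addr_ge0 ?sqr_ge0.
  rewrite (@radial_kernel_integral (fun s => d ^+ 2 * s ^+ 2 * \1_(`]-oo, c[%classic) s))//.
  - have pos s : (`]0, +oo[%classic : set R) s ->
        (0 <= (pi * s ^+ 3 * \1_(`]-oo, c[%classic) s * profile s)%:E)%E.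
      by rewrite /= in_itv/= andbT => s0; rewrite lee_fin mom_ge0.
    rewrite PhiE// -ge0_integralD//; last 2 first.
      exact: measurable_funTS (mmom c).
      exact: measurable_funTS (mmom c).
    rewrite -ge0_integralZl//; first last.
    + by rewrite lee_fin invr_ge0 exprn_ge0// ltW.
    + move=> s; rewrite /= in_itv/= andbT => s0.
      by have := profile_ge0 s; nneg.
    + apply: measurable_funTS; apply/measurable_EFinP.
      apply: measurable_funM measurable_profile; apply: measurable_funM.
        exact: measurable_funM.
      apply: measurable_funM => //; apply: measurable_funM => //; exact: measurable_funX.
    apply: eq_integral => s _; rewrite -EFinD -EFinM; congr EFin.
    by field; rewrite gt_eqF.
  - by apply: measurable_funM => //; apply: measurable_funM => //; exact: measurable_funX.
  - by move=> s; nneg.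
rewrite fi; case: (\int[leb2]_z f z)%E => [r||]//; rewrite -!EFinD => -[] h; congr EFin; lra.
Qed.

Lemma radial_kernel_mass d : 0 < d ->
  (\int[leb2]_z (radial_kernel d z)%:E = (d ^- 2 * mass0)%:E)%E.
Proof.
move=> d0; rewrite EFinM -mass0E.
transitivity (\int[leb2]_z (1 * radial_kernel d z)%:E)%E.
  by apply: eq_integral => z _; rewrite mul1r.
rewrite (@radial_kernel_integral (fun=> 1))//; congr (_ * _)%E.
by apply: eq_integral => s _; rewrite mulr1.
Qed.

Lemma mass0_ge0 : 0 <= mass0.
Proof.
rewrite -lee_fin -mass0E; apply: integral_ge0 => s; rewrite /= in_itv/= andbT => s0.
by have := profile_ge0 s; nneg.
Qed.

(** Near t = 1 the annulus lies in s >= 1/2, where 2 pi s <= 8 pi s^3: the mass is at most 8 (Phi(1)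
    - Phi(t)), and the difference quotient of Phi is eventually at most |l| + 1. For t <= 1 - e1 the
    total mass is at most (mass0 / e1) (1 - t). The constant adds the two cases. *)
Lemma radial_kernel_annulus (l : R) :
  (Phi gamma t - Phi gamma 1) / (t - 1) @[t --> 1^'-] --> l ->
  exists2 C : R, 0 < C & forall d t, 0 < d -> t <= 1 ->
  (\int[leb2]_z (\1_(`[t, +oo[%classic) (norm2 z / d) * radial_kernel d z)%:E
     <= (d ^- 2 * (C * (1 - t)))%:E)%E.
Proof.
move=> hl.
have [e0 e0_gt0 Phi_lip] : exists2 e : R, 0 < e & forall t, 1 - e < t <= 1 ->
    Phi gamma 1 - Phi gamma t <= (`|l| + 1) * (1 - t).
  have /cvgrPdist_lt/(_ 1 ltr01) := hl.
  move=> [e /= e0 he]; exists e => // t /andP[et]; rewrite le_eqVlt => /orP[/eqP ->|t1].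
    by rewrite !subrr mulr0.
  have := he t; rewrite /ball_/= gtr0_norm ?subr_gt0// => /(_ _ t1).
  have -> : 1 - t < e by lra.
  move=> /(_ isT) h.
  have : (Phi gamma t - Phi gamma 1) / (t - 1) <= `|l| + 1.
    have := ler_norm l; move: h; rewrite ltr_norml => /andP[]; lra.
  by rewrite -opprB -(opprB 1 t) invrN mulrNN ler_pdivrMr// subr_gt0.
pose e1 := Num.min e0 2^-1.
have e1_gt0 : 0 < e1 by rewrite lt_min e0_gt0 invr_gt0 ltr0n.
exists (8 * (`|l| + 1) + mass0 / e1).
  by rewrite ltr_wpDr ?divr_ge0 ?mass0_ge0 ?(ltW e1_gt0)// mulr_gt0// ltr_wpDl.
move=> d t d0 t1.
have mI : measurable_fun [set: R] (\1_(`[t, +oo[%classic) : R -> R) by [].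
rewrite (@radial_kernel_integral (\1_(`[t, +oo[%classic)) _ d0 mI)// EFinM.
apply: lee_wpmul2l; first by rewrite lee_fin invr_ge0 exprn_ge0// ltW.
have [tle|tgt] := leP t (1 - e1).
  apply: (@le_trans _ _ mass0%:E).
    rewrite -mass0E; apply: ge0_le_integral => //.
    - by move=> s; rewrite /= in_itv/= andbT => s0; rewrite lee_fin !mulr_ge0 ?pi_ge0 ?profile_ge0// ltW.
    - apply: measurable_funTS; apply/measurable_EFinP; apply: measurable_funM measurable_profile.
      by apply: measurable_funM => //; exact: measurable_funM.
    - apply: measurable_funTS; apply/measurable_EFinP; apply: measurable_funM measurable_profile.
      exact: measurable_funM.
    - move=> s; rewrite /= in_itv/= andbT => s0; rewrite lee_fin.
      apply: ler_wpM2r; first exact: profile_ge0.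
      by rewrite ler_piMr ?mulr_ge0 ?pi_ge0// ?(ltW s0)//.
  have t1' : 0 <= 1 - t by lra.
  rewrite lee_fin mulrDl ler_wpDl//; first by nneg.
  by rewrite -mulrA ler_peMr ?mass0_ge0// ler_pdivlMl// mulr1; lra.
have e1e0 : e1 <= e0 by rewrite ge_min lexx.
have e1h : e1 <= 2^-1 by rewrite ge_min lexx orbT.
have t01 : 0 <= t <= 1 by rewrite t1 andbT; lra.
pose f b s : R := pi * s ^+ 3 * \1_b s * profile s.
have V : (\int[mu]_(s in `]0%R, +oo[) (f `[t, +oo[%classic s)%:E = (Phi gamma 1 - Phi gamma t)%:E)%E.
  have mf b : measurable b -> measurable_fun setT (fun s => (f b s)%:E).
    move=> mb; apply/measurable_EFinP; apply: measurable_funM measurable_profile.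
    by apply: measurable_funM => //; apply: measurable_funM => //; exact: measurable_funX.
  have f0 b s : (`]0, +oo[%classic : set R) s -> (0 <= (f b s)%:E)%E.
    by rewrite /= in_itv/= andbT => s0; rewrite lee_fin mom_ge0.
  have : ((Phi gamma t)%:E + \int[mu]_(s in `]0%R, +oo[) (f `[t, +oo[%classic s)%:E = (Phi gamma 1)%:E)%E.
    rewrite !PhiE ?ler01 ?lexx// -ge0_integralD//.
    - apply: eq_integral => s _; rewrite -EFinD /f -mulrDl -mulrDr; congr EFin.
      have [s1|s1] := ltP s 1; last by rewrite profile_out ?mulr0.
      congr (_ * _ * _); rewrite !indicE !mem_setE !in_itv/= s1 andbT ltNge.
      by case: (t <= s) => /=; rewrite ?add0r ?addr0.
    - exact: f0.
    - exact: measurable_funTS (mf _ (measurable_itv _)).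
    - exact: f0.
    - exact: measurable_funTS (mf _ (measurable_itv _)).
  case: (\int[mu]_(s in _) _)%E => [r||]//; rewrite -EFinD => -[] h; congr EFin; lra.
apply: (@le_trans _ _ (8%:E * (Phi gamma 1 - Phi gamma t)%:E)%E); last first.
  have t1' : 0 <= 1 - t by lra.
  have m0 := mass0_ge0.
  have te : 1 - e0 < t <= 1 by rewrite t1 andbT; lra.
  have := Phi_lip t te; have : 0 <= mass0 / e1 * (1 - t) by nneg.
  rewrite -EFinM lee_fin; nra.
rewrite -V -ge0_integralZl//.
- apply: ge0_le_integral => //.
  + by move=> s; rewrite /= in_itv/= andbT => s0; rewrite lee_fin !mulr_ge0 ?pi_ge0 ?profile_ge0// ltW.
  + apply: measurable_funTS; apply/measurable_EFinP; apply: measurable_funM measurable_profile.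
    by apply: measurable_funM => //; exact: measurable_funM.
  + apply: measurable_funTS; apply/measurable_EFinP; apply: measurable_funM => //.
    apply: measurable_funM measurable_profile.
    by apply: measurable_funM => //; apply: measurable_funM => //; exact: measurable_funX.
  + move=> s; rewrite /= in_itv/= andbT => s0; rewrite -EFinM lee_fin /f !mulrA.
    apply: ler_wpM2r; first exact: profile_ge0.
    rewrite indicE mem_setE in_itv/= andbT; case: (leP t s) => ts /=; last by lra.
    have h1 : 0 <= pi * s by nneg.
    have h2 : 1 <= 4 * (s * s) by nra.
    by nra.
- apply: measurable_funTS; apply/measurable_EFinP; apply: measurable_funM measurable_profile.
  by apply: measurable_funM => //; apply: measurable_funM => //; exact: measurable_funX.
- by move=> s; rewrite /= in_itv/= andbT => s0; rewrite lee_fin mom_ge0.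
Qed.

End Profile.

(** * Inscribed polygons *)

Section Hull.
Context {R : realType}.
Implicit Types (A : set (plane R)) (p q x y z : plane R).

Lemma sub_conv_hull A : A `<=` conv_hull A.
Proof.
move=> x Ax; exists 1%N, (fun=> x), (fun=> 1); split => //.
  by rewrite big_ord1.
by rewrite big_ord1 scale1r.
Qed.

Lemma conv_hull_convex A p q (t : R) : 0 <= t <= 1 ->
  conv_hull A p -> conv_hull A q -> conv_hull A (p + t *: (q - p)).
Proof.
move=> /andP[t0 t1] [n [v [w [Av w0 w1 ->]]]] [m [v' [w' [Av' w'0 w'1 ->]]]].
exists (n + m)%N, (fun i => match fintype.split i with inl j => v j | inr j => v' j end),
  (fun i => match fintype.split i with inl j => (1 - t) * w j | inr j => t * w' j end).
have spl (T : Type) (f : 'I_n -> T) (g : 'I_m -> T) i :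
    match fintype.split (lshift m i) with inl j => f j | inr j => g j end = f i.
  by rewrite (unsplitK (inl _ i)).
have spr (T : Type) (f : 'I_n -> T) (g : 'I_m -> T) i :
    match fintype.split (rshift n i) with inl j => f j | inr j => g j end = g i.
  by rewrite (unsplitK (inr _ i)).
split.
- by move=> i; case: (fintype.split i).
- by move=> i; case: fintype.split => j; rewrite mulr_ge0// subr_ge0.
- rewrite big_split_ord/=.
  under eq_bigr do rewrite spl; under [X in _ + X]eq_bigr do rewrite spr.
  by rewrite -!mulr_sumr w1 w'1 !mulr1 subrK.
- rewrite big_split_ord/=.
  under [X in _ = X + _]eq_bigr do rewrite !spl -scalerA.
  under [X in _ = _ + X]eq_bigr do rewrite !spr -scalerA.
  rewrite -!scaler_sumr scalerBr scalerBl scale1r.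
  by rewrite -addrA [- _ + _]addrC.
Qed.

Lemma conv_hull_coord A (a b c : R) :
  (forall v, A v -> a * v.1 + b * v.2 <= c) ->
  forall p, conv_hull A p -> a * p.1 + b * p.2 <= c.
Proof.
move=> Ac p [n [v [w [Av w0 w1 ->]]]].
have s1 : (\sum_i w i *: v i).1 = \sum_i w i * (v i).1.
  by rewrite (big_morph (fun z : plane R => z.1) (id1 := 0) (op1 := +%R)).
have s2 : (\sum_i w i *: v i).2 = \sum_i w i * (v i).2.
  by rewrite (big_morph (fun z : plane R => z.2) (id1 := 0) (op1 := +%R)).
rewrite s1 s2 !mulr_sumr -big_split/= -[c]mulr1 -w1 mulr_sumr.
apply: ler_sum => i _; have := ler_wpM2l (w0 i) (Ac _ (Av i)); nra.
Qed.

End Hull.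

(** * Cocircular points and crossing chords *)

Section Circle.
Context {R : realType}.
Implicit Types (x y z p q u v : plane R) (d : R).

Definition cross (u v : plane R) : R := u.1 * v.2 - u.2 * v.1.
Definition sqdist (p q : plane R) : R := (q.1 - p.1) ^+ 2 + (q.2 - p.2) ^+ 2.

Lemma sqdistE p q : sqdist p q = dist2 p q ^+ 2.
Proof. by rewrite /dist2 /norm2 sqr_sqrtr// addr_ge0 ?sqr_ge0. Qed.

Lemma sqdist_eq0 p q : sqdist p q = 0 -> p = q.
Proof.
rewrite /sqdist => h.
have h1 : (q.1 - p.1) ^+ 2 = 0 by have := sqr_ge0 (q.1 - p.1); have := sqr_ge0 (q.2 - p.2); lra.
have h2 : (q.2 - p.2) ^+ 2 = 0 by lra.
move/eqP : h1; move/eqP : h2; rewrite !sqrf_eq0 !subr_eq0.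
by case: p q {h} => [a b] [c e] /= /eqP -> /eqP ->.
Qed.

(** A line meets a circle at most twice. With u = p - x, e = q - p and f = v - p, the circle gives 2
    u.e = -|e|^2 and 2 u.f = -|f|^2; if e and f are parallel, this forces |e|^2 = e.f = |f|^2, that
    is q = v. *)
Lemma cocircular_cross x d p q v : sqdist x p = d -> sqdist x q = d -> sqdist x v = d ->
  p <> q -> p <> v -> q <> v -> cross (q - p) (v - p) != 0.
Proof.
move=> xp xq xv pq pv qv; apply/eqP; rewrite /cross/= => c0.
set e1 := q.1 - p.1 in c0; set e2 := q.2 - p.2 in c0.
set f1 := v.1 - p.1 in c0; set f2 := v.2 - p.2 in c0.
set u1 := p.1 - x.1; set u2 := p.2 - x.2.
have hp : u1 ^+ 2 + u2 ^+ 2 = d by [].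
have hq : (u1 + e1) ^+ 2 + (u2 + e2) ^+ 2 = d by rewrite -xq /sqdist /u1 /e1 /u2 /e2; ring.
have hv : (u1 + f1) ^+ 2 + (u2 + f2) ^+ 2 = d by rewrite -xv /sqdist /u1 /f1 /u2 /f2; ring.
have e0 : e1 ^+ 2 + e2 ^+ 2 != 0 by apply/eqP => h; apply: pq; exact: sqdist_eq0.
have f0 : f1 ^+ 2 + f2 ^+ 2 != 0 by apply/eqP => h; apply: pv; exact: sqdist_eq0.
have he : 2 * (u1 * e1 + u2 * e2) = - (e1 ^+ 2 + e2 ^+ 2) by lra.
have hf : 2 * (u1 * f1 + u2 * f2) = - (f1 ^+ 2 + f2 ^+ 2) by lra.
have k1 : (e1 ^+ 2 + e2 ^+ 2) * (f1 ^+ 2 + f2 ^+ 2 - (e1 * f1 + e2 * f2)) = 0.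
  have p1 : (e1 ^+ 2 + e2 ^+ 2) * f1 = (e1 * f1 + e2 * f2) * e1.
    have -> : (e1 ^+ 2 + e2 ^+ 2) * f1 = (e1 * f1 + e2 * f2) * e1 - e2 * (e1 * f2 - e2 * f1) by ring.
    by rewrite c0; ring.
  have p2 : (e1 ^+ 2 + e2 ^+ 2) * f2 = (e1 * f1 + e2 * f2) * e2.
    have -> : (e1 ^+ 2 + e2 ^+ 2) * f2 = (e1 * f1 + e2 * f2) * e2 + e1 * (e1 * f2 - e2 * f1) by ring.
    by rewrite c0; ring.
  have -> : (e1 ^+ 2 + e2 ^+ 2) * (f1 ^+ 2 + f2 ^+ 2 - (e1 * f1 + e2 * f2)) =
    (e1 ^+ 2 + e2 ^+ 2) * - (2 * (u1 * f1 + u2 * f2)) + (e1 * f1 + e2 * f2) * - (e1 ^+ 2 + e2 ^+ 2) by rewrite hf; ring.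
  rewrite -he.
  have -> : (e1 ^+ 2 + e2 ^+ 2) * - (2 * (u1 * f1 + u2 * f2)) =
    - 2 * (u1 * ((e1 ^+ 2 + e2 ^+ 2) * f1) + u2 * ((e1 ^+ 2 + e2 ^+ 2) * f2)) by ring.
  by rewrite p1 p2; ring.
have k2 : (f1 ^+ 2 + f2 ^+ 2) * (e1 ^+ 2 + e2 ^+ 2 - (e1 * f1 + e2 * f2)) = 0.
  have p1 : (f1 ^+ 2 + f2 ^+ 2) * e1 = (e1 * f1 + e2 * f2) * f1.
    have -> : (f1 ^+ 2 + f2 ^+ 2) * e1 = (e1 * f1 + e2 * f2) * f1 + f2 * (e1 * f2 - e2 * f1) by ring.
    by rewrite c0; ring.
  have p2 : (f1 ^+ 2 + f2 ^+ 2) * e2 = (e1 * f1 + e2 * f2) * f2.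
    have -> : (f1 ^+ 2 + f2 ^+ 2) * e2 = (e1 * f1 + e2 * f2) * f2 - f1 * (e1 * f2 - e2 * f1) by ring.
    by rewrite c0; ring.
  have -> : (f1 ^+ 2 + f2 ^+ 2) * (e1 ^+ 2 + e2 ^+ 2 - (e1 * f1 + e2 * f2)) =
    (f1 ^+ 2 + f2 ^+ 2) * - (2 * (u1 * e1 + u2 * e2)) + (e1 * f1 + e2 * f2) * - (f1 ^+ 2 + f2 ^+ 2) by rewrite he; ring.
  rewrite -hf.
  have -> : (f1 ^+ 2 + f2 ^+ 2) * - (2 * (u1 * e1 + u2 * e2)) =
    - 2 * (u1 * ((f1 ^+ 2 + f2 ^+ 2) * e1) + u2 * ((f1 ^+ 2 + f2 ^+ 2) * e2)) by ring.
  by rewrite p1 p2; ring.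
move/eqP : k1; rewrite mulf_eq0 (negbTE e0)/= => /eqP k1.
move/eqP : k2; rewrite mulf_eq0 (negbTE f0)/= => /eqP k2.
apply: qv; apply: sqdist_eq0.
have -> : sqdist q v = (f1 ^+ 2 + f2 ^+ 2 - (e1 * f1 + e2 * f2)) + (e1 ^+ 2 + e2 ^+ 2 - (e1 * f1 + e2 * f2)).
  by rewrite /sqdist /f1 /e1 /f2 /e2; ring.
by rewrite k1 k2 addr0.
Qed.

(* A chord meets the line through U and V only inside the disc, hence between U and V. *)
Lemma chords_cross x d U V Y Z : sqdist x U = d -> sqdist x V = d ->
    sqdist x Y = d -> sqdist x Z = d ->
    cross (V - U) (Y - U) * cross (V - U) (Z - U) < 0 ->
  exists s t : R, [/\ 0 < s < 1, 0 < t < 1 & U + s *: (V - U) = Y + t *: (Z - Y)].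
Proof.
move=> xU xV xY xZ; set gY := cross _ _; set gZ := cross _ (Z - U) => gYZ.
have gn : gY - gZ != 0.
  by rewrite subr_eq0; apply/eqP => h; move: gYZ; rewrite h; nra.
(* The parameter at which the affine function [cross (V - U) (. - U)] vanishes on the chord from [Y]
   to [Z]. *)
pose t := gY / (gY - gZ).
have t01 : 0 < t < 1.
  rewrite /t; have [g0|g0] := ltP 0 (gY - gZ).
    rewrite ltr_pdivrMr// mul1r divr_gt0//; nra.
  have g0' : gY - gZ < 0 by rewrite lt_neqAle gn.
  rewrite ltr_ndivrMr// mul1r; apply/andP; split; last by nra.
  by rewrite nmulr_rgt0 ?invr_lt0//; nra.
have [zz [zzE [zY1 zY2]]] : exists zz : plane R, zz = Y + t *: (Z - Y) /\
    zz.1 = Y.1 + t * (Z.1 - Y.1) /\ zz.2 = Y.2 + t * (Z.2 - Y.2).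
  by exists (Y + t *: (Z - Y)).
have UV : sqdist U V != 0.
  apply/eqP => /sqdist_eq0 h; move: gYZ; rewrite /gY /gZ h /cross/=; nra.
have line : cross (V - U) (zz - U) = 0.
  have -> : cross (V - U) (zz - U) = gY - t * (gY - gZ).
    by rewrite /gY /gZ /cross/= zY1 zY2; ring.
  by rewrite /t divfK// subrr.
pose E1 := V.1 - U.1; pose E2 := V.2 - U.2.
pose s := ((zz.1 - U.1) * E1 + (zz.2 - U.2) * E2) / sqdist U V.
have z1 : zz.1 = U.1 + s * E1.
  apply: (mulfI UV); rewrite mulrDr mulrA [_ * s]mulrC divfK//.
  have := line; rewrite /cross /sqdist/= -/E1 -/E2 => l.
  have -> : (E1 ^+ 2 + E2 ^+ 2) * zz.1 = (E1 ^+ 2 + E2 ^+ 2) * U.1 +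
     ((zz.1 - U.1) * E1 + (zz.2 - U.2) * E2) * E1 - E2 * (E1 * (zz.2 - U.2) - E2 * (zz.1 - U.1)) by ring.
  by rewrite l; ring.
have z2 : zz.2 = U.2 + s * E2.
  apply: (mulfI UV); rewrite mulrDr mulrA [_ * s]mulrC divfK//.
  have := line; rewrite /cross /sqdist/= -/E1 -/E2 => l.
  have -> : (E1 ^+ 2 + E2 ^+ 2) * zz.2 = (E1 ^+ 2 + E2 ^+ 2) * U.2 +
     ((zz.1 - U.1) * E1 + (zz.2 - U.2) * E2) * E2 + E1 * (E1 * (zz.2 - U.2) - E2 * (zz.1 - U.1)) by ring.
  by rewrite l; ring.
exists s, t; split=> //; last first.
  rewrite -zzE; apply/esym; rewrite (surjective_pairing zz) z1 z2.
  by rewrite (surjective_pairing U).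
have YZ0 : 0 < sqdist Y Z.
  rewrite lt_neqAle eq_sym; apply/andP; split; last by rewrite addr_ge0 ?sqr_ge0.
  apply/eqP => /sqdist_eq0 h; move: gn; rewrite /gY /gZ h subrr eqxx//.
(* The power of the point [zz] with respect to the circle, computed on each chord: s (1 - s) |UV|^2
   = t (1 - t) |YZ|^2 > 0, so [s] lies in ]0, 1[ as well. *)
have inY : sqdist x zz = d - t * (1 - t) * sqdist Y Z.
  have -> : d - t * (1 - t) * sqdist Y Z =
     (1 - t) * sqdist x Y + t * sqdist x Z - t * (1 - t) * sqdist Y Z by rewrite xY xZ; ring.
  by rewrite /sqdist zY1 zY2; ring.
have inU : sqdist x zz = d - s * (1 - s) * sqdist U V.
  have -> : d - s * (1 - s) * sqdist U V =
     (1 - s) * sqdist x U + s * sqdist x V - s * (1 - s) * sqdist U V by rewrite xU xV; ring.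
  by rewrite /sqdist z1 z2 /E1 /E2; ring.
have UV0 : 0 < sqdist U V.
  by rewrite lt_neqAle eq_sym UV addr_ge0 ?sqr_ge0.
have : 0 < s * (1 - s).
  rewrite -(pmulr_lgt0 _ UV0).
  have -> : s * (1 - s) * sqdist U V = t * (1 - t) * sqdist Y Z by lra.
  by case/andP: t01 => t0 t1; apply: mulr_gt0 => //; apply: mulr_gt0 => //; rewrite subr_gt0.
by move=> h; apply/andP; split; nra.
Qed.

Lemma sign_change (f : nat -> R) a b : (a <= b)%N ->
  (forall k, (a <= k <= b)%N -> f k != 0) -> f a * f b < 0 ->
  exists2 k, (a <= k < b)%N & f k * f k.+1 < 0.
Proof.
move=> ab; rewrite -(subnKC ab); elim: (b - a)%N => [|m IH] nz.
  by rewrite addn0; have := sqr_ge0 (f a); rewrite expr2 leNgt => /negbTE ->.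
rewrite addnS => fab.
have fm : f (a + m)%N != 0 by apply: nz; rewrite leq_addr addnS leqnSn.
have [h|h] := ltP (f a * f (a + m)%N) 0.
  have [k /andP[ak km] fk] := IH (fun k h => nz k ltac:(by case/andP: h => -> /= h; rewrite addnS (leq_trans h)//)) h.
  by exists k => //; rewrite ak/= ltnS ltnW.
exists (a + m)%N; first by rewrite leq_addr ltnS leqnn.
have fa : f a != 0 by apply: nz; rewrite leqnn addnS leqW// leq_addr.
have h' : 0 < f a * f (a + m)%N by rewrite lt_neqAle eq_sym mulf_neq0.
have fa2 : 0 < f a ^+ 2 by rewrite exprn_even_gt0//.
rewrite -(pmulr_rlt0 _ fa2).
have -> : f a ^+ 2 * (f (a + m)%N * f (a + m).+1) = (f a * f (a + m)%N) * (f a * f (a + m).+1) by ring.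
by rewrite pmulr_rlt0.
Qed.

End Circle.

(** * Edges of an inscribed polygon and the disc that it contains *)

Section InscribedPolygon.
Context {R : realType}.
Variables (x : plane R) (d : R) (s : seq (plane R)).
Hypothesis ins : inscribed x d s.

Let n := size s.
(** Indices are taken modulo the number of sides, so that neighbours always have consecutive
    indices. *)
Definition vertex (k : nat) : plane R := s`_(k %% n).
Let P := vertex.

Let n_gt0 : (0 < n)%N. Proof. by have [[]] := ins. Qed.

Let ltn_modn k : (k %% n < n)%N. Proof. by rewrite ltn_mod. Qed.

Let next_vertexE k : next_vertex s (k %% n) = P k.+1.
Proof. by rewrite /next_vertex /P /vertex -/n -addn1 modnDml addn1. Qed.

Lemma vertex_edge k (t : R) : 0 <= t < 1 -> edge s (k %% n) (P k + t *: (P k.+1 - P k)).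
Proof. by move=> t01; exists t; rewrite ?next_vertexE//= in_itv. Qed.

Let edge_disj i j z : edge s (i %% n) z -> edge s (j %% n) z -> (i = j %[mod n])%N.
Proof.
move=> iz jz; apply/eqP/negPn/negP => /eqP ij.
have [[_ _ dis] _] := ins; have := dis _ _ (ltn_modn i) (ltn_modn j) ij.
by move=> /seteqP[/(_ z (conj iz jz))].
Qed.

(** Each vertex lies on its own half-open edge, and distinct edges are disjoint. *)
Lemma vertex_inj i j : P i = P j -> (i = j %[mod n])%N.
Proof.
move=> Pij; have t0 : 0 <= (0 : R) < 1 by rewrite lexx ltr01.
apply: (@edge_disj _ _ (P i)).
  by have := vertex_edge i t0; rewrite scale0r addr0.
by rewrite Pij; have := vertex_edge j t0; rewrite scale0r addr0.
Qed.

Lemma vertex_sqdist k : sqdist x (P k) = d ^+ 2.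
Proof. by rewrite sqdistE; have [_ -> //] := ins; rewrite mem_nth. Qed.

Lemma vertex_in v : v \in s -> exists i, v = P i.
Proof.
move=> vs; exists (index v s); rewrite /P /vertex modn_small ?nth_index//.
by rewrite index_mem.
Qed.

Lemma vertex_side k : dist2 (P k) (P k.+1) <= longest_side s.
Proof.
rewrite /longest_side; have := le_bigmax 0 (fun i : 'I_n => dist2 s`_i (next_vertex s i)) (Ordinal (ltn_modn k)).
by rewrite /= next_vertexE.
Qed.

Let edges_disj i j (t u : R) : 0 <= t < 1 -> 0 <= u < 1 -> (i != j %[mod n])%N ->
  P i + t *: (P i.+1 - P i) <> P j + u *: (P j.+1 - P j).
Proof.
move=> t01 u01 /eqP ij e; apply: ij.
by apply: edge_disj (vertex_edge _ t01) _; rewrite e; exact: vertex_edge.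
Qed.

(** If the ends of edge j were strictly on both sides of the line through edge i, the two chords
    would cross at an interior point of both, by [chords_cross]. *)
Let no_cross i j : (i != j %[mod n])%N ->
  0 <= cross (P i.+1 - P i) (P j - P i) * cross (P i.+1 - P i) (P j.+1 - P i).
Proof.
move=> ij; rewrite leNgt; apply/negP => h.
have [t [u [/andP[t0 t1] /andP[u0 u1] e]]] := chords_cross (vertex_sqdist i)
  (vertex_sqdist i.+1) (vertex_sqdist j) (vertex_sqdist j.+1) h.
by apply: (edges_disj _ _ ij e); rewrite ?t1 ?u1 ltW.
Qed.

Let vertex_cross i j k : (i != j %[mod n])%N -> (i != k %[mod n])%N -> (j != k %[mod n])%N ->
  cross (P j - P i) (P k - P i) != 0.
Proof.
move=> ij ik jk; apply: (cocircular_cross (vertex_sqdist i) (vertex_sqdist j) (vertex_sqdist k));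
  by move=> /vertex_inj /eqP; rewrite ?(negbTE ij) ?(negbTE ik) ?(negbTE jk).
Qed.

Let modDneq i a b : (a < b < a + n)%N -> (i + a != i + b %[mod n])%N.
Proof.
move=> /andP[ab ban]; rewrite eqn_modDl eq_sym eqn_mod_dvd ?(ltnW ab)//.
apply/negP => /dvdn_leq; rewrite subn_gt0 => /(_ ab).
by rewrite leqNgt ltn_subLR ?(ltnW ab)// ban.
Qed.

Let PDn i : P (i + n) = P i.
Proof. by rewrite /P /vertex modnDr. Qed.

(* If all other vertices lie on one side of the line through P i and P (i + m), an edge
   at P i separates P (i + m) from the other neighbour of P i unless the two vertices
   are neighbours, and the polyline would have to cross that edge. *)
Lemma supporting_edge (i m : nat) (e : R) : (0 < m < n)%N ->
  (forall k, (k != i %[mod n])%N -> (k != i + m %[mod n])%N ->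
     0 < e * cross (P (i + m) - P i) (P k - P i)) ->
  m = 1%N \/ m = n.-1.
Proof.
move=> /andP[m0 mn] side; apply: contrapT => /not_orP[/eqP m1 /eqP mn1].
have m2 : (1 < m)%N by rewrite ltn_neqAle eq_sym m1.
have mn2 : (m < n.-1)%N by rewrite ltn_neqAle mn1 -ltnS prednK.
have n1 : n.-1.+1 = n by rewrite prednK.
pose W k := P (i + k).
have W0 : P i = W 0%N by rewrite /W addn0.
have Wn : W n = W 0%N by rewrite /W PDn addn0.
pose c a b := cross (W a - W 0%N) (W b - W 0%N).
have cC a b : c a b = - c b a by rewrite /c /cross; ring.
have sideW k : (0 < k < n)%N -> k != m -> 0 < e * c m k.
  move=> /andP[k0 kn] km; rewrite /c -W0; apply: side.
    by rewrite -{2}(addn0 i) eq_sym; apply: modDneq; rewrite k0 add0n.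
  move: km; rewrite neq_ltn => /orP[km|mk].
    by apply: modDneq; rewrite km ltn_addl.
  by rewrite eq_sym; apply: modDneq; rewrite mk ltn_addl.
have c0 a b : (0 < a < n)%N -> (0 < b < n)%N -> a != b -> c a b != 0.
  move=> /andP[a0 an] /andP[b0 bn] ab; rewrite /c -W0; apply: vertex_cross.
  - by rewrite -{1}(addn0 i); apply: modDneq; rewrite a0 add0n.
  - by rewrite -{1}(addn0 i); apply: modDneq; rewrite b0 add0n.
  - move: ab; rewrite neq_ltn => /orP[ab|ba].
      by apply: modDneq; rewrite ab ltn_addl.
    by rewrite eq_sym; apply: modDneq; rewrite ba ltn_addl.
have I1 : (0 < 1 < n)%N by rewrite (leq_trans m2)// ltnW.
have In : (0 < n.-1 < n)%N by rewrite -n1 ltnS leqnn andbT; case: (n) I1 => [|[]].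
have n1n : (1 != n.-1)%N by rewrite neq_ltn (leq_trans m2)// ltnW.
have s1 := sideW 1%N I1 (ltac:(by rewrite eq_sym)).
have sn := sideW n.-1 In (ltac:(by rewrite eq_sym)).
have c1n := c0 1%N n.-1 I1 In n1n.
(* This sign tells which edge at [W 0] separates [W m] from the other neighbour of [W 0]. If it is
   the edge to [W 1], the path from [W m] to [W n.-1] has to change sides; otherwise the path from
   [W 1] to [W m] changes sides with respect to the edge from [W n.-1]. Either way some edge of the
   path contradicts [no_cross]. *)
have [h|h] := ltP 0 (e * c 1%N n.-1).
- have : c 1%N m * c 1%N n.-1 < 0.
    rewrite (cC 1%N m); have [e0|e0|e0] := ltgtP e 0; last by move: h; rewrite e0 mul0r ltxx.
      by move: h s1; rewrite !nmulr_rgt0//; nra.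
    by move: h s1; rewrite !pmulr_rgt0//; nra.
  move=> /(sign_change (ltnW mn2) (f := c 1%N)) [k /andP[mk kn]|k /andP[mk kn]].
    apply: c0 => //; first by rewrite (leq_trans m0)//= -n1 ltnS.
    by rewrite neq_ltn (leq_trans m2).
  have := @no_cross i (i + k); rewrite -[i.+1]addn1 -[(i + k).+1]addnS -/(W 1%N) -/(W k) -/(W k.+1) W0.
  rewrite -/(c 1%N k) -/(c 1%N k.+1) leNgt => + h'; rewrite h' => /(_ _)/negP; apply => //.
  rewrite -{1}(addn0 i); apply: modDneq; rewrite (leq_trans m0)//= add0n.
  by rewrite (leq_trans kn)// leq_pred.
- have h1 : e * c 1%N n.-1 < 0.
    rewrite lt_neqAle h andbT mulf_neq0//; apply/eqP => e0; move: s1; rewrite e0 mul0r ltxx//.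
  have : c n.-1 1%N * c n.-1 m < 0.
    rewrite (cC n.-1 1%N) (cC n.-1 m); have [e0|e0|e0] := ltgtP e 0; last by move: h1; rewrite e0 mul0r ltxx.
      by move: h1 sn; rewrite nmulr_rgt0// nmulr_rlt0//; nra.
    by move: h1 sn; rewrite pmulr_rgt0// pmulr_rlt0//; nra.
  move=> /(sign_change (ltnW m2) (f := c n.-1)) [k /andP[mk kn]|k /andP[mk kn]].
    apply: c0 => //; first by rewrite mk (leq_ltn_trans kn).
    by rewrite neq_ltn (leq_ltn_trans kn)// orbT.
  have := @no_cross (i + n.-1) (i + k); rewrite -!addnS n1 -/(W n.-1) -/(W n) Wn -/(W k) -/(W k.+1).
  have E a : cross (W 0%N - W n.-1) (W a - W n.-1) = - c n.-1 a.
    by rewrite /c /cross/=; ring.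
  rewrite !E mulrNN leNgt => + h'; rewrite h' => /(_ _)/negP; apply => //.
  rewrite eq_sym; apply: modDneq; rewrite (leq_trans kn)//= ?(ltnW mn2)//.
  by rewrite ltn_addl//; case/andP: In.
Qed.


(* Among the segments joining vertices on both sides of the line through x and y, the
   one that meets this line farthest in the direction of y is an edge. *)
Lemma inscribed_region (r : R) y : 0 < r -> disc x r `<=` region s ->
  sqdist x y < d ^+ 2 - longest_side s ^+ 2 / 4 -> region s y.
Proof.
move=> r0 xr yd.
have xhull : region s x.
  apply: xr; rewrite /disc/= /dist2 subrr /norm2/= !expr0n addr0 sqrtr0//.
have [->//|/eqP xy] := eqVneq y x.
pose w1 := y.1 - x.1; pose w2 := y.2 - x.2.
pose m := sqdist x y.
have m0 : 0 < m.
  rewrite lt_neqAle eq_sym addr_ge0 ?sqr_ge0// andbT; apply/eqP => /sqdist_eq0 h.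
  exact: xy.
have mE : m = w1 ^+ 2 + w2 ^+ 2 by [].
(* Coordinates centred at x, along and across y - x, both multiplied by |y - x|: the point y has a =
   m and b = 0. *)
pose a (v : plane R) := w1 * (v.1 - x.1) + w2 * (v.2 - x.2).
pose b (v : plane R) := w1 * (v.2 - x.2) - w2 * (v.1 - x.1).
have ab k : a (P k) ^+ 2 + b (P k) ^+ 2 = m * d ^+ 2.
  by rewrite -(vertex_sqdist k) mE /sqdist /a /b; ring.
(* Shrinks vectors of length sqrt m to length r / 2, which stay in the disc contained in the
   polygon. *)
pose ep := r / (2 * Num.sqrt m).
have sm0 : 0 < Num.sqrt m by rewrite sqrtr_gt0.
have ep0 : 0 < ep by rewrite divr_gt0// mulr_gt0.
have inhull (c1 c2 : R) : c1 ^+ 2 + c2 ^+ 2 = m -> region s (x.1 + ep * c1, x.2 + ep * c2).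
  move=> c12; apply: xr; rewrite /disc/= /dist2 /norm2/=.
  have -> : (x.1 + ep * c1 - x.1) ^+ 2 + (x.2 + ep * c2 - x.2) ^+ 2 = (r / 2) ^+ 2.
    have -> : (x.1 + ep * c1 - x.1) ^+ 2 + (x.2 + ep * c2 - x.2) ^+ 2 = ep ^+ 2 * (c1 ^+ 2 + c2 ^+ 2) by ring.
    by rewrite c12 -(sqr_sqrtr (ltW m0)) /ep; field; rewrite gt_eqF.
  by rewrite sqrtr_sqr ger0_norm; lra.
have hull_lin (c1 c2 c3 : R) : (forall k, c1 * (P k).1 + c2 * (P k).2 <= c3) ->
    forall p, region s p -> c1 * p.1 + c2 * p.2 <= c3.
  move=> H; apply: conv_hull_coord => v /= vs.
  by have [k ->] := vertex_in vs; exact: H.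
have PI k : P (Ordinal (ltn_modn k)) = P k by rewrite /P /vertex/= -/n modn_mod.
(* Otherwise all vertices, and with them the hull, would lie in the half-plane b <= 0, which does
   not contain a disc about x. The same argument gives [bneg]. *)
have bpos : exists i : 'I_n, 0 < b (P i).
  apply: contrapT => /forallNP nb.
  have bk k : - w2 * (P k).1 + w1 * (P k).2 <= w1 * x.2 - w2 * x.1.
    rewrite leNgt; apply/negP => h; apply: (nb (Ordinal (ltn_modn k))).
    by rewrite PI /b; lra.
  have h : (- w2) ^+ 2 + w1 ^+ 2 = m by rewrite mE; ring.
  have := hull_lin _ _ _ bk _ (inhull _ _ h); have := mulr_gt0 ep0 m0; rewrite mE /=; nra.
have bneg : exists i : 'I_n, b (P i) < 0.
  apply: contrapT => /forallNP nb.
  have bk k : w2 * (P k).1 + (- w1) * (P k).2 <= w2 * x.1 - w1 * x.2.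
    rewrite leNgt; apply/negP => h; apply: (nb (Ordinal (ltn_modn k))).
    by rewrite PI /b; lra.
  have h : w2 ^+ 2 + (- w1) ^+ 2 = m by rewrite mE; ring.
  have := hull_lin _ _ _ bk _ (inhull _ _ h); have := mulr_gt0 ep0 m0; rewrite mE /=; nra.
have Ph k : region s (P k) by apply: sub_conv_hull; rewrite /= mem_nth.
(* By convexity it is enough to find a point of the hull on the ray from x through y, at y or
   beyond. *)
have toy z : region s z -> b z = 0 -> m <= a z -> region s y.
  move=> zs bz az; have a0 : 0 < a z by apply: lt_le_trans az.
  have -> : y = x + (m / a z) *: (z - x).
    have z1 : m * (z.1 - x.1) = a z * w1.
      have -> : m * (z.1 - x.1) = w1 * a z - w2 * b z by rewrite mE /a /b; ring.
      by rewrite bz; ring.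
    have z2 : m * (z.2 - x.2) = a z * w2.
      have -> : m * (z.2 - x.2) = w2 * a z + w1 * b z by rewrite mE /a /b; ring.
      by rewrite bz; ring.
    rewrite (surjective_pairing (x + _)) [LHS]surjective_pairing; congr pair => /=.
      rewrite /GRing.scale/= mulrAC z1 mulrAC mulfV ?gt_eqF// mul1r /w1; ring.
    rewrite /GRing.scale/= mulrAC z2 mulrAC mulfV ?gt_eqF// mul1r /w2; ring.
  apply: conv_hull_convex => //; rewrite divr_ge0 ?(ltW m0) ?(ltW a0)//=.
  by rewrite ler_pdivrMr// mul1r.
have md : m < d ^+ 2.
  by apply: lt_le_trans yd _; have := sqr_ge0 (longest_side s); lra.
have [[k [bk ak]]|nk] := pselect (exists k, b (P k) = 0 /\ 0 < a (P k)).
  apply: (toy (P k)) => //; rewrite -(ler_sqr (ltW m0) (ltW ak)).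
  have := ab k; rewrite bk expr0n addr0 => ->; rewrite expr2 ler_pM2l//; exact: ltW.
have [i0 bi0] := bpos; have [j0 bj0] := bneg.
pose pr (ij : 'I_n * 'I_n) := (0 < b (P ij.1)) && (b (P ij.2) < 0).
(* The value of [a] at the point where the segment from [P i] to [P j] meets the line b = 0. *)
pose F (ij : 'I_n * 'I_n) := (b (P ij.1) * a (P ij.2) - b (P ij.2) * a (P ij.1)) / (b (P ij.1) - b (P ij.2)).
have pr0 : pr (i0, j0) by rewrite /pr bi0 bj0.
case: (Order.TotalTheory.arg_maxP F pr0) => -[i j] /andP[/= bp bq] Fmax.
set p := P i in bp Fmax; set q := P j in bq Fmax.
pose L (v : plane R) := (b p - b q) * a v - (a p - a q) * b v - (b p * a q - b q * a p).
have bpq : 0 < b p - b q by lra.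
have LE v : L v = m * cross (q - p) (v - p).
  by rewrite /L /cross mE /a /b/=; ring.
(* [L] vanishes on the line through p and q. A vertex beyond this line could replace p or q,
   whichever is on its side, and increase [F]. So the line supports the polygon, and
   [supporting_edge] makes pq an edge. *)
have Lk k : L (P k) <= 0.
  have [bk|bk|bk] := ltgtP (b (P k)) 0.
  - have := Fmax (i, Ordinal (ltn_modn k)); rewrite /pr /F/= PI bp bk => /(_ isT).
    have bpk : 0 < b p - b (P k) by lra.
    rewrite ler_pdivrMr// mulrAC ler_pdivlMr// => h.
    rewrite -(pmulr_rle0 _ bp); rewrite /L; nra.
  - have := Fmax (Ordinal (ltn_modn k), j); rewrite /pr /F/= PI bq bk => /(_ isT).
    have bpk : 0 < b (P k) - b q by lra.
    rewrite ler_pdivrMr// mulrAC ler_pdivlMr// => h.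
    have bq' : 0 < - b q by lra.
    rewrite -(pmulr_rle0 _ bq'); rewrite /L; nra.
  (* A vertex with b = 0 lies behind x here; being on the circle it has the largest |a|, hence the
     least [a] of all vertices. *)
  - have ak : a (P k) <= 0 by rewrite leNgt; apply/negP => ak; apply: nk; exists k.
    have amin l : a (P k) <= a (P l).
      have h : a (P l) ^+ 2 <= a (P k) ^+ 2.
        have := ab k; have := ab l; rewrite bk expr0n addr0 => hl ->.
        by have := sqr_ge0 (b (P l)); lra.
      rewrite leNgt; apply/negP => hl.
      have : (- a (P k)) ^+ 2 < (- a (P l)) ^+ 2 by rewrite ltr_sqr ?nnegrE; lra.
      by rewrite !sqrrN; lra.
    have := amin i; have := amin j; rewrite -/p -/q /L bk => h1 h2; nra.
pose dm := ((j + (n - i)) %% n)%N.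
have iE : (i + dm = j %[mod n])%N.
  by rewrite /dm modnDmr addnCA subnKC ?modnDr// ltnW.
have dm0 : (0 < dm < n)%N.
  rewrite ltn_modn andbT lt0n; apply/eqP => d0; move: iE; rewrite d0 addn0 => iE.
  have e : p = q by rewrite /p /q /P /vertex -/n iE.
  by move: bp bq; rewrite e; lra.
have Pq : P (i + dm)%N = q by rewrite /q /P /vertex -/n iE.
have side k : (k != i %[mod n])%N -> (k != i + dm %[mod n])%N ->
    0 < -1 * cross (P (i + dm)%N - P i) (P k - P i).
  move=> ki kd; rewrite mulN1r oppr_gt0 Pq lt_neqAle -(pmulr_rle0 _ m0) -LE Lk andbT.
  rewrite -Pq; apply: vertex_cross.
  - have := modDneq i (a := 0) (b := dm); rewrite addn0 add0n; exact.
  - by rewrite eq_sym.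
  - by rewrite eq_sym.
have pqH : sqdist p q <= longest_side s ^+ 2.
  have [e|e] := supporting_edge dm0 side.
    move: Pq; rewrite e addn1 => <-; rewrite sqdistE.
    by have := vertex_side i; have := norm2_ge0 (P i.+1 - P i); rewrite -/(dist2 _ _) => h0 h1; apply: lerXn2r => //; rewrite nnegrE (le_trans h0).
  have -> : p = P (i + dm).+1 by rewrite -addnS e prednK// PDn.
  rewrite -Pq (_ : sqdist _ _ = sqdist (P (i + dm)%N) (P (i + dm).+1)); last by rewrite /sqdist; ring.
  rewrite sqdistE.
  by have := vertex_side (i + dm)%N; have := norm2_ge0 (P (i + dm).+1 - P (i + dm)%N);
    rewrite -/(dist2 _ _) => h0 h1; apply: lerXn2r => //; rewrite nnegrE (le_trans h0).
(* The point x + ep (y - x) of the hull satisfies [L] <= 0 too, which puts the crossing point [z]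
   below strictly in front of x. *)
have lin : (b p - b q) * (ep * m) <= b p * a q - b q * a p.
  pose c1 := (b p - b q) * w1 + (a p - a q) * w2; pose c2 := (b p - b q) * w2 - (a p - a q) * w1.
  have := hull_lin c1 c2 (b p * a q - b q * a p + c1 * x.1 + c2 * x.2).
  have LP k : c1 * (P k).1 + c2 * (P k).2 <= b p * a q - b q * a p + c1 * x.1 + c2 * x.2.
    have := Lk k; have -> : L (P k) = c1 * ((P k).1 - x.1) + c2 * ((P k).2 - x.2) - (b p * a q - b q * a p).
      by rewrite /L /c1 /c2 [a (P k)]/a [b (P k)]/b; ring.
    lra.
  move=> /(_ LP _ (inhull w1 w2 (esym mE))) /=.
  have -> : c1 * (x.1 + ep * w1) + c2 * (x.2 + ep * w2) = c1 * x.1 + c2 * x.2 + (b p - b q) * (ep * m).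
    by rewrite /c1 /c2 mE; ring.
  lra.
pose lam := b p / (b p - b q).
pose z : plane R := p + lam *: (q - p).
have lam01 : 0 <= lam <= 1.
  by rewrite divr_ge0 ?(ltW bp) ?(ltW bpq)//= ler_pdivrMr// mul1r; lra.
have zE1 : z.1 = p.1 + lam * (q.1 - p.1) by [].
have zE2 : z.2 = p.2 + lam * (q.2 - p.2) by [].
have az : a z = a p + lam * (a q - a p) by rewrite /a zE1 zE2; ring.
have bz : b z = 0.
  have -> : b z = b p + lam * (b q - b p) by rewrite /b zE1 zE2; ring.
  by rewrite /lam; field; rewrite gt_eqF.
have az0 : 0 < a z.
  have -> : a z = (b p * a q - b q * a p) / (b p - b q) by rewrite az /lam; field; rewrite gt_eqF.
  by rewrite divr_gt0//; have := mulr_gt0 bpq (mulr_gt0 ep0 m0); lra.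
apply: (toy z) => //; first by apply: conv_hull_convex => //; exact: Ph.
rewrite -(ler_sqr (ltW m0) (ltW az0)).
have -> : a z ^+ 2 = m * sqdist x z.
  have -> : m * sqdist x z = a z ^+ 2 + b z ^+ 2 by rewrite mE /sqdist /a /b; ring.
  by rewrite bz; ring.
rewrite expr2 ler_pM2l//.
(* With both ends on the circle this is d^2 - lam (1 - lam) |pq|^2, which is at least d^2 - H^2 / 4
   for the longest side H, as lam (1 - lam) <= 1/4. *)
have -> : sqdist x z = (1 - lam) * sqdist x p + lam * sqdist x q - lam * (1 - lam) * sqdist p q.
  by rewrite /sqdist zE1 zE2; ring.
rewrite !vertex_sqdist.
have : lam * (1 - lam) * sqdist p q <= longest_side s ^+ 2 / 4.
  have h1 : lam * (1 - lam) <= 1 / 4 by have := sqr_ge0 (lam - 1 / 2); lra.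
  have h2 : 0 <= lam * (1 - lam) by case/andP: lam01 => ? ?; apply: mulr_ge0 => //; lra.
  have h3 : 0 <= sqdist p q by rewrite addr_ge0 ?sqr_ge0.
  by nra.
by move: yd; rewrite -/m; lra.
Qed.

End InscribedPolygon.

(** * Collars *)

Section Enlarged.
Context {R : realType}.
Implicit Types (Omega A : set (plane R)) (x y z b : plane R) (d : R).

Lemma continuous_dist2l b : continuous (fun y : plane R => dist2 y b).
Proof.
move=> y; apply: (@continuous_comp _ _ _ (fun y : plane R => b - y) (@norm2 R)).
  by apply: cvgB; [exact: cvg_cst|exact: cvg_id].
exact: continuous_norm2.
Qed.

Lemma dist2_ge0 x y : 0 <= dist2 x y. Proof. exact: norm2_ge0. Qed.

Lemma dist_set_le A y b : A b -> dist_set y A <= dist2 y b.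
Proof.
move=> Ab; apply: ge_inf; last by exists b.
by exists 0 => _ [q _ <-]; exact: dist2_ge0.
Qed.

Lemma dist_set_lt A y d : A !=set0 -> dist_set y A < d ->
  exists2 b, A b & dist2 y b < d.
Proof.
move=> [b0 Ab0] /inf_lt [|_ [b Ab <-] bd]; last by exists b.
by exists (dist2 y b0); exists b0.
Qed.

Lemma norm2Z (t : R) z : norm2 (t *: z) = `|t| * norm2 z.
Proof.
rewrite /norm2/= /GRing.scale/= !exprMn -mulrDr sqrtrM ?sqr_ge0// sqrtr_sqr//.
Qed.

(** The supremum t of the parameters whose points are in A works. Points of A accumulate there; a
    neighbourhood inside A would allow a larger parameter if t < 1, and would contain the excluded
    end point if t = 1. *)
Lemma segment_boundary A x z : A x -> ~ A (x + z) ->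
  exists2 t : R, 0 <= t <= 1 & boundary A (x + t *: z).
Proof.
move=> Ax Axz; pose T := [set t : R | 0 <= t <= 1 /\ A (x + t *: z)].
have T0 : T 0 by rewrite /T/= lexx ler01 scale0r addr0.
have T1 : ubound T 1 by move=> t [/andP[]].
have hT : has_sup T by split; [exists 0|exists 1].
pose t := sup T.
have t0 : 0 <= t by exact: (ub_le_sup hT.2 T0).
have t1 : t <= 1 by apply: ge_sup => //; exists 0.
have cl : continuous (fun t : R => x + t *: z).
  by move=> s; apply: cvgD; [exact: cvg_cst|apply: cvgZr_tmp; exact: cvg_id].
exists t; first by rewrite t0.
split.
  move=> B /(cl t) [e /= e0 eB].
  have [s Ts ts] := sup_adherent e0 hT.
  exists (x + s *: z); split; first by case: Ts.
  apply: eB; rewrite /ball_/=; have st : s <= t by exact: (ub_le_sup hT.2 Ts).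
  by rewrite ger0_norm ?subr_ge0// ltrBlDr -ltrBlDl.
move=> /(cl t) [e /= e0 eA].
have [t1'|t1'] := ltP t 1; last first.
  have tE : t = 1 by apply/eqP; rewrite eq_le t1.
  by apply: Axz; have := eA t; rewrite /ball_/= subrr normr0 tE scale1r; exact.
pose s := Num.min 1 (t + e / 2).
have ts : t < s by rewrite lt_min t1' ltrDl divr_gt0.
have Ts : T s.
  split; first by rewrite (le_trans t0 (ltW ts)) ge_min lexx.
  apply: eA; rewrite /ball_/= ltr0_norm ?subr_lt0// opprB.
  have : s <= t + e / 2 by rewrite ge_min lexx orbT.
  by lra.
by have := ub_le_sup hT.2 Ts; rewrite -/t leNgt ts.
Qed.

(** If y is outside Omega, the segment from x to y meets the boundary at a point no farther from y
    than x is. *)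
Lemma enlarged_disc Omega x y d : Omega x -> dist2 x y < d -> enlarged Omega d y.
Proof.
move=> Ox xy; have [Oy|Oy] := pselect (Omega y); [by left|right; split=> //].
have [t /andP[t0 t1] bt] : exists2 t : R, 0 <= t <= 1 & boundary Omega (x + t *: (y - x)).
  by apply: segment_boundary => //; rewrite subrKC.
apply: le_lt_trans xy; apply: le_trans (dist_set_le _ bt) _.
rewrite /dist2 (_ : x + _ - y = (t - 1) *: (y - x)); last first.
  by rewrite [LHS]surjective_pairing [RHS]surjective_pairing; congr pair;
    rewrite /= /GRing.scale/=; ring.
by rewrite norm2Z ler_piMl ?norm2_ge0// ler_norml; apply/andP; split; lra.
Qed.

Lemma enlarged_mono Omega d d' : d <= d' -> enlarged Omega d `<=` enlarged Omega d'.
Proof.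
by move=> dd' y [Oy|[Oy yd]]; [left|right; split => //; exact: lt_le_trans dd'].
Qed.

Lemma collarE Omega d y : boundary Omega !=set0 ->
  collar Omega d y <-> ~ Omega y /\ exists2 b, boundary Omega b & dist2 y b < d.
Proof.
move=> b0; split=> [[Oy /(dist_set_lt b0) h]//|[Oy [b bO yb]]]; split=> //.
exact: le_lt_trans (dist_set_le _ bO) yb.
Qed.

Lemma enlargedE Omega d : boundary Omega !=set0 ->
  enlarged Omega d = Omega `|` \bigcup_(b in boundary Omega) [set y | dist2 y b < d].
Proof.
move=> b0; apply/seteqP; split=> y.
  by move=> [Oy|/(collarE _ _ b0)[_ [b bO yb]]]; [left|right; exists b].
move=> [Oy|[b bO yb]]; first by left.
have [Oy|Oy] := pselect (Omega y); [by left|right].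
by apply/collarE => //; split=> //; exists b.
Qed.

Lemma enlarged_open Omega d : open Omega -> boundary Omega !=set0 ->
  open (enlarged Omega d).
Proof.
move=> oO b0; rewrite enlargedE//; apply: openU => //; apply: bigcup_open => b _.
rewrite (_ : mkset _ = (fun y : plane R => dist2 y b) @^-1` [set t | t < d])//.
by apply: open_comp; [move=> y _; exact: continuous_dist2l|exact: open_lt].
Qed.

Lemma enlarged_measurable Omega d : open Omega -> boundary Omega !=set0 ->
  measurable (enlarged Omega d).
Proof. by move=> oO b0; apply: open_measurable_plane; exact: enlarged_open. Qed.

Lemma collar_measurable Omega d : open Omega -> boundary Omega !=set0 ->
  measurable (collar Omega d).
Proof.
move=> oO b0; have -> : collar Omega d = enlarged Omega d `\` Omega.
  apply/seteqP; split=> y; first by move=> [Oy yd]; split=> //; right.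
  by move=> [[|//]].
by apply: measurableD; [exact: enlarged_measurable|exact: open_measurable_plane].
Qed.

Lemma norm2_coord z : (`|z.1| <= norm2 z) * (`|z.2| <= norm2 z).
Proof.
by split; rewrite -sqrtr_sqr /norm2 ler_sqrt ?addr_ge0 ?sqr_ge0//
  ?lerDl ?lerDr sqr_ge0.
Qed.

Definition box (c : plane R) (r : R) : set (plane R) :=
  `]c.1 - r, c.1 + r[%classic `*` `]c.2 - r, c.2 + r[%classic.

Lemma measurable_box c r : measurable (box c r).
Proof. by apply: measurableX; exact: measurable_itv. Qed.

Lemma leb2_box c r : 0 <= r -> leb2 (box c r) = (4 * r ^+ 2)%:E.
Proof.
move=> r0; rewrite leb2_rect; [|exact: measurable_itv|exact: measurable_itv].
rewrite !lebesgue_measure_itv/= !lte_fin.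
have [->|rn0] := eqVneq r 0.
  by rewrite !subr0 !addr0 !ltxx mul0e expr0n mulr0.
have rp : 0 < r by rewrite lt_neqAle eq_sym rn0.
rewrite !ltrD2l (_ : - r < r); last by lra.
by rewrite -!EFinB -EFinM; congr EFin; ring.
Qed.

Lemma segment_tube (p q : plane R) d : 0 < d -> exists2 B : set (plane R), measurable B &
  (forall y t, 0 <= t < 1 -> dist2 y (p + t *: (q - p)) < d -> B y) /\
  (leb2 B <= (16 * (dist2 p q + d) * d)%:E)%E.
Proof.
move=> d0; pose N := (Num.truncn (dist2 p q / d)).+1.
have N0 : 0 < N%:R :> R by rewrite ltr0n.
have pqN : dist2 p q / N%:R <= d.
  by rewrite ler_pdivrMr// -ler_pdivrMl// mulrC ltW// truncnS_gt.
have Nle : N%:R * d <= dist2 p q + d.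
  rewrite /N -natr1 mulrDl mul1r lerD2r -ler_pdivlMr// truncn_le//.
  by rewrite divr_ge0 ?dist2_ge0// ltW.
pose c (k : nat) : plane R := p + (k%:R / N%:R) *: (q - p).
exists (\big[setU/set0]_(k < N) box (c k) (2 * d)).
  by apply: bigsetU_measurable => k _; exact: measurable_box.
split.
  move=> y t /andP[t0 t1] yt.
  pose k := Num.truncn (t * N%:R).
  have tN0 : 0 <= t * N%:R by rewrite mulr_ge0// ltW.
  have kt : k%:R <= t * N%:R by rewrite truncn_le.
  have tk : t * N%:R < k%:R + 1 by rewrite natr1 truncnS_gt.
  have kN : (k < N)%N by rewrite -(ltr_nat R) (le_lt_trans kt)// gtr_pMl.
  rewrite (bigD1 (Ordinal kN))//=; left.
  have tkN : `|t - k%:R / N%:R| <= N%:R^-1.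
    have h1 : k%:R / N%:R <= t by rewrite ler_pdivrMr.
    have h2 : t <= k%:R / N%:R + N%:R^-1 by rewrite -[X in _ + X]mul1r -mulrDl ler_pdivlMr// ltW.
    by rewrite ger0_norm; lra.
  have [y1 y2] := norm2_coord (p + t *: (q - p) - y).
  have [z1 z2] := norm2_coord (q - p).
  have cl (b : R) : `|b| <= dist2 p q -> `|(t - k%:R / N%:R) * b| <= d.
    move=> bp; rewrite normrM; apply: le_trans pqN; rewrite [leRHS]mulrC.
    by apply: ler_pM.
  have e1 : (p + t *: (q - p) - y).1 = p.1 + t * (q.1 - p.1) - y.1 by [].
  have e2 : (p + t *: (q - p) - y).2 = p.2 + t * (q.2 - p.2) - y.2 by [].
  have c1 : (c k).1 = p.1 + k%:R / N%:R * (q.1 - p.1) by [].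
  have c2 : (c k).2 = p.2 + k%:R / N%:R * (q.2 - p.2) by [].
  have lin (P0 S K Y : R) : `|P0 + S - Y| < d -> `|S - K| <= d ->
      Y \in `]P0 + K - 2 * d, P0 + K + 2 * d[.
    by rewrite ltr_norml ler_norml in_itv/= => /andP[? ?] /andP[? ?]; apply/andP; split; lra.
  have := cl _ z1; have := cl _ z2; move: (le_lt_trans y1 yt) (le_lt_trans y2 yt).
  rewrite e1 e2 /= !mulrBl => h1 h2 h3 h4.
  by split; rewrite /mkset ?c1 ?c2; apply: lin; eassumption.
apply: le_trans (_ : (\sum_(k < N) leb2 (box (c k) (2 * d)) <= _)%E).
  apply: (@content_subadditive _ _ _ (@leb2 R) _ (fun k => box (c k) (2 * d)) N) => //.
    by move=> k _; exact: measurable_box.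
  by apply: bigsetU_measurable => k _; exact: measurable_box.
under eq_bigr do rewrite leb2_box ?mulr_ge0 ?(ltW d0)//.
rewrite sumEFin sumr_const card_ord lee_fin -mulr_natl; nra.
Qed.


(** The boundary consists of finitely many segments and the collar lies in the tubes about them. The
    summand 1 only keeps the constant positive. *)
Lemma leb2_collar Omega : open Omega -> boundary Omega !=set0 ->
    (exists s : seq (plane R), boundary Omega = polyline s) ->
  exists2 C : R, 0 < C & forall d, 0 < d <= 1 -> (leb2 (collar Omega d) <= (C * d)%:E)%E.
Proof.
move=> oO b0 [s bs].
pose L i := dist2 s`_i (next_vertex s i).
have L0 i : 0 <= L i by exact: dist2_ge0.
exists (\sum_(i < size s) 16 * (L i + 1) + 1).
  by rewrite ltr_wpDl// sumr_ge0// => i _; rewrite mulr_ge0// addr_ge0.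
move=> d /andP[d0 d1].
have tube i := cid2 (segment_tube s`_i (next_vertex s i) d0).
pose B i := projT1 (tube i).
have mB i : measurable (B i) by rewrite /B; case: (tube i).
have Bs i y t : 0 <= t < 1 -> dist2 y (s`_i + t *: (next_vertex s i - s`_i)) < d -> B i y.
  by rewrite /B; case: (tube i) => /= ? _ [h _]; exact: h.
have BL i : (leb2 (B i) <= (16 * (L i + d) * d)%:E)%E.
  by rewrite /B; case: (tube i) => /= ? _ [_].
apply: (@le_trans _ _ (\sum_(i < size s) leb2 (B i))%E).
  apply: (@content_subadditive _ _ _ (@leb2 R) _ B (size s)) => //.
    exact: collar_measurable.
  move=> y /(collarE _ _ b0)[_ [b bO yb]].
  move: bO; rewrite bs => -[i /= is_ [t]]; rewrite /= in_itv/= => t01 bE.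
  rewrite -bigcup_mkord; exists i => //; apply: Bs t01 _.
  by rewrite bE.
apply: (@le_trans _ _ (\sum_(i < size s) (16 * (L i + 1) * d)%:E)%E).
  apply: lee_sum => i _; apply: le_trans (BL i) _.
  by rewrite lee_fin ler_pM2r// ler_pM2l// lerD2l.
rewrite sumEFin lee_fin -mulr_suml ler_pM2r//; lra.
Qed.

Lemma boundary_neq0 Omega : bounded_open_polygon Omega -> boundary Omega !=set0.
Proof.
move=> [_ _ _ _ [s [s0 _ _] ->]]; exists s`_0, 0%N => //; exists 0.
  by rewrite /= in_itv/= lexx ltr01.
by rewrite scale0r addr0.
Qed.

Lemma bounded_set_box Omega : bounded_set Omega ->
  exists2 B : R, 0 < B & Omega `<=` box 0 B.
Proof.
move=> [M [_ /(_ (`|M| + 1))]].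
rewrite (le_lt_trans (ler_norm M)) ?ltrDl// => /(_ isT) h.
exists (`|M| + 2); first by rewrite ltr_wpDl.
move=> x /h/=; rewrite prod_normE ge_max => /andP[]; rewrite !ler_norml => /andP[? ?] /andP[? ?].
by split; rewrite /= in_itv/=; apply/andP; split; lra.
Qed.

End Enlarged.

(** * Taylor estimates along the axes *)

Section Taylor.
Context {R : realType}.

(** The mean value theorem, n times. Since t <= 1 the successive factors are bounded by 1, and the 1
    / n! of Taylor's formula is given up. *)
Lemma iterated_mvt (n : nat) (F : nat -> R -> R) (M : R) :
  (forall k (t : R), (k < n)%N -> 0 <= t <= 1 -> is_derive t 1 (F k) (F k.+1 t)) ->
  (forall k, (k < n)%N -> F k 0 = 0) ->
  (forall t : R, 0 <= t <= 1 -> `|F n t| <= M) ->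
  forall t : R, 0 <= t <= 1 -> `|F 0%N t| <= M.
Proof.
elim: n F => [|n IH] F dF F0 FM t t01; first exact: FM.
have F1 s : 0 <= s <= 1 -> `|F 1%N s| <= M.
  by apply: (IH (fun k => F k.+1)) => // [k r kn|k kn]; [exact: dF|exact: F0].
case/andP: t01 => t0 t1.
have sub r : r \in `[0, t] -> 0 <= r <= 1.
  by rewrite in_itv/= => /andP[-> rt]; rewrite (le_trans rt).
have [c c0t] : exists2 c, c \in `[0, t] & F 0%N t - F 0%N 0 = F 1%N c * (t - 0).
  apply: MVT_segment => //.
    by move=> r rt; apply: dF => //; apply: sub; exact: subset_itv_oo_cc rt.
  apply: derivable_within_continuous => r rt.
  by have := dF 0%N r (ltn0Sn _) (sub _ rt) => -[].
rewrite F0// !subr0 => ->; rewrite normrM (ger0_norm t0).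
by apply: le_trans (F1 c (sub _ c0t)); rewrite ler_piMr.
Qed.

(** [p k] and [m k] stand for the k-th directional derivative along x + r t v and x - r t v. In the
    sum of both the odd orders cancel at t = 0, so that after removal of the terms of order 0 and 2
    the function and its first three derivatives vanish there. *)
Lemma symmetric_taylor4 (p m : nat -> R -> R) (v : nat -> R) (r M : R) :
  (forall k (t : R), (k < 4)%N -> 0 <= t <= 1 -> is_derive t 1 (p k) (r * p k.+1 t)) ->
  (forall k (t : R), (k < 4)%N -> 0 <= t <= 1 -> is_derive t 1 (m k) (- r * m k.+1 t)) ->
  (forall k, p k 0 = v k) -> (forall k, m k 0 = v k) ->
  (forall t : R, 0 <= t <= 1 -> `|p 4%N t| <= M) ->
  (forall t : R, 0 <= t <= 1 -> `|m 4%N t| <= M) ->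
  `|p 0%N 1 + m 0%N 1 - 2 * v 0%N - r ^+ 2 * v 2%N| <= 2 * (M * r ^+ 4).
Proof.
move=> dp dm p0 m0 pM mM.
pose F k : R -> R := match k with
  | 0%N => fun t => p 0%N t + m 0%N t - 2 * v 0%N - r ^+ 2 * v 2%N * t ^+ 2
  | 1%N => fun t => r * p 1%N t - r * m 1%N t - 2 * r ^+ 2 * v 2%N * t
  | 2%N => fun t => r ^+ 2 * p 2%N t + r ^+ 2 * m 2%N t - 2 * r ^+ 2 * v 2%N
  | 3%N => fun t => r ^+ 3 * p 3%N t - r ^+ 3 * m 3%N t
  | _ => fun t => r ^+ 4 * p 4%N t + r ^+ 4 * m 4%N t end.
have -> : p 0%N 1 + m 0%N 1 - 2 * v 0%N - r ^+ 2 * v 2%N = F 0%N 1.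
  by rewrite /F expr1n mulr1.
apply: (@iterated_mvt 4 F); last by rewrite lexx ler01.
- move=> k t k4 t01; have h := dp ^~ t; have h' := dm ^~ t.
  case: k k4 => [|[|[|[|//]]]] k4.
  + have h0 := h 0%N isT t01; have h0' := h' 0%N isT t01.
    by apply: is_derive_eq; rewrite /GRing.scale/=; ring.
  + have h0 := h 1%N isT t01; have h0' := h' 1%N isT t01.
    by apply: is_derive_eq; rewrite /GRing.scale/=; ring.
  + have h0 := h 2%N isT t01; have h0' := h' 2%N isT t01.
    by apply: is_derive_eq; rewrite /GRing.scale/=; ring.
  + have h0 := h 3%N isT t01; have h0' := h' 3%N isT t01.
    by apply: is_derive_eq; rewrite /GRing.scale/=; ring.
- by move=> [|[|[|[|//]]]] _; rewrite /F ?p0 ?m0; ring.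
- move=> t t01; have r4 : 0 <= r ^+ 4 by rewrite (exprM r 2 2) sqr_ge0.
  have b1 := pM t t01; have b2 := mM t t01.
  rewrite /F -mulrDr normrM (ger0_norm r4) mulrA mulrC ler_wpM2r//.
  by apply: le_trans (ler_normD _ _) _; lra.
Qed.

Implicit Types (D : set (plane R)) (f u : plane R -> R) (x v : plane R).

Lemma is_derive_line f x v (s t : R) : derivable f (x + (s * t) *: v) v ->
  is_derive t 1 (fun t => f (x + (s * t) *: v)) (s * 'D_v f (x + (s * t) *: v)).
Proof.
move=> df; pose G r := f (x + r *: v).
have dG : is_derive (s * t) 1 G ('D_v f (x + (s * t) *: v)).
  have E : (fun h : R => h^-1 *: ((G \o shift (s * t)) (h *: 1) - G (s * t))) =
      (fun h => h^-1 *: ((f \o shift (x + (s * t) *: v)) (h *: v) - f (x + (s * t) *: v))).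
    apply/funext => h.
    have -> : (G \o shift (s * t)) (h *: 1) = f (x + (h + s * t) *: v).
      by rewrite /= /G /GRing.scale/= mulr1.
    by rewrite scalerDl addrCA.
  by split; rewrite /derivable /derive E.
rewrite -[X in is_derive _ _ X _]/(G \o (fun t => s * t)) mulrC.
apply: is_derive1_comp.
by apply: is_derive_eq; rewrite /GRing.scale/= mulr1.
Qed.

Section bounded_partials.
Variables (D : set (plane R)) (u : plane R -> R) (M : R).
Hypothesis du : forall s i x, (size s < 4)%N -> D x -> derivable (partial s u) x (unit_vec i).
Hypothesis Mu : forall s x, (size s <= 4)%N -> D x -> `|partial s u x| <= M.

Let line i s x (r t : R) := partial s u (x + (r * t) *: unit_vec i).

Let dline i s x r t : (size s < 4)%N -> D (x + (r * t) *: unit_vec i) ->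
  is_derive t 1 (line i s x r) (r * line i (i :: s) x r t).
Proof. by move=> s4 Dx; apply: is_derive_line; exact: du. Qed.

Let line0 i s x r : line i s x r 0 = partial s u x.
Proof. by rewrite /line mulr0 scale0r addr0. Qed.

Let line1 i s x r : line i s x r 1 = partial s u (x + r *: unit_vec i).
Proof. by rewrite /line mulr1. Qed.

Lemma partial_lipschitz i s x r : (size s < 4)%N ->
  (forall t, 0 <= t <= 1 -> D (x + (r * t) *: unit_vec i)) ->
  `|partial s u (x + r *: unit_vec i) - partial s u x| <= M * `|r|.
Proof.
move=> s4 Dx.
pose F k : R -> R := match k with 0%N => fun t => line i s x r t - partial s u x
  | _ => fun t => r * line i (i :: s) x r t end.
have := @iterated_mvt 1 F (M * `|r|); rewrite -line1; apply.
- move=> [|//] t _ t01; have h := dline s4 (Dx t t01); rewrite /F.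
  by apply: is_derive_eq; rewrite subr0.
- by move=> [|//] _; rewrite /F line0 subrr.
- by move=> t t01; rewrite /F normrM mulrC ler_wpM2r// Mu//; exact: Dx.
- by rewrite lexx ler01.
Qed.

Lemma partial_taylor2 i s x r : (size s < 3)%N ->
  (forall t, 0 <= t <= 1 -> D (x + (r * t) *: unit_vec i)) ->
  `|partial s u (x + r *: unit_vec i) - partial s u x - r * partial (i :: s) u x| <= M * r ^+ 2.
Proof.
move=> s3 Dx; have s4 := ltnW s3 : (size s < 4)%N.
pose F k : R -> R := match k with
  | 0%N => fun t => line i s x r t - partial s u x - r * partial (i :: s) u x * t
  | 1%N => fun t => r * line i (i :: s) x r t - r * partial (i :: s) u x
  | _ => fun t => r * (r * line i [:: i, i & s] x r t) end.
have := @iterated_mvt 2 F (M * r ^+ 2); rewrite -line1 -[r * partial _ u x]mulr1; apply.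
- move=> [|[|//]] t _ t01; have h := dline s4 (Dx t t01);
    have h' := @dline i (i :: s) x r t s3 (Dx t t01); rewrite /F.
    by apply: is_derive_eq; rewrite /GRing.scale/=; ring.
  by apply: is_derive_eq; rewrite /GRing.scale/=; ring.
- by move=> [|[|//]] _; rewrite /F line0; ring.
- move=> t t01; rewrite /F mulrA -expr2 normrM (ger0_norm (sqr_ge0 _)) mulrC.
  by rewrite ler_wpM2r ?sqr_ge0// Mu//; exact: Dx.
- by rewrite lexx ler01.
Qed.

Lemma partial_second_difference i s x r : (size s < 3)%N ->
  (forall t, -1 <= t <= 1 -> D (x + (r * t) *: unit_vec i)) ->
  `|partial s u (x + r *: unit_vec i) + partial s u (x + (- r) *: unit_vec i)
     - 2 * partial s u x| <= 2 * (M * r ^+ 2).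
Proof.
move=> s3 Dx.
have D1 t : 0 <= t <= 1 -> D (x + (r * t) *: unit_vec i).
  by move=> t01; apply: Dx; lra.
have D2 t : 0 <= t <= 1 -> D (x + (- r * t) *: unit_vec i).
  by move=> t01; rewrite mulNr -mulrN; apply: Dx; lra.
have := partial_taylor2 s3 D1; have := partial_taylor2 s3 D2.
rewrite sqrrN !ler_norml => /andP[? ?] /andP[? ?]; apply/andP; split; lra.
Qed.

Lemma second_difference4 i x r :
  (forall t, -1 <= t <= 1 -> D (x + (r * t) *: unit_vec i)) ->
  `|u (x + r *: unit_vec i) + u (x + (- r) *: unit_vec i) - 2 * u x
     - r ^+ 2 * partial [:: i; i] u x| <= 2 * (M * r ^+ 4).
Proof.
move=> Dx.
have D1 t : 0 <= t <= 1 -> D (x + (r * t) *: unit_vec i).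
  by move=> t01; apply: Dx; lra.
have D2 t : 0 <= t <= 1 -> D (x + (- r * t) *: unit_vec i).
  by move=> t01; rewrite mulNr -mulrN; apply: Dx; lra.
pose p k t := line i (nseq k i) x r t; pose m k t := line i (nseq k i) x (- r) t.
have := @symmetric_taylor4 p m (fun k => partial (nseq k i) u x) r M.
rewrite /p /m !line1; apply.
- by move=> k t k4 t01; apply: dline; [rewrite size_nseq|exact: D1].
- by move=> k t k4 t01; apply: dline; [rewrite size_nseq|exact: D2].
- by move=> k; rewrite line0.
- by move=> k; rewrite line0.
- by move=> t t01; apply: Mu => //; exact: D1.
- by move=> t t01; apply: Mu => //; exact: D2.
Qed.

Let sign_sum_arith (fpp fmp fpm fmm f0p f0m u0 gp gm g0 k0 p q : R) :
  0 <= p -> 0 <= q -> 0 <= M ->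
  `|fpp + fmp - 2 * f0p - p * gp| <= 2 * (M * (p * p)) ->
  `|fpm + fmm - 2 * f0m - p * gm| <= 2 * (M * (p * p)) ->
  `|f0p + f0m - 2 * u0 - q * k0| <= 2 * (M * (q * q)) ->
  `|gp + gm - 2 * g0| <= 2 * (M * q) ->
  `|fpp + fmp + fpm + fmm - 4 * u0 - 2 * p * g0 - 2 * q * k0| <= 4 * M * (p + q) ^+ 2.
Proof.
move=> p0 q0 M0 A1 A2 A3 A4.
have A5 : `|p * (gp + gm - 2 * g0)| <= 2 * (M * (p * q)).
  have -> : 2 * (M * (p * q)) = p * (2 * (M * q)) by ring.
  by rewrite normrM (ger0_norm p0); exact: ler_wpM2l.
have h : 0 <= M * (p * q) by rewrite !mulr_ge0.
move: A1 A2 A3 A5.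
rewrite !ler_norml => /andP[? ?] /andP[? ?] /andP[? ?] /andP[? ?].
by apply/andP; split; lra.
Qed.

Definition sign_sum x (z : plane R) : R :=
  u (x + z) + u (x + (- z.1, z.2)) + u (x + (z.1, - z.2)) + u (x + (- z.1, - z.2)) - 4 * u x.

(** The four sign changes cancel the odd terms and the mixed derivative. The sum is made of second
    differences along the first axis at the heights z.2 and - z.2, and of twice the second
    difference along the second axis at x; a second difference of the pure second derivative along
    the first axis brings its values at the two heights back to x. *)
Lemma sign_sum_laplacian x (z : plane R) :
  (forall z' : plane R, `|z'.1| <= `|z.1| -> `|z'.2| <= `|z.2| -> D (x + z')) ->
  `|sign_sum x z - 2 * z.1 ^+ 2 * partial [:: false; false] u x
     - 2 * z.2 ^+ 2 * partial [:: true; true] u x| <= 4 * M * (z.1 ^+ 2 + z.2 ^+ 2) ^+ 2.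
Proof.
case: z => a b /= Dx; rewrite /sign_sum/=.
have ex (y : plane R) c : y + c *: unit_vec false = (y.1 + c, y.2).
  by rewrite [LHS]surjective_pairing /= /GRing.scale/= mulr1 mulr0 addr0.
have ey (y : plane R) c : y + c *: unit_vec true = (y.1, y.2 + c).
  by rewrite [LHS]surjective_pairing /= /GRing.scale/= mulr1 mulr0 addr0.
have xE c e : x + (c, e) = (x.1 + c, x.2 + e) by [].
have small (t c : R) : -1 <= t <= 1 -> `|c * t| <= `|c|.
  by move=> t1; rewrite normrM ler_piMr// ler_norml.
have Dp c t : `|c| <= `|b| -> -1 <= t <= 1 -> D ((x + (0, c)) + (a * t) *: unit_vec false).
  move=> cb t1; rewrite ex xE/= addr0 -xE; apply: Dx => //=; exact: small.
have Dq t : -1 <= t <= 1 -> D (x + (b * t) *: unit_vec true).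
  move=> t1; rewrite ey -[X in (X, _)]addr0 -xE; apply: Dx => /=; [by rewrite normr0|exact: small].
have A1 := @second_difference4 false (x + (0, b)) a (fun t => @Dp b t (lexx _)).
have A2 := @second_difference4 false (x + (0, - b)) a (fun t => Dp (- b) t ltac:(by rewrite normrN)).
have A3 := @second_difference4 true x b Dq.
have A4 := @partial_second_difference true [:: false; false] x b isT Dq.
move: A1 A2 A3 A4; rewrite !ex !ey !xE /= !addr0.
have M0 : 0 <= M by apply: le_trans (Mu (s := [::]) isT (Dx 0 _ _)); rewrite ?normr0.
have E4 (c : R) : c ^+ 4 = c ^+ 2 * c ^+ 2 by ring.
rewrite !E4 => A1 A2 A3 A4.
exact: (sign_sum_arith (sqr_ge0 a) (sqr_ge0 b) M0 A1 A2 A3 A4).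
Qed.

End bounded_partials.

(** Each partial derivative has its own bound; there are finitely many words of length at most n, so
    one bound serves them all. *)
Lemma Cb_bounded D u n : Cb n D u ->
  exists2 M : R, 0 < M & forall s x, (size s <= n)%N -> D x -> `|partial s u x| <= M.
Proof.
move=> [_ cb].
have /choice[Mf MfP] : forall s : seq bool, exists M : R, (size s <= n)%N -> forall x, D x -> `|partial s u x| <= M.
  move=> s; have [sn|sn] := boolP (size s <= n)%N; last by exists 0.
  by have [_ [M MP]] := cb s sn; exists M => _.
pose M := \big[Num.max/0]_(k < n.+1) \big[Num.max/0]_(t : k.-tuple bool) Mf t.
have M0 : 0 <= M by exact: bigmax_ge_id.
exists (M + 1); first by rewrite ltr_wpDl.
move=> s x sn Dx; apply: le_trans (MfP s sn x Dx) _.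
apply: (@le_trans _ _ M); last by rewrite lerDl.
apply: le_trans (le_bigmax _ _ (Ordinal (sn : (size s < n.+1)%N))) => /=.
exact: (le_bigmax _ (fun t : (size s).-tuple bool => Mf t) (in_tuple s)).
Qed.

End Taylor.

(** * Truncation error of the nonlocal operator *)

Section SignedInvariance.
Context d (T : measurableType d) {R : realType} (mu : {measure set T -> \bar R}).
Local Open Scope ereal_scope.

Lemma integral_invariant (tau : T -> T) :
  (forall f : T -> \bar R, measurable_fun setT f -> (forall x, 0 <= f x) ->
     \int[mu]_x f (tau x) = \int[mu]_x f x) ->
  forall f : T -> \bar R, measurable_fun setT f -> \int[mu]_x f (tau x) = \int[mu]_x f x.
Proof.
move=> tauP f mf; rewrite [LHS]integralE [RHS]integralE; congr (_ - _).
  rewrite -[RHS]tauP//; last exact: measurable_funepos.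
  by apply: eq_integral => x _; rewrite !funeposE.
rewrite -[RHS]tauP//; last exact: measurable_funeneg.
by apply: eq_integral => x _; rewrite !funenegE.
Qed.

End SignedInvariance.

Section Truncation.
Context {R : realType}.
Variables (gam : R -> plane R -> plane R -> R) (gamt : R -> R -> R) (gamma : R -> R).
Hypothesis KC : kernel_conditions gam gamt gamma.
Variables (d : R) (d0 : 0 < d).
Let K := radial_kernel gamma d.

Let K0 z : 0 <= K z := radial_kernel_ge0 KC d z.

Lemma radial_kernel_out z : d <= norm2 z -> K z = 0.
Proof.
by move=> dz; rewrite /K /radial_kernel /profile ltr_pdivrMr// mul1r [_ < d]ltNge dz andbF mulr0.
Qed.

Let mK : measurable_fun [set: plane R] K := measurable_radial_kernel KC d.

Lemma radial_kernel_integrable : leb2.-integrable setT (EFin \o K).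
Proof.
apply/integrableP; split; first exact/measurable_EFinP.
rewrite (eq_integral (fun z => (K z)%:E)); last by move=> z _ /=; rewrite ger0_norm.
by rewrite (radial_kernel_mass KC d0) ltry.
Qed.

Lemma dominated_integrable (f : plane R -> R) (B : R) :
  measurable_fun setT f -> (forall z, `|f z| <= B * K z) ->
  leb2.-integrable setT (EFin \o f).
Proof.
move=> mf fB; apply: (@le_integrable _ _ _ leb2 _ _ _ (fun z => (B%:E * (K z)%:E)%E)) => //.
- exact/measurable_EFinP.
- by move=> z _; rewrite /= lee_fin (le_trans (fB z))// ler_norm.
- by apply: integrableZl => //; exact: radial_kernel_integrable.
Qed.

Lemma radial_moment2 (i : bool) : \int[leb2]_z (coord i z ^+ 2 * K z) = 1.
Proof.
rewrite /Rintegral -[RHS]/(fine 1%:E) -(Phi1 KC) -(radial_kernel_moment2 KC i d0) ?ler01 ?lexx//.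
congr fine; apply: eq_integral => z _; congr EFin.
rewrite indicE mem_setE in_itv/= ltr_pdivrMr// mul1r; case: ltP => /=; first by rewrite mulr1.
by move=> /radial_kernel_out; rewrite -/K => ->; rewrite !mulr0.
Qed.

Let le_fint (f g : plane R -> R) (B B' : R) :
  measurable_fun setT f -> measurable_fun setT g ->
  (forall z, `|f z| <= B * K z) -> (forall z, `|g z| <= B' * K z) ->
  (forall z, `|f z| <= g z) -> `|\int[leb2]_z f z| <= \int[leb2]_z g z.
Proof.
move=> mf mg fB gB fg; have fi := dominated_integrable mf fB.
apply: le_trans (le_normr_Rintegral _ fi) _ => //; apply: le_Rintegral => //.
  by move/integrable_abse : fi.
exact: dominated_integrable gB.
Qed.

Let Rinvariant (tau : plane R -> plane R) (f : plane R -> R) :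
  (forall f : plane R -> \bar R, measurable_fun setT f -> (forall x, 0 <= f x)%E ->
     (\int[leb2]_x f (tau x) = \int[leb2]_x f x)%E) -> measurable_fun setT f ->
  \int[leb2]_z f (tau z) = \int[leb2]_z f z.
Proof.
move=> tauP mf; rewrite /Rintegral.
by rewrite (integral_invariant tauP (f := EFin \o f))//; exact/measurable_EFinP.
Qed.

Variables (C t : R).
Hypothesis annulus : (\int[leb2]_z (\1_(`[t, +oo[%classic) (norm2 z / d) * K z)%:E
     <= (d ^- 2 * (C * (1 - t)))%:E)%E.

Variables (D D' : set (plane R)) (x : plane R) (u chi : plane R -> R) (M : R).
Hypotheses (mD : measurable D) (DD' : D `<=` D') (xD : disc x d `<=` D).
Hypothesis du : forall s i x, (size s < 4)%N -> D' x -> derivable (partial s u) x (unit_vec i).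
Hypothesis Mu : forall s x, (size s <= 4)%N -> D' x -> `|partial s u x| <= M.
Hypotheses (mu : measurable_fun D u) (mchi : measurable_fun D chi).
Hypotheses (chi01 : forall y, 0 <= chi y <= 1)
  (chi1 : forall y, D y -> dist2 x y < t * d -> chi y = 1).

Let ut := u \_ D.
Let ct := chi \_ D.

Let mut : measurable_fun setT ut.
Proof. exact: (measurable_restrictT _ mD).1. Qed.
Let mct : measurable_fun setT ct.
Proof. exact: (measurable_restrictT _ mD).1. Qed.

Let inD z : norm2 z < d -> D (x + z).
Proof. by move=> zd; apply: xD; rewrite /disc/= /dist2 addrC addKr. Qed.

Let utE z : norm2 z < d -> ut (x + z) = u (x + z).
Proof. by move=> zd; rewrite /ut patchE mem_set//; exact: inD. Qed.

Let D'z (z z' : plane R) : norm2 z < d -> `|z'.1| <= `|z.1| -> `|z'.2| <= `|z.2| -> D' (x + z').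
Proof.
move=> zd z1 z2; apply/DD'/inD; apply: le_lt_trans zd; rewrite /norm2 ler_sqrt ?addr_ge0 ?sqr_ge0//.
by rewrite -[z'.1 ^+ 2]real_normK ?num_real// -[z'.2 ^+ 2]real_normK ?num_real//
  -[z.1 ^+ 2]real_normK ?num_real// -[z.2 ^+ 2]real_normK ?num_real// lerD ?lerXn2r ?nnegrE.
Qed.

Let M0 : 0 <= M.
Proof.
have xx : disc x d x by rewrite /disc/= /dist2 subrr /norm2/= !expr0n addr0 sqrtr0.
exact: le_trans (normr_ge0 _) (Mu (s := [::]) isT (DD' (xD xx))).
Qed.

Lemma lipschitz_bound z : norm2 z < d -> `|u (x + z) - u x| <= 2 * M * norm2 z.
Proof.
move=> zd; have [z1 z2] := norm2_coord z.
have p1 : x + z = (x + (z.1, 0)) + z.2 *: unit_vec true.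
  by rewrite [LHS]surjective_pairing [RHS]surjective_pairing /= /GRing.scale/= !mulr0 mulr1 !addr0.
have p2 : x + (z.1, 0) = x + z.1 *: unit_vec false.
  by rewrite [LHS]surjective_pairing [RHS]surjective_pairing /= /GRing.scale/= !mulr0 mulr1 !addr0.
have small (s c : R) : 0 <= s <= 1 -> `|c * s| <= `|c|.
  by move=> /andP[s0 s1]; rewrite normrM ler_piMr// ger0_norm.
have h1 := @partial_lipschitz _ D' u M du Mu true [::] (x + (z.1, 0)) z.2 isT.
have h2 := @partial_lipschitz _ D' u M du Mu false [::] x z.1 isT.
have -> : u (x + z) - u x = (u (x + z) - u (x + (z.1, 0))) + (u (x + (z.1, 0)) - u x) by ring.
apply: le_trans (ler_normD _ _) _.
have -> : 2 * M * norm2 z = M * norm2 z + M * norm2 z by ring.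
apply: lerD.
  rewrite p1; apply: le_trans (h1 _) _; last by rewrite ler_wpM2l.
  move=> s s01; rewrite -addrA; apply: D'z zd _ _ => /=; rewrite /GRing.scale/= ?mulr0 ?mulr1 ?addr0 ?add0r//.
  exact: small.
rewrite p2; apply: le_trans (h2 _) _; last by rewrite ler_wpM2l.
move=> s s01; apply: D'z zd _ _ => /=; rewrite /GRing.scale/= ?mulr0 ?mulr1 ?normr0//.
exact: small.
Qed.

Let g z := (ut (x + z) - u x) * K z.

Let mg : measurable_fun setT g.
Proof.
apply: measurable_funM => //; apply: measurable_funB => //.
apply: (measurableT_comp mut); apply: measurable_fun_pair => /=; exact: measurable_funD.
Qed.

Let gB z : `|g z| <= 2 * M * d * K z.
Proof.
rewrite /g normrM (ger0_norm (K0 z)); have [zd|zd] := ltP (norm2 z) d; last first.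
  by rewrite radial_kernel_out// !mulr0.
rewrite utE//; apply: ler_wpM2r => //; apply: le_trans (lipschitz_bound zd) _.
by apply: ler_wpM2l; [rewrite mulr_ge0|exact: ltW].
Qed.

Let indB z : 0 <= (\1_(`[t, +oo[%classic) (norm2 z / d) : R) <= 1.
Proof. by rewrite indicE; case: (_ \in _); rewrite /= ?lexx ?ler01. Qed.

Let mind : measurable_fun [set: plane R] (fun z : plane R => \1_(`[t, +oo[%classic) (norm2 z / d) : R).
Proof.
apply: (measurableT_comp (f := \1_(`[t, +oo[%classic) : R -> R)) => //.
by apply: measurable_funM => //; exact: measurable_norm2.
Qed.

Let mctx : measurable_fun setT (fun z : plane R => ct (x + z)).
Proof. by apply: (measurableT_comp mct); apply: measurable_fun_pair => /=; exact: measurable_funD. Qed.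

Let ct01 y : 0 <= ct y <= 1.
Proof. by rewrite /ct patchE; case: ifP => // _; rewrite lexx ler01. Qed.

Let Md0 : 0 <= 2 * M * d.
Proof. by rewrite !mulr_ge0// ltW. Qed.

(** The factor 1 - chi vanishes for |z| < t d. On the annulus that remains u varies by at most 2 M
    d, and the mass of the kernel there is the hypothesis [annulus]. *)
Lemma truncation_defect :
  `|\int[leb2]_z (g z * (1 - ct (x + z)))| <= 2 * M * d * (d ^- 2 * (C * (1 - t))).
Proof.
have iI : leb2.-integrable setT (EFin \o (fun z : plane R => \1_(`[t, +oo[%classic) (norm2 z / d) * K z)).
  apply: (@dominated_integrable _ 1); first exact: measurable_funM.
  move=> z; case/andP: (indB z) => i0 i1; rewrite normrM (ger0_norm (K0 z)) ger0_norm//.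
  by rewrite ler_wpM2r.
apply: (@le_trans _ _ (\int[leb2]_z (2 * M * d * (\1_(`[t, +oo[%classic) (norm2 z / d) * K z)))).
  apply: (@le_fint _ _ (2 * M * d) (2 * M * d)).
  - by apply: measurable_funM => //; exact: measurable_funB.
  - by apply: measurable_funM => //; exact: measurable_funM.
  - move=> z; rewrite normrM; apply: le_trans (gB z); rewrite ler_piMr//.
    by case/andP: (ct01 (x + z)) => c0 c1; rewrite ger0_norm; lra.
  - move=> z; case/andP: (indB z) => i0 i1.
    rewrite normrM (ger0_norm Md0) ler_wpM2l// normrM (ger0_norm (K0 z)) ger0_norm//.
    by rewrite ler_piMl.
  - move=> z; have [zd|zd] := ltP (norm2 z) d; last first.
      by rewrite /g radial_kernel_out// !mulr0 mul0r normr0.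
    case/andP: (ct01 (x + z)) => c0 c1.
    rewrite indicE mem_setE in_itv/= andbT ler_pdivlMr//; case: (leP (t * d) (norm2 z)) => tz /=.
      rewrite mul1r normrM; apply: le_trans (gB z); rewrite ler_piMr// ger0_norm; lra.
    rewrite /ct patchE mem_set; last exact: inD.
    rewrite chi1 ?subrr ?mulr0 ?normr0 ?mul0r ?mulr0//; first exact: inD.
    by rewrite /dist2 addrC addKr.
rewrite RintegralZl//; apply: ler_wpM2l => //.
rewrite /Rintegral -lee_fin fineK; first exact: annulus.
exact: integrable_fin_num iI.
Qed.

Let quarter_le (I a0 a1 b : R) :
  `|4 * I - 2 * a0 - 2 * a1| <= 8 * M * b -> `|2 * I - (a0 + a1)| <= 4 * M * b.
Proof.
rewrite -!mulrA; set B := M * b.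
by rewrite !ler_norml => /andP[? ?]; apply/andP; split; lra.
Qed.

(** The kernel and the area are invariant under both reflections, so four times the integral is the
    integral of [sign_sum] against the kernel. The unit second moments turn its main part into twice
    the Laplacian; the remainder 4 M |z|^4 is at most 4 M d^2 |z|^2, and |z|^2 integrates to 2. *)
Lemma truncation_full : `|2 * \int[leb2]_z g z - laplacian u x| <= 4 * M * d ^+ 2.
Proof.
pose s1 (z : plane R) : plane R := (- z.1, z.2); pose s2 (z : plane R) : plane R := (z.1, - z.2).
have n1 z : norm2 (s1 z) = norm2 z by rewrite /norm2/= sqrrN.
have n2 z : norm2 (s2 z) = norm2 z by rewrite /norm2/= sqrrN.
have mopp : measurable_fun setT (fun r : measurableTypeR R => - r : measurableTypeR R).
  by apply: continuous_measurable_fun; exact: opp_continuous.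
have ms1 : measurable_fun setT s1.
  by apply: measurable_fun_pair => //=; exact: (measurableT_comp mopp).
have ms2 : measurable_fun setT s2.
  by apply: measurable_fun_pair => //=; exact: (measurableT_comp mopp).
have K1 z : K (s1 z) = K z by rewrite /K /radial_kernel n1.
have K2 z : K (s2 z) = K z by rewrite /K /radial_kernel n2.
have mg1 := measurableT_comp mg ms1; have mg2 := measurableT_comp mg ms2.
have mg12 := measurableT_comp mg1 ms2.
have i0 := dominated_integrable mg gB.
have i1 : leb2.-integrable setT (EFin \o (fun z => g (s1 z))).
  by apply: (@dominated_integrable _ (2 * M * d)) => // z; rewrite -K1; exact: gB.
have i2 : leb2.-integrable setT (EFin \o (fun z => g (s2 z))).
  by apply: (@dominated_integrable _ (2 * M * d)) => // z; rewrite -K2; exact: gB.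
have i12 : leb2.-integrable setT (EFin \o (fun z => g (s1 (s2 z)))).
  by apply: (@dominated_integrable _ (2 * M * d)) => // z; rewrite -K2 -K1; exact: gB.
have e1 : \int[leb2]_z g (s1 z) = \int[leb2]_z g z by apply: Rinvariant => // f; exact: ge0_integral_leb2_opp1.
have e2 : \int[leb2]_z g (s2 z) = \int[leb2]_z g z by apply: Rinvariant => // f; exact: ge0_integral_leb2_opp2.
have e12 : \int[leb2]_z g (s1 (s2 z)) = \int[leb2]_z g z.
  rewrite -e1; apply: (Rinvariant (f := fun z => g (s1 z))) => // f; exact: ge0_integral_leb2_opp2.
have mz (i : bool) : measurable_fun setT (fun z : plane R => coord i z ^+ 2 * K z).
  apply: measurable_funM => //; case: i => /=.
    by rewrite /coord; apply: measurable_funX; exact: measurable_snd.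
  by rewrite /coord; apply: measurable_funX; exact: measurable_fst.
have zB (i : bool) (z : plane R) : `|coord i z ^+ 2 * K z| <= d ^+ 2 * K z.
  rewrite normrM (ger0_norm (K0 z)) (ger0_norm (sqr_ge0 _)).
  have [zd|zd] := ltP (norm2 z) d; last by rewrite radial_kernel_out// !mulr0.
  apply: ler_wpM2r => //; have [z1 z2] := norm2_coord z.
  rewrite -[coord i z ^+ 2]real_normK ?num_real// lerXn2r ?nnegrE// ?(ltW d0)//.
  by apply: le_trans (ltW zd); case: i; rewrite /coord.
have iz i := dominated_integrable (mz i) (zB i).
pose a0 := partial [:: false; false] u x; pose a1 := partial [:: true; true] u x.
have D01 : leb2.-integrable setT (EFin \o (fun z => g z + g (s1 z))).
  exact: (integrableD measurableT i0 i1).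
have D012 : leb2.-integrable setT (EFin \o (fun z => g z + g (s1 z) + g (s2 z))).
  exact: (integrableD measurableT D01 i2).
have D4 : leb2.-integrable setT (EFin \o (fun z => g z + g (s1 z) + g (s2 z) + g (s1 (s2 z)))).
  exact: (integrableD measurableT D012 i12).
have iz0 : leb2.-integrable setT (EFin \o (fun z : plane R => 2 * a0 * (coord false z ^+ 2 * K z))).
  exact: (integrableZl measurableT (2 * a0) (iz false)).
have iz1 : leb2.-integrable setT (EFin \o (fun z : plane R => 2 * a1 * (coord true z ^+ 2 * K z))).
  exact: (integrableZl measurableT (2 * a1) (iz true)).
have D5 : leb2.-integrable setT (EFin \o (fun z => g z + g (s1 z) + g (s2 z) + g (s1 (s2 z)) -
     2 * a0 * (coord false z ^+ 2 * K z))).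
  exact: (integrableB measurableT D4 iz0).
have D6 : leb2.-integrable setT (EFin \o (fun z => g z + g (s1 z) + g (s2 z) + g (s1 (s2 z)) -
     2 * a0 * (coord false z ^+ 2 * K z) - 2 * a1 * (coord true z ^+ 2 * K z))).
  exact: (integrableB measurableT D5 iz1).
have E : 4 * \int[leb2]_z g z - 2 * a0 - 2 * a1 =
    \int[leb2]_z (g z + g (s1 z) + g (s2 z) + g (s1 (s2 z)) -
     2 * a0 * (coord false z ^+ 2 * K z) - 2 * a1 * (coord true z ^+ 2 * K z)).
  rewrite !RintegralB// !RintegralD// e1 e2 e12 !RintegralZl//.
  by rewrite !radial_moment2; ring.
have iz01 : leb2.-integrable setT (EFin \o (fun z : plane R => coord false z ^+ 2 * K z + coord true z ^+ 2 * K z)).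
  exact: (integrableD measurableT (iz false) (iz true)).
suff h : `|4 * \int[leb2]_z g z - 2 * a0 - 2 * a1| <= 8 * M * d ^+ 2.
  by move: h; rewrite /laplacian -/a0 -/a1; exact: quarter_le.
rewrite E; apply: le_trans (le_normr_Rintegral _ D6) _ => //.
apply: (@le_trans _ _ (\int[leb2]_z (4 * M * d ^+ 2 * (coord false z ^+ 2 * K z + coord true z ^+ 2 * K z)))); last first.
  rewrite RintegralZl// RintegralD// !radial_moment2.
  by rewrite (_ : 4 * M * d ^+ 2 * (1 + 1) = 8 * M * d ^+ 2)//; ring.
apply: le_Rintegral => //.
- by move/integrable_abse : D6.
- exact: (integrableZl measurableT (4 * M * d ^+ 2) iz01).
- move=> z _; have [zd|zd] := ltP (norm2 z) d; last first.
    have g0 w : norm2 w = norm2 z -> g w = 0.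
      by move=> wz; rewrite /g radial_kernel_out ?mulr0// wz.
    generalize a0 a1 => b0 b1; rewrite g0// g0 ?n1// g0 ?n2// g0 ?n1 ?n2// radial_kernel_out//.
    by rewrite !mulr0 !addr0 !subr0 normr0 mulr0.
  rewrite /g !K1 !K2 !utE ?n1 ?n2//.
  have h := @sign_sum_laplacian _ D' u M du Mu x z (fun z' => D'z zd).
  have -> : (u (x + z) - u x) * K z + (u (x + s1 z) - u x) * K z + (u (x + s2 z) - u x) * K z +
     (u (x + s1 (s2 z)) - u x) * K z - 2 * a0 * (coord false z ^+ 2 * K z) - 2 * a1 * (coord true z ^+ 2 * K z)
     = (sign_sum u x z - 2 * z.1 ^+ 2 * a0 - 2 * z.2 ^+ 2 * a1) * K z.
    by rewrite /sign_sum /s1 /s2 /coord/=; ring.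
  rewrite normrM (ger0_norm (K0 z)) -mulrDl mulrA; apply: ler_wpM2r => //.
  apply: le_trans h _; rewrite expr2 mulrA; apply: ler_wpM2r; first by rewrite addr_ge0 ?sqr_ge0.
  rewrite ler_wpM2l ?mulr_ge0//.
  have -> : z.1 ^+ 2 + z.2 ^+ 2 = norm2 z ^+ 2 by rewrite /norm2 sqr_sqrtr// addr_ge0 ?sqr_ge0.
  by rewrite lerXn2r ?nnegrE ?norm2_ge0// ltW.
Qed.

Lemma truncation_error :
  `|2 * \int[leb2]_(y in D) ((u y - u x) * (K (y - x) * chi y)) - laplacian u x|
    <= 4 * M * d ^+ 2 + 4 * M * (C * ((1 - t) / d)).
Proof.
pose G y := (ut y - u x) * (K (y - x) * ct y).
have mG : measurable_fun setT G.
  apply: measurable_funM; first exact: measurable_funB.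
  apply: measurable_funM => //; apply: (measurableT_comp mK).
  by apply: measurable_fun_pair => /=; exact: measurable_funD.
have -> : \int[leb2]_(y in D) ((u y - u x) * (K (y - x) * chi y)) = \int[leb2]_y G y.
  rewrite Rintegral_mkcond; apply: eq_Rintegral => y _.
  rewrite patchE /G /ut /ct !patchE; case: ifPn => // yD.
  rewrite radial_kernel_out ?mul0r ?mulr0//.
  rewrite leNgt; apply/negP => h; move: yD; rewrite notin_setE; apply.
  exact: xD.
have -> : \int[leb2]_y G y = \int[leb2]_z (g z - g z * (1 - ct (x + z))).
  transitivity (\int[leb2]_z G (z + x)).
    by apply/esym; apply: (Rinvariant (tau := fun z => z + x)) => // f mf f0; exact: ge0_integral_leb2_shift.
  by apply: eq_Rintegral => z _; rewrite /G /g addrK [x + z]addrC; ring.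
have i1 : leb2.-integrable setT (EFin \o (fun z => g z * (1 - ct (x + z)))).
  apply: (@dominated_integrable _ (2 * M * d)).
    by apply: measurable_funM => //; exact: measurable_funB.
  move=> z; rewrite normrM; apply: le_trans (gB z); rewrite ler_piMr//.
  by case/andP: (ct01 (x + z)) => c0 c1; rewrite ger0_norm; lra.
rewrite RintegralB//; last exact: dominated_integrable gB.
have := truncation_full; have := truncation_defect.
set A := \int[leb2]_z g z; set B := Rintegral _ _ _.
have -> : 2 * M * d * (d ^- 2 * (C * (1 - t))) = 2 * M * (C * ((1 - t) / d)) by field; rewrite gt_eqF.
rewrite !ler_norml => /andP[? ?] /andP[? ?]; apply/andP; split; lra.
Qed.

End Truncation.

(** * Nodal interpolation *)

Section Triangle.
Context {R : realType}.
Implicit Types (t : tri R) (x v : plane R) (F : plane R -> R).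

Definition affine F : Prop := exists a b c : R, forall x, F x = a + b * x.1 + c * x.2.

Lemma affine_sum F n (v : 'I_n -> plane R) (w : 'I_n -> R) : affine F ->
  \sum_i w i = 1 -> F (\sum_i w i *: v i) = \sum_i w i * F (v i).
Proof.
move=> [a [b [c FE]]] w1; rewrite FE.
have -> : (\sum_i w i *: v i).1 = \sum_i w i * (v i).1.
  by rewrite (big_morph (fun z : plane R => z.1) (id1 := 0) (op1 := +%R)).
have -> : (\sum_i w i *: v i).2 = \sum_i w i * (v i).2.
  by rewrite (big_morph (fun z : plane R => z.2) (id1 := 0) (op1 := +%R)).
rewrite -[a]mulr1 -w1 !mulr_sumr -!big_split/=; apply: eq_bigr => i _.
by rewrite FE; ring.
Qed.

Lemma affine_le F A (m : R) : affine F -> (forall v, A v -> F v <= m) ->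
  forall x, conv_hull A x -> F x <= m.
Proof.
move=> aF Am _ [n [v [w [Av w0 w1 ->]]]]; rewrite affine_sum// -[m]mul1r -w1 mulr_suml.
by apply: ler_sum => i _; rewrite ler_wpM2l// Am.
Qed.

Lemma affine_bound F A (m : R) : affine F -> (forall v, A v -> `|F v| <= m) ->
  forall x, conv_hull A x -> `|F x| <= m.
Proof.
move=> aF Am x hx; rewrite ler_norml; apply/andP; split; last first.
  by apply: (affine_le aF) hx => v /Am; rewrite ler_norml => /andP[].
rewrite lerNl; apply: (affine_le (F := fun x => - F x)) hx.
  by have [a [b [c FE]]] := aF; exists (- a), (- b), (- c) => y; rewrite FE; ring.
by move=> v /Am; rewrite ler_norml => /andP[]; rewrite lerNl.
Qed.

Lemma affine_continuous F : affine F -> continuous F.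
Proof.
move=> [a [b [c FE]]] x; rewrite (_ : F = fun x => a + b * x.1 + c * x.2); last exact/funext.
apply: cvgD; first apply: cvgD; first exact: cvg_cst.
  by apply: cvgM; [exact: cvg_cst | exact: cvg_fst].
by apply: cvgM; [exact: cvg_cst | exact: cvg_snd].
Qed.

(** The barycentric coordinates for the vertices [t.1.1], [t.1.2], [t.2], by Cramer's rule. *)
Definition bary2 t x : R :=
  let a := t.1.2 - t.1.1 in let b := t.2 - t.1.1 in
  ((x.1 - t.1.1.1) * b.2 - (x.2 - t.1.1.2) * b.1) / (a.1 * b.2 - a.2 * b.1).
Definition bary3 t x : R :=
  let a := t.1.2 - t.1.1 in let b := t.2 - t.1.1 in
  (a.1 * (x.2 - t.1.1.2) - a.2 * (x.1 - t.1.1.1)) / (a.1 * b.2 - a.2 * b.1).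
Definition bary1 t x : R := 1 - bary2 t x - bary3 t x.

Lemma affine_bary2 t : affine (bary2 t).
Proof.
pose D := (t.1.2 - t.1.1).1 * (t.2 - t.1.1).2 - (t.1.2 - t.1.1).2 * (t.2 - t.1.1).1.
exists ((- t.1.1.1 * (t.2.2 - t.1.1.2) + t.1.1.2 * (t.2.1 - t.1.1.1)) / D),
  ((t.2.2 - t.1.1.2) / D), (- (t.2.1 - t.1.1.1) / D) => x /=.
by rewrite /bary2 -/D /=; move: D^-1 => E; ring.
Qed.

Lemma affine_bary3 t : affine (bary3 t).
Proof.
pose D := (t.1.2 - t.1.1).1 * (t.2 - t.1.1).2 - (t.1.2 - t.1.1).2 * (t.2 - t.1.1).1.
exists ((- (t.1.2.1 - t.1.1.1) * t.1.1.2 + (t.1.2.2 - t.1.1.2) * t.1.1.1) / D),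
  (- (t.1.2.2 - t.1.1.2) / D), ((t.1.2.1 - t.1.1.1) / D) => x /=.
by rewrite /bary3 -/D /=; move: D^-1 => E; ring.
Qed.

Lemma affine_bary1 t : affine (bary1 t).
Proof.
have [a [b [c E2]]] := affine_bary2 t; have [a' [b' [c' E3]]] := affine_bary3 t.
by exists (1 - a - a'), (- b - b'), (- c - c') => x; rewrite /bary1 E2 E3; ring.
Qed.

Lemma bary_vertices t : nondegenerate t ->
  [/\ [/\ bary1 t t.1.1 = 1, bary2 t t.1.1 = 0 & bary3 t t.1.1 = 0],
      [/\ bary1 t t.1.2 = 0, bary2 t t.1.2 = 1 & bary3 t t.1.2 = 0] &
      [/\ bary1 t t.2 = 0, bary2 t t.2 = 0 & bary3 t t.2 = 1]].
Proof.
rewrite /nondegenerate/bary1/bary2/bary3/= => D0.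
by split; split; field.
Qed.

Lemma baryE t x : nondegenerate t ->
  x.1 = bary1 t x * t.1.1.1 + bary2 t x * t.1.2.1 + bary3 t x * t.2.1 /\
  x.2 = bary1 t x * t.1.1.2 + bary2 t x * t.1.2.2 + bary3 t x * t.2.2.
Proof. by rewrite /nondegenerate/bary1/bary2/bary3/= => D0; split; field. Qed.

Lemma tri_setE t : nondegenerate t ->
  tri_set t = [set x | [/\ 0 <= bary1 t x, 0 <= bary2 t x & 0 <= bary3 t x]].
Proof.
move=> nt; have [[b11 b12 b13] [b21 b22 b23] [b31 b32 b33]] := bary_vertices nt.
apply/seteqP; split=> x /= => [hx|[x1 x2 x3]].
  have neg F : affine F -> affine (fun x => - F x).
    by move=> [a [b [c FE]]]; exists (- a), (- b), (- c) => y; rewrite FE; ring.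
  by split; rewrite -oppr_le0;
    [apply: (affine_le (neg _ (affine_bary1 t))) hx
    |apply: (affine_le (neg _ (affine_bary2 t))) hx
    |apply: (affine_le (neg _ (affine_bary3 t))) hx];
    move=> v [[->|->]|->]; rewrite ?(b11, b12, b13, b21, b22, b23, b31, b32, b33); lra.
exists 3%N, (fun i : 'I_3 => nth 0 [:: t.1.1; t.1.2; t.2] i),
  (fun i : 'I_3 => nth 0 [:: bary1 t x; bary2 t x; bary3 t x] i); split.
- by move=> [[|[|[|//]]] ?] /=; [left; left | left; right | right].
- by move=> [[|[|[|//]]] ?] /=.
- by rewrite !big_ord_recl big_ord0/= /bary1; ring.
- rewrite !big_ord_recl big_ord0/= addr0 [LHS]surjective_pairing [RHS]surjective_pairing/=.
  by have [e1 e2] := baryE x nt; congr pair; rewrite ?{1}e1 ?{1}e2 /GRing.scale/= addrA.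
Qed.

Lemma tri_set_closed t : nondegenerate t -> closed (tri_set t).
Proof.
move=> nt; rewrite tri_setE//.
have cl F : affine F -> closed [set x | 0 <= F x].
  move=> aF; have -> : [set x | 0 <= F x] = F @^-1` [set y | 0 <= y] by [].
  by apply: (preimage_closed _ (@closed_ge R 0)) => x _; exact: affine_continuous.
have -> : [set x | [/\ 0 <= bary1 t x, 0 <= bary2 t x & 0 <= bary3 t x]] =
    [set x | 0 <= bary1 t x] `&` [set x | 0 <= bary2 t x] `&` [set x | 0 <= bary3 t x].
  by apply/seteqP; split=> x /= => [[]|[[]]].
by apply: closedI; [apply: closedI|]; apply: cl;
  [exact: affine_bary1 | exact: affine_bary2 | exact: affine_bary3].
Qed.

Lemma tri_set_bary t x : nondegenerate t -> tri_set t x ->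
  [/\ 0 <= bary1 t x, 0 <= bary2 t x & 0 <= bary3 t x].
Proof. by move=> nt; rewrite tri_setE. Qed.

Lemma covered_cons t T : covered (t :: T) = tri_set t `|` covered T.
Proof.
apply/seteqP; split=> x /=.
  by move=> [s]; rewrite inE => /predU1P[->|sT] sx; [left | right; exists s].
move=> [tx|[s sT sx]]; first by exists t => //; rewrite mem_head.
by exists s => //; rewrite inE sT orbT.
Qed.

Lemma covered_nil : covered [::] = @set0 (plane R).
Proof. by apply/seteqP; split=> x //= -[]. Qed.

Lemma covered_closed (T : seq (tri R)) : (forall t, t \in T -> nondegenerate t) -> closed (covered T).
Proof.
elim: T => [|t T IH] nT; first by rewrite covered_nil; exact: closed0.
rewrite covered_cons; apply: closedU; first by apply/tri_set_closed/nT/mem_head.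
by apply: IH => s sT; apply: nT; rewrite inE sT orbT.
Qed.

Lemma covered_continuous (T : seq (tri R)) F : (forall t, t \in T -> nondegenerate t) ->
  (forall t, t \in T -> exists2 G, affine G & {in tri_set t, F =1 G}) ->
  {within covered T, continuous F}.
Proof.
elim: T => [|t T IH] nT FT; first by rewrite covered_nil; exact: continuous_subspace0.
have nT' s : s \in T -> nondegenerate s by move=> sT; apply: nT; rewrite inE sT orbT.
rewrite covered_cons; apply: withinU_continuous.
- exact/tri_set_closed/nT/mem_head.
- exact: covered_closed.
- have [G aG FG] := FT t (mem_head _ _).
  apply: (@subspace_eq_continuous _ _ _ G).
    by move=> x /FG/esym.
  by apply: continuous_subspaceT => x; exact: affine_continuous.
- by apply: IH => // s sT; apply: FT; rewrite inE sT orbT.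
Qed.

Lemma covered_bounded (T : seq (tri R)) F :
  (forall t, t \in T -> exists a b c : R, forall x, tri_set t x -> F x = a + b * x.1 + c * x.2) ->
  exists M, forall x, covered T x -> `|F x| <= M.
Proof.
elim: T => [|t T IH] FT; first by exists 0 => x; rewrite covered_nil.
have [|M FM] := IH; first by move=> s sT; apply: FT; rewrite inE sT orbT.
have [a [b [c FE]]] := FT t (mem_head _ _).
pose m := `|F t.1.1| + `|F t.1.2| + `|F t.2|; exists (Num.max m M) => x.
rewrite covered_cons le_max => -[tx|/FM ->]; last by rewrite orbT.
apply/orP; left; rewrite FE//.
apply: (affine_bound (F := fun x => a + b * x.1 + c * x.2)) tx; first by exists a, b, c.
move=> v tv; rewrite -FE; last exact: sub_conv_hull.
by have := normr_ge0 (F t.1.1); have := normr_ge0 (F t.1.2); have := normr_ge0 (F t.2);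
  rewrite /m; case: tv => [[->|->]|->]; lra.
Qed.

Lemma fe_measurable_bounded (T : seq (tri R)) D w : (forall t, t \in T -> nondegenerate t) ->
  D `<=` covered T -> measurable D -> fe_space T D w ->
  measurable_fun setT w /\ exists M, forall x, `|w x| <= M.
Proof.
move=> nT DT mD [phi [cphi phiT wphi w0]]; split.
  have -> : w = phi \_ D.
    apply/funext => x; rewrite patchE.
    by case: ifPn; rewrite ?notin_setE ?in_setE; [exact: wphi | exact: w0].
  have cT := covered_closed nT.
  have mphi := closed_continuous_measurable_plane cT cphi.
  exact: (measurable_restrictT _ mD).1 (measurable_funS (closed_measurable_plane cT) DT mphi).
have [M FM] := covered_bounded phiT; exists (Num.max M 0) => x.
have [Dx|nDx] := pselect (D x); last by rewrite w0// normr0 le_max lexx orbT.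
by rewrite wphi// le_max FM//; exact: DT.
Qed.

Lemma fe_spaceB (T : seq (tri R)) D w1 w2 : fe_space T D w1 -> fe_space T D w2 ->
  fe_space T D (fun x => w1 x - w2 x).
Proof.
move=> [f [cf fT wf wf0]] [g [cg gT wg wg0]]; exists (fun x => f x - g x); split.
- by move=> x; apply: cvgB; [exact: cf | exact: cg].
- move=> t tT; have [a [b [c fE]]] := fT t tT; have [a' [b' [c' gE]]] := gT t tT.
  by exists (a - a'), (b - b'), (c - c') => x tx; rewrite fE// gE//; ring.
- by move=> x Dx; rewrite wf// wg.
- by move=> x Dx; rewrite wf0// wg0// subrr.
Qed.

Definition interp u t x : R :=
  bary1 t x * u t.1.1 + bary2 t x * u t.1.2 + bary3 t x * u t.2.

Lemma affine_interp u t : affine (interp u t).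
Proof.
have [a1 [b1 [c1 E1]]] := affine_bary1 t; have [a2 [b2 [c2 E2]]] := affine_bary2 t.
have [a3 [b3 [c3 E3]]] := affine_bary3 t.
exists (a1 * u t.1.1 + a2 * u t.1.2 + a3 * u t.2),
  (b1 * u t.1.1 + b2 * u t.1.2 + b3 * u t.2),
  (c1 * u t.1.1 + c2 * u t.1.2 + c3 * u t.2) => x.
by rewrite /interp E1 E2 E3; ring.
Qed.

Lemma interp_vertex u t v : nondegenerate t -> vertices t v -> interp u t v = u v.
Proof.
move=> nt; have [[b11 b12 b13] [b21 b22 b23] [b31 b32 b33]] := bary_vertices nt.
by move=> [[->|->]|->]; rewrite /interp ?(b11, b12, b13, b21, b22, b23, b31, b32, b33); ring.
Qed.

(** By conformity x is a convex combination of common vertices, and there both affine functions take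
    the values of u. *)
Lemma interp_consistent u T t t' x : (forall s, s \in T -> nondegenerate s) -> conforming T ->
  t \in T -> t' \in T -> tri_set t x -> tri_set t' x -> interp u t x = interp u t' x.
Proof.
move=> nT cT tT t'T tx t'x; have [->//|tt'] := pselect (t = t').
have : (tri_set t `&` tri_set t') x by [].
rewrite (cT _ _ tT t'T tt') => -[n [v [w [Av w0 w1 ->]]]].
rewrite !(affine_sum _ (affine_interp u _))//; apply: eq_bigr => i _; have [vt vt'] := Av i.
by rewrite !interp_vertex//; exact: nT.
Qed.

(** The first triangle of the list that contains x gives the value; on a conforming mesh the choice
    is immaterial by [interp_consistent]. *)
Definition interpolant u (T : seq (tri R)) x : R :=
  foldr (fun t r => if `[< tri_set t x >] then interp u t x else r) 0 T.

Lemma interpolantE u T t x : (forall s, s \in T -> nondegenerate s) -> conforming T ->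
  t \in T -> tri_set t x -> interpolant u T x = interp u t x.
Proof.
move=> nT cT tT tx.
suff h S : {subset S <= T} -> t \in S -> interpolant u S x = interp u t x by exact: h.
rewrite /interpolant; elim: S => //= s S IH sS; rewrite inE => tS.
case: asboolP => sx.
  by apply: (@interp_consistent u T); rewrite ?sS ?mem_head.
apply: IH; first by move=> s' s'S; apply: sS; rewrite inE s'S orbT.
by case/predU1P : tS => [ts|//]; move: sx; rewrite -ts.
Qed.

Lemma interpolant_fe u T D : (forall s, s \in T -> nondegenerate s) -> conforming T ->
  fe_space T D (interpolant u T \_ D).
Proof.
move=> nT cT; exists (interpolant u T); split.
- apply: covered_continuous => // t tT; exists (interp u t); first exact: affine_interp.
  by move=> x /set_mem tx; exact: interpolantE.
- move=> t tT; have [a [b [c E]]] := affine_interp u t; exists a, b, c => x tx.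
  by rewrite (interpolantE _ nT cT tT)// E.
- by move=> x Dx; rewrite patchE mem_set.
- by move=> x nDx; rewrite patchE memNset.
Qed.

Lemma tri_diam_coord t v v' : vertices t v -> vertices t v' ->
  (`|v'.1 - v.1| <= tri_diam t) * (`|v'.2 - v.2| <= tri_diam t).
Proof.
have H p q : dist2 p q <= tri_diam t ->
    ((`|q.1 - p.1| <= tri_diam t) * (`|q.2 - p.2| <= tri_diam t)) *
    ((`|p.1 - q.1| <= tri_diam t) * (`|p.2 - q.2| <= tri_diam t)).
  move=> pq; have [n1 n2] := norm2_coord (q - p).
  rewrite [`|p.1 - _|]distrC [`|p.2 - _|]distrC.
  by do 2!split; apply: le_trans pq.
have d0 : 0 <= tri_diam t by rewrite /tri_diam le_max dist2_ge0.
have k1 : dist2 t.1.1 t.1.2 <= tri_diam t by rewrite /tri_diam le_max lexx.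
have k2 : dist2 t.1.2 t.2 <= tri_diam t by rewrite /tri_diam !le_max lexx orbT.
have k3 : dist2 t.2 t.1.1 <= tri_diam t by rewrite /tri_diam !le_max lexx !orbT.
have [[? ?] [? ?]] := H _ _ k1; have [[? ?] [? ?]] := H _ _ k2; have [[? ?] [? ?]] := H _ _ k3.
by move=> [[->|->]|->] [[->|->]|->]; split; rewrite ?subrr ?normr0.
Qed.

Lemma tri_coord t x v : tri_set t x -> vertices t v ->
  (`|v.1 - x.1| <= tri_diam t) * (`|v.2 - x.2| <= tri_diam t).
Proof.
move=> tx tv; split.
  apply: (affine_bound (F := fun x => v.1 - x.1)) tx.
    by exists v.1, (-1), 0 => y; ring.
  by move=> v' tv'; have [] := tri_diam_coord tv' tv.
apply: (affine_bound (F := fun x => v.2 - x.2)) tx.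
  by exists v.2, 0, (-1) => y; ring.
by move=> v' tv'; have [] := tri_diam_coord tv' tv.
Qed.

Lemma mesh_size_tri (T : seq (tri R)) t : t \in T -> tri_diam t <= mesh_size T.
Proof.
rewrite /mesh_size; elim: T => // s T IH; rewrite inE big_cons le_max.
by case/predU1P => [->|/IH ->]; rewrite ?lexx ?orbT.
Qed.

Section error.
Variables (D : set (plane R)) (u : plane R -> R) (M : R).
Hypothesis du : forall s i x, (size s < 4)%N -> D x -> derivable (partial s u) x (unit_vec i).
Hypothesis Mu : forall s x, (size s <= 4)%N -> D x -> `|partial s u x| <= M.

(** The path goes from x along the first axis and then along the second. Each leg leaves a
    second-order remainder, and the third M h^2 is the price of taking the derivative of the second
    leg at x instead of the corner. *)
Lemma taylor1 x (a b h : R) : `|a| <= h -> `|b| <= h ->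
  (forall z : plane R, `|z.1| <= h -> `|z.2| <= h -> D (x + z)) ->
  `|u (x + (a, b)) - u x - a * partial [:: false] u x - b * partial [:: true] u x| <= 3 * (M * h ^+ 2).
Proof.
move=> ah bh xD.
have h0 : 0 <= h by exact: le_trans ah.
have small (s c : R) : 0 <= s <= 1 -> `|c| <= h -> `|c * s| <= h.
  by move=> /andP[s0 s1]; apply: le_trans; rewrite normrM ler_piMr// ger0_norm.
pose m := x + (a, 0).
have p1 : x + (a, b) = m + b *: unit_vec true.
  by rewrite [LHS]surjective_pairing [RHS]surjective_pairing /= /GRing.scale/= !mulr0 mulr1 !addr0.
have p2 : m = x + a *: unit_vec false.
  by rewrite [LHS]surjective_pairing [RHS]surjective_pairing /= /GRing.scale/= !mulr0 mulr1.
have D1 s : 0 <= s <= 1 -> D (x + (a * s) *: unit_vec false).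
  by move=> s01; apply: xD; rewrite /= /GRing.scale/= ?mulr0 ?mulr1 ?normr0//; exact: small.
have D2 s : 0 <= s <= 1 -> D (m + (b * s) *: unit_vec true).
  by move=> s01; rewrite /m -addrA; apply: xD;
    rewrite /= /GRing.scale/= ?mulr0 ?mulr1 ?addr0 ?add0r//; exact: small.
have M0 : 0 <= M.
  by apply: le_trans (normr_ge0 _) (Mu (s := [::]) isT (D1 0 _)); rewrite lexx ler01.
have : `|u (m + b *: unit_vec true) - u m - b * partial [:: true] u m| <= M * b ^+ 2.
  exact: (@partial_taylor2 _ D u M du Mu true [::] m b isT D2).
have : `|u (x + a *: unit_vec false) - u x - a * partial [:: false] u x| <= M * a ^+ 2.
  exact: (@partial_taylor2 _ D u M du Mu false [::] x a isT D1).
have := @partial_lipschitz _ D u M du Mu false [:: true] x a isT D1.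
rewrite -p1 -p2.
generalize (partial [:: true] u m) (partial [:: true] u x) (partial [:: false] u x) => uy uy0 ux.
move: (u (x + _)) (u m) (u x) => u1 um u0 l1 l2 l3 /=.
have sq c : `|c| <= h -> M * c ^+ 2 <= M * h ^+ 2.
  by move=> ch; rewrite ler_wpM2l// -[c ^+ 2]real_normK ?num_real// lerXn2r ?nnegrE.
have -> : u1 - u0 - a * ux - b * uy0 = (u1 - um - b * uy) + (um - u0 - a * ux) + b * (uy - uy0) by ring.
have l4 : `|b * (uy - uy0)| <= M * h ^+ 2.
  rewrite normrM expr2 mulrCA; apply: ler_pM => //; apply: le_trans l1 _.
  by rewrite ler_wpM2l.
apply: le_trans (ler_normD _ _) _; have := ler_normD (u1 - um - b * uy) (um - u0 - a * ux).
have := sq _ ah; have := sq _ bh; lra.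
Qed.

(** Barycentric coordinates reproduce affine functions, so in the expansion of the vertex values
    about x the terms of order 0 and 1 cancel, and a convex combination of the remainders is left.
    Expanding at x needs u smooth on a box about x. *)
Lemma interp_error t x (h : R) : nondegenerate t -> tri_set t x -> tri_diam t <= h ->
  (forall z : plane R, `|z.1| <= h -> `|z.2| <= h -> D (x + z)) ->
  `|interp u t x - u x| <= 3 * (M * h ^+ 2).
Proof.
move=> nt tx th xD.
have err v : vertices t v ->
    `|u v - u x - (v.1 - x.1) * partial [:: false] u x - (v.2 - x.2) * partial [:: true] u x|
      <= 3 * (M * h ^+ 2).
  move=> tv; have [v1 v2] := tri_coord tx tv.
  have := taylor1 (le_trans v1 th) (le_trans v2 th) xD.
  by rewrite (_ : x + _ = v)// [LHS]surjective_pairing [RHS]surjective_pairing /= !subrKC.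
have [b1 b2 b3] := tri_set_bary nt tx; have [e1 e2] := baryE x nt.
have b123 : bary1 t x + bary2 t x + bary3 t x = 1 by rewrite /bary1; ring.
have := err t.1.1 (or_introl (or_introl erefl)).
have := err t.1.2 (or_introl (or_intror erefl)).
have := err t.2 (or_intror erefl).
rewrite /interp.
generalize (partial [:: true] u x) (partial [:: false] u x) => uy ux.
move: (u t.1.1) (u t.1.2) (u t.2) (u x) => u1 u2 u3 u0.
move: (bary1 t x) (bary2 t x) (bary3 t x) b1 b2 b3 e1 e2 b123 => c1 c2 c3 c1_ge0 c2_ge0 c3_ge0 e1 e2 c123.
set r1 := (X in `|X| <= _); move=> l3; set r2 := (X in `|X| <= _); move=> l2.
set r3 := (X in `|X| <= _); move=> l1.
have -> : c1 * u1 + c2 * u2 + c3 * u3 - u0 = c1 * r3 + c2 * r2 + c3 * r1.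
  transitivity (c1 * u1 + c2 * u2 + c3 * u3 - (c1 + c2 + c3) * u0
    - ux * (c1 * t.1.1.1 + c2 * t.1.2.1 + c3 * t.2.1 - (c1 + c2 + c3) * x.1)
    - uy * (c1 * t.1.1.2 + c2 * t.1.2.2 + c3 * t.2.2 - (c1 + c2 + c3) * x.2)).
    by rewrite c123 !mul1r -e1 -e2 !subrr !mulr0 !subr0.
  by rewrite /r1 /r2 /r3; ring.
have -> : 3 * (M * h ^+ 2) = c1 * (3 * (M * h ^+ 2)) + c2 * (3 * (M * h ^+ 2)) + c3 * (3 * (M * h ^+ 2)).
  by rewrite -!mulrDl c123 mul1r.
have B c r : 0 <= c -> `|r| <= 3 * (M * h ^+ 2) -> `|c * r| <= c * (3 * (M * h ^+ 2)).
  by move=> c0 l; rewrite normrM ger0_norm// ler_wpM2l.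
apply: le_trans (ler_normD _ _) _; apply: lerD; last exact: B.
by apply: le_trans (ler_normD _ _) _; apply: lerD; exact: B.
Qed.

End error.

End Triangle.

(** * Symmetric kernels and the energy estimate *)

Section SymmetricForm.
Context d (T : measurableType d) (R : realType).
Variable mu : {sigma_finite_measure set T -> \bar R}.
Variables (k : T -> T -> R) (A : R).
Hypothesis mk : measurable_fun setT (fun q : T * T => k q.1 q.2).
Hypothesis k0 : forall x y, 0 <= k x y.
Hypothesis ksym : forall x y, k x y = k y x.
Hypothesis kA : forall x, (\int[mu]_y (k x y)%:E <= A%:E)%E.
Hypothesis ik : (mu \x mu)%E.-integrable setT (fun q => (k q.1 q.2)%:E).

Let mky x : measurable_fun setT (k x).
Proof.
exact: (measurableT_comp mk (pair1_measurable x)).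
Qed.

Lemma kernel_section_integrable (f : T -> R) (B : R) x : measurable_fun setT f ->
  (forall y, `|f y| <= B) -> mu.-integrable setT (fun y => (f y * k x y)%:E).
Proof.
move=> mf fB.
have ikx : mu.-integrable setT (fun y => (k x y)%:E).
  apply/integrableP; split; first by apply/measurable_EFinP; exact: mky.
  rewrite (eq_integral (fun y => (k x y)%:E)); last by move=> y _ /=; rewrite ger0_norm.
  by rewrite (le_lt_trans (kA x))// ltry.
apply: (@le_integrable _ _ _ mu _ _ _ (fun y => (B%:E * (k x y)%:E)%E)) => //.
- by apply/measurable_EFinP; exact: measurable_funM.
- move=> y _; rewrite /= lee_fin !normrM (ger0_norm (k0 _ _)) ler_wpM2r//.
  by rewrite (le_trans (fB y))// ler_norm.
- exact: integrableZl.
Qed.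

Lemma kernel_integrable (F : T * T -> R) (B : R) : measurable_fun setT F ->
  (forall q, `|F q| <= B) -> (mu \x mu)%E.-integrable setT (fun q => (F q * k q.1 q.2)%:E).
Proof.
move=> mF FB.
apply: (@le_integrable _ _ _ (mu \x mu)%E _ _ _ (fun q => (B%:E * (k q.1 q.2)%:E)%E)) => //.
- by apply/measurable_EFinP; exact: measurable_funM.
- move=> q _; rewrite /= lee_fin !normrM (ger0_norm (k0 _ _)) ler_wpM2r//.
  by rewrite (le_trans (FB q))// ler_norm.
- exact: integrableZl.
Qed.

Definition double_integral (F : T * T -> R) : R := \int[(mu \x mu)%E]_q (F q * k q.1 q.2).
Local Notation J := double_integral.

Section bounded.
Variables (F : T * T -> R) (B : R).
Hypotheses (mF : measurable_fun setT F) (FB : forall q, `|F q| <= B).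

Let mFx x : measurable_fun setT (fun y => F (x, y)).
Proof. exact: (measurableT_comp mF (pair1_measurable x)). Qed.

Let innerE x : (\int[mu]_y (F (x, y) * k x y)%:E)%E = (\int[mu]_y (F (x, y) * k x y))%:E.
Proof.
rewrite /Rintegral fineK//; apply: integrable_fin_num => //.
exact: (@kernel_section_integrable _ B).
Qed.

Lemma inner_integrable : mu.-integrable setT (fun x => (\int[mu]_y (F (x, y) * k x y))%:E).
Proof.
have := integrable_fubini_F (kernel_integrable mF FB).
by apply: eq_integrable => // x _; rewrite /fubini_F /= innerE.
Qed.

Lemma double_integral_iter : J F = \int[mu]_x \int[mu]_y (F (x, y) * k x y).
Proof.
rewrite /J /Rintegral -(integral12_prod_meas1 (kernel_integrable mF FB)).
by congr fine; apply: eq_integral => x _; rewrite /fubini_F /= innerE.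
Qed.

Lemma double_integral_swap : J (fun q => F (q.2, q.1)) = J F.
Proof.
rewrite /J /Rintegral; congr fine.
pose G (q : T * T) := (F q * k q.1 q.2)%:E.
have mG : measurable_fun setT G by apply/measurable_EFinP; exact: measurable_funM.
have swp : measurable_fun setT (fun q : T * T => (q.2, q.1)).
  by apply: measurable_fun_pair => /=; [exact: measurable_snd | exact: measurable_fst].
rewrite -(@integral_invariant _ _ _ _ (fun q => (q.2, q.1)) _ G)//.
  by apply: eq_integral => q _; rewrite /G /= ksym.
move=> f mf f0; have mf' : measurable_fun setT (fun q : T * T => f (q.2, q.1)).
  exact: (measurableT_comp mf).
by rewrite (fubini_tonelli1 _ mf')// (fubini_tonelli2 _ mf).
Qed.

End bounded.

Lemma double_integral_iterM (w : T -> R) (G : T * T -> R) (B C : R) :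
  measurable_fun setT w -> (forall x, `|w x| <= B) ->
  measurable_fun setT G -> (forall q, `|G q| <= C) ->
  mu.-integrable setT (fun x => (w x * \int[mu]_y (G (x, y) * k x y))%:E) /\
  J (fun q => w q.1 * G q) = \int[mu]_x (w x * \int[mu]_y (G (x, y) * k x y)).
Proof.
move=> mw wB mG GC; pose F (q : T * T) := w q.1 * G q.
have mF : measurable_fun setT F.
  by apply: measurable_funM => //; apply: (measurableT_comp mw); exact: measurable_fst.
have FB q : `|F q| <= B * C by rewrite normrM ler_pM.
have inner x : \int[mu]_y (F (x, y) * k x y) = w x * \int[mu]_y (G (x, y) * k x y).
  rewrite -RintegralZl//; last first.
    apply: (@kernel_section_integrable _ C) => //.
    exact: (measurableT_comp mG (pair1_measurable x)).
  by apply: eq_Rintegral => y _; rewrite /F /= mulrA.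
split.
  by have := inner_integrable mF FB; apply: eq_integrable => // x _; rewrite inner.
by rewrite (double_integral_iter mF FB); apply: eq_Rintegral => x _; rewrite inner.
Qed.

Lemma double_integralD (F G : T * T -> R) (B : R) : measurable_fun setT F -> measurable_fun setT G ->
  (forall q, `|F q| <= B) -> (forall q, `|G q| <= B) -> J (fun q => F q + G q) = J F + J G.
Proof.
move=> mF mG FB GB; rewrite /J -RintegralD//.
- by apply: eq_Rintegral => q _; rewrite mulrDl.
- exact: kernel_integrable FB.
- exact: kernel_integrable GB.
Qed.

Lemma double_integralZ (c : R) (F : T * T -> R) (B : R) : measurable_fun setT F -> (forall q, `|F q| <= B) ->
  J (fun q => c * F q) = c * J F.
Proof.
move=> mF FB; rewrite /J -RintegralZl//; last exact: kernel_integrable FB.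
by apply: eq_Rintegral => q _; rewrite mulrA.
Qed.

Lemma le_double_integral (F G : T * T -> R) (B : R) : measurable_fun setT F -> measurable_fun setT G ->
  (forall q, `|F q| <= B) -> (forall q, `|G q| <= B) -> (forall q, F q <= G q) -> J F <= J G.
Proof.
move=> mF mG FB GB FG; apply: le_Rintegral => //.
- exact: kernel_integrable FB.
- exact: kernel_integrable GB.
- by move=> q _; rewrite ler_wpM2r.
Qed.

Definition energy_form (u v : T -> R) : R :=
  J (fun q => (u q.2 - u q.1) * (v q.2 - v q.1)).

Section form_theory.
Implicit Types u v w e : T -> R.

Definition bmeas u : Prop := measurable_fun setT u /\ exists B, forall x, `|u x| <= B.

Let diff_meas u : measurable_fun setT u -> measurable_fun setT (fun q : T * T => u q.2 - u q.1).
Proof.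
move=> mu'; apply: measurable_funB; apply: (measurableT_comp mu');
  [exact: measurable_snd | exact: measurable_fst].
Qed.

Let diff_bound u B : (forall x, `|u x| <= B) -> forall x y, `|u y - u x| <= 2 * B.
Proof.
move=> uB x y; apply: le_trans (ler_normB _ _) _.
by have := uB x; have := uB y; lra.
Qed.

Let pair_meas u v : bmeas u -> bmeas v -> exists B,
  measurable_fun setT (fun q : T * T => (u q.2 - u q.1) * (v q.2 - v q.1)) /\
  forall q, `|(u q.2 - u q.1) * (v q.2 - v q.1)| <= B.
Proof.
move=> [mu' [B uB]] [mv [C vC]]; exists (2 * B * (2 * C)); split.
  by apply: measurable_funM; exact: diff_meas.
by move=> q; rewrite normrM ler_pM// diff_bound.
Qed.

Lemma formDr u v w : bmeas u -> bmeas v -> bmeas w ->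
  energy_form w (fun x => u x + v x) = energy_form w u + energy_form w v.
Proof.
move=> bu bv bw; have [B [m1 B1]] := pair_meas bw bu; have [C [m2 C1]] := pair_meas bw bv.
rewrite /energy_form -(@double_integralD _ _ (Num.max B C))//.
- by apply: eq_Rintegral => q _; congr (_ * _); ring.
- by move=> q; rewrite le_max B1.
- by move=> q; rewrite le_max C1 orbT.
Qed.

Lemma form_young u v : bmeas u -> bmeas v -> energy_form u v <= 4^-1 * energy_form u u + energy_form v v.
Proof.
move=> bu bv; have [B [m1 B1]] := pair_meas bu bu; have [C [m2 C1]] := pair_meas bv bv.
have [D [m3 D1]] := pair_meas bu bv.
have m1' := measurable_funM (@measurable_cst _ _ _ _ setT (4^-1 : R)) m1.
have B1' q : `|4^-1 * ((u q.2 - u q.1) * (u q.2 - u q.1))| <= B.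
  apply: le_trans (B1 q); rewrite normrM ler_piMl// ger0_norm; lra.
rewrite /energy_form -(double_integralZ _ m1 B1) -(@double_integralD _ _ (Num.max B C))//; first last.
- by move=> q; rewrite le_max C1 orbT.
- by move=> q; rewrite le_max B1'.
apply: (@le_double_integral _ _ (Num.max D (B + C))) => //.
- exact: measurable_funD.
- by move=> q; rewrite le_max D1.
- move=> q; rewrite le_max; apply/orP; right; apply: le_trans (ler_normD _ _) _.
  exact: lerD.
- move=> q; move: (u q.2 - u q.1) (v q.2 - v q.1) => a b.
  by have := sqr_ge0 (a / 2 - b); lra.
Qed.

(** Nonlocal integration by parts: in -2 w(x) (e(y) - e(x)) one of the two copies has its variables
    exchanged, which the symmetry of k allows. *)
Lemma form_nonlocal w e : bmeas w -> bmeas e ->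
  energy_form w e = - 2 * \int[mu]_x (w x * \int[mu]_y ((e y - e x) * k x y)).
Proof.
move=> [mw [B wB]] be; have [me [C eC]] := be.
pose G (q : T * T) := e q.2 - e q.1; have mG : measurable_fun setT G := diff_meas me.
have GC q : `|G q| <= 2 * C by exact: diff_bound.
have [_ <-] := double_integral_iterM mw wB mG GC.
pose F (q : T * T) := w q.1 * G q.
have mF : measurable_fun setT F.
  by apply: measurable_funM => //; apply: (measurableT_comp mw); exact: measurable_fst.
have FB q : `|F q| <= B * (2 * C) by rewrite normrM ler_pM.
have mF' : measurable_fun setT (fun q => F (q.2, q.1)).
  apply: (measurableT_comp mF).
  by apply: measurable_fun_pair => /=; [exact: measurable_snd | exact: measurable_fst].
have -> : -2 * J F = -1 * (J (fun q => F (q.2, q.1)) + J F).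
  by rewrite (double_integral_swap mF); ring.
rewrite -(@double_integralD _ _ (B * (2 * C)))// -(@double_integralZ _ _ (B * (2 * C) + B * (2 * C))).
- by apply: eq_Rintegral => q _; congr (_ * _); rewrite /F /G /=; ring.
- exact: measurable_funD.
- by move=> q; apply: le_trans (ler_normD _ _) _; exact: lerD.
Qed.

(** From (a - b)^2 <= 2 (a^2 + b^2), where by symmetry both squares contribute the same, at most A
    times the square norm. *)
Lemma form_le_L2 u : bmeas u -> mu.-integrable setT (fun x => (u x ^+ 2)%:E) ->
  energy_form u u <= 4 * A * \int[mu]_x (u x ^+ 2).
Proof.
move=> bu iu; have [mu' [B uB]] := bu; have [C [m1 C1]] := pair_meas bu bu.
have B0 : 0 <= B by exact: le_trans (normr_ge0 _) (uB point).
pose F (q : T * T) := u q.1 ^+ 2.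
have mF : measurable_fun setT F.
  by apply: measurable_funX; apply: (measurableT_comp mu'); exact: measurable_fst.
have FB q : `|F q| <= B ^+ 2 by rewrite normrX lerXn2r ?nnegrE.
have mF' : measurable_fun setT (fun q => F (q.2, q.1)).
  apply: (measurableT_comp mF).
  by apply: measurable_fun_pair => /=; [exact: measurable_snd | exact: measurable_fst].
have mFF := measurable_funD mF' mF.
have FFB q : `|F (q.2, q.1) + F q| <= B ^+ 2 + B ^+ 2.
  by apply: le_trans (ler_normD _ _) _; rewrite lerD.
apply: (@le_trans _ _ (2 * J (fun q => F (q.2, q.1) + F q))).
  rewrite -(double_integralZ _ mFF FFB).
  apply: (@le_double_integral _ _ (Num.max C (2 * (B ^+ 2 + B ^+ 2)))) => //.
  - exact: measurable_funM.
  - by move=> q; rewrite le_max C1.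
  - move=> q; rewrite le_max; apply/orP; right.
    by rewrite normrM (ger0_norm (ler0n _ 2)); apply: ler_wpM2l => //; exact: FFB.
  - move=> q; rewrite /F /=; move: (u q.2) (u q.1) => a b.
    by have := sqr_ge0 (a + b); lra.
rewrite (@double_integralD _ _ (B ^+ 2))// (double_integral_swap mF).
suff : J F <= A * \int[mu]_x u x ^+ 2 by lra.
rewrite (double_integral_iter mF FB) -RintegralZl//.
apply: le_Rintegral => //.
- exact: (inner_integrable mF FB).
- exact: (integrableZl measurableT A iu).
- move=> x _; rewrite /F /=.
  have kx : mu.-integrable setT (fun y => (1 * k x y)%:E).
    by apply: (@kernel_section_integrable _ 1) => // y; rewrite normr1.
  have -> : \int[mu]_y (u x ^+ 2 * k x y) = \int[mu]_y (u x ^+ 2 * (1 * k x y)).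
    by apply: eq_Rintegral => y _; rewrite mul1r.
  rewrite RintegralZl// mulrC ler_wpM2r ?sqr_ge0// /Rintegral -lee_fin fineK.
    by apply: le_trans (kA x); under eq_integral do rewrite mul1r.
  exact: integrable_fin_num kx.
Qed.

Lemma form_energy u : bmeas u ->
  (\int[mu]_x \int[mu]_y ((u y - u x) ^+ 2 * k x y)%:E)%E = (energy_form u u)%:E.
Proof.
move=> bu; have [C [m1 C1]] := pair_meas bu bu.
have iu := kernel_integrable m1 C1.
rewrite /energy_form /J /Rintegral fineK; last exact: integrable_fin_num iu.
rewrite (fubini_tonelli1 (m1 := mu) (m2 := mu))//.
- exact/measurable_EFinP/measurable_funM.
- by move=> q; rewrite lee_fin mulr_ge0// -expr2 sqr_ge0.
Qed.

(** Young's inequality spends a quarter of the energy of w on the term with eta, and the Poincare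
    inequality bounds the last term of the residual estimate by another quarter; the remaining half
    gives the factor 2. *)
Lemma energy_estimate w eta e (K V rho : R) :
  bmeas w -> bmeas eta -> bmeas e -> (forall x, w x = eta x + e x) ->
  mu.-integrable setT (fun x => (w x ^+ 2)%:E) -> 0 < K ->
  \int[mu]_x (w x ^+ 2) <= K * energy_form w w ->
  energy_form w e <= K * rho ^+ 2 * V + (4 * K)^-1 * \int[mu]_x (w x ^+ 2) ->
  energy_form w w <= 2 * energy_form eta eta + 2 * (K * rho ^+ 2 * V).
Proof.
move=> bw beta be wE iw K0 wK we.
have := form_young bw beta.
have := formDr beta be bw.
rewrite (_ : (fun x => eta x + e x) = w); last by apply/funext => x; rewrite wE.
have : (4 * K)^-1 * \int[mu]_x (w x ^+ 2) <= 4^-1 * energy_form w w.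
  rewrite invfM -mulrA ler_wpM2l ?invr_ge0//.
  by rewrite mulrC ler_pdivrMr// mulrC.
lra.
Qed.

End form_theory.

End SymmetricForm.

(** * Nonlocal Poincare inequality *)

Section Poincare.
Context {R : realType}.
Variables (gam : R -> plane R -> plane R -> R) (gamt : R -> R -> R) (gamma : R -> R).
Hypothesis KC : kernel_conditions gam gamt gamma.
Variables (w : plane R -> R) (B : R).
Hypotheses (mw : measurable_fun setT w) (wB : forall x, ~ box 0 B x -> w x = 0) (B0 : 0 < B).
Local Open Scope ereal_scope.

Definition shift_diff (z : plane R) : \bar R := \int[leb2]_x ((w (x + z) - w x) ^+ 2)%:E.

Let mshift z : measurable_fun setT (fun x : plane R => w (x + z)%R).
Proof.
by apply: (measurableT_comp mw); apply: measurable_fun_pair => /=; exact: measurable_funD.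
Qed.

Let msq (f g : plane R -> R) : measurable_fun setT f -> measurable_fun setT g ->
  measurable_fun setT (fun x => ((f x - g x) ^+ 2)%:E).
Proof.
by move=> mf mg; apply/measurable_EFinP; apply: measurable_funX; exact: measurable_funB.
Qed.

Lemma shift_diff_ge0 z : 0 <= shift_diff z.
Proof. by apply: integral_ge0 => x _; rewrite lee_fin sqr_ge0. Qed.

(** The triangle inequality in L^2 for n translates, kept in squared form: (a + b)^2 <= (1 + 1/N)
    a^2 + (1 + N) b^2 is applied inductively, and (1 + 1/N) N^2 + (1 + N) = (1 + N)^2. *)
Lemma shift_diff_muln z n : shift_diff (n%:R *: z)%R <= (n%:R ^+ 2)%:E * shift_diff z.
Proof.
case: n => [|n].
  rewrite expr0n mul0e /shift_diff integral0_eq// => x _.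
  by rewrite scale0r addr0 subrr expr0n.
elim: n => [|n IH]; first by rewrite scale1r expr1n mul1e.
set N : R := n.+1%:R; have N0 : (0 < N)%R by rewrite ltr0n.
have -> : n.+2%:R = (1 + N)%R :> R by rewrite /N -natr1 addrC.
apply: (@le_trans _ _ (\int[leb2]_x (((1 + N^-1) * (w (x + z + N *: z) - w (x + z)) ^+ 2)%:E
    + ((1 + N) * (w (x + z) - w x) ^+ 2)%:E))).
  apply: ge0_le_integral => //.
  - by move=> x _; rewrite lee_fin sqr_ge0.
  - exact: msq.
  - apply: emeasurable_funD; apply/measurable_EFinP; apply: measurable_funM => //;
      apply: measurable_funX; apply: measurable_funB => //.
    apply: eq_measurable_fun (mshift (z + N *: z)%R) => x _.
    by rewrite addrA.
  - move=> x _; rewrite -EFinD lee_fin scalerDl scale1r addrA.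
    move: (w (x + z + N *: z)%R) (w (x + z)%R) (w x) => a b e.
    have := sqr_ge0 ((a - b) - N * (b - e))%R.
    have NN : (N^-1 * N = 1)%R by rewrite mulVf// gt_eqF.
    have Ni : (0 <= N^-1)%R by rewrite invr_ge0 ltW.
    move=> /(mulr_ge0 Ni); rewrite -subr_ge0 => h; rewrite -subr_ge0.
    rewrite (_ : (_ - _)%R = (N^-1 * (a - b - N * (b - e)) ^+ 2
      + (N^-1 * N - 1) * (2 * (a - b) * (b - e) - N * (b - e) ^+ 2))%R); last by ring.
    by rewrite NN subrr mul0r addr0.
rewrite ge0_integralD//; first last.
- by apply/measurable_EFinP; apply: measurable_funM => //; apply: measurable_funX; exact: measurable_funB.
- by move=> x _; rewrite lee_fin mulr_ge0 ?sqr_ge0// addr_ge0// ltW.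
- apply/measurable_EFinP; apply: measurable_funM => //; apply: measurable_funX; apply: measurable_funB => //.
  by apply: eq_measurable_fun (mshift (z + N *: z)%R) => x _; rewrite addrA.
- by move=> x _; rewrite lee_fin mulr_ge0 ?sqr_ge0// addr_ge0// invr_ge0 ltW.
pose f (x : plane R) := ((1 + N^-1) * (w (x + N *: z) - w x) ^+ 2)%:E.
rewrite -/(shift_diff z) (_ : \int[_]_x _ = \int[leb2]_x f (x + z)%R)//.
rewrite ge0_integral_leb2_shift; last 2 first.
- by apply/measurable_EFinP; apply: measurable_funM => //; apply: measurable_funX; exact: measurable_funB.
- by move=> x; rewrite lee_fin mulr_ge0 ?sqr_ge0// addr_ge0// invr_ge0 ltW.
have Z (r : R) (z' : plane R) : (0 <= r)%R ->
    \int[leb2]_x (r * (w (x + z') - w x) ^+ 2)%R%:E = r%:E * shift_diff z'.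
  move=> r0; under eq_integral do rewrite EFinM.
  rewrite ge0_integralZl_EFin//; last exact: msq.
  by move=> x _; rewrite lee_fin sqr_ge0.
rewrite !Z ?addr_ge0 ?invr_ge0 ?(ltW N0)//.
apply: (@le_trans _ _ ((1 + N^-1)%:E * ((N ^+ 2)%:E * shift_diff z) + (1 + N)%:E * shift_diff z)).
  rewrite leeD2r// lee_pmul2l// lte_fin; first by rewrite addr_gt0// invr_gt0.
rewrite muleA -EFinM -ge0_muleDl ?lee_fin; last 2 first.
- by rewrite mulr_ge0 ?sqr_ge0// addr_ge0// invr_ge0 ltW.
- by rewrite addr_ge0// ltW.
rewrite -EFinD (_ : ((1 + N^-1) * N ^+ 2 + (1 + N))%R = ((1 + N) ^+ 2)%R)//.
by field; rewrite gt_eqF.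
Qed.

Lemma shift_diff_far (z : plane R) : (`|z.1| <= 1)%R ->
  (z.1 ^+ 2)%:E * \int[leb2]_x (w x ^+ 2)%:E <= ((2 * B + 1) ^+ 2)%:E * shift_diff z.
Proof.
move=> z1; have [->|z0] := eqVneq z.1 0%R.
  by rewrite expr0n mul0e mule_ge0 ?shift_diff_ge0// lee_fin sqr_ge0.
have az : (0 < `|z.1|)%R by rewrite normr_gt0.
(* n |z_1| > 2 B carries the box off itself, so at every x at most one of w(x) and w(x + n z) is
   nonzero. Minimality keeps n |z_1| <= 2 B + |z_1| <= 2 B + 1. *)
pose n := (Num.truncn (2 * B / `|z.1|)).+1.
have [nl nu] : (n%:R * `|z.1| <= 2 * B + 1)%R /\ (2 * B < n%:R * `|z.1|)%R.
  have /andP[h1 h2] : ((Num.truncn (2 * B / `|z.1|))%:R <= 2 * B / `|z.1| < n%:R)%R.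
    by apply: Num.Theory.truncn_itv; rewrite divr_ge0// mulr_ge0// ltW.
  rewrite -ltr_pdivrMr// h2; split => //.
  by rewrite /n -natr1 mulrDl mul1r lerD// -ler_pdivlMr.
apply: (@le_trans _ _ ((z.1 ^+ 2)%:E * shift_diff (n%:R *: z)%R)).
  rewrite lee_pmul2l//; last by rewrite lte_fin exprn_even_gt0//= orbC z0.
  apply: ge0_le_integral => //.
  - by move=> x _; rewrite lee_fin sqr_ge0.
  - by apply/measurable_EFinP; exact: measurable_funX.
  - exact: msq.
  - move=> x _; rewrite lee_fin.
    have [bx|bx] := pselect (box 0%R B x); last by rewrite (wB bx) expr0n sqr_ge0.
    rewrite (_ : w (x + n%:R *: z) = 0)%R ?sub0r ?sqrrN//; apply: wB => -[+ _].
    move: bx => -[+ _]; rewrite /= !in_itv/= !sub0r !add0r => /andP[? ?] /andP[].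
    rewrite /GRing.scale/=; case: (ltrP 0 z.1) => zp ? ?; move: nu.
      by rewrite gtr0_norm//; lra.
    by rewrite ler0_norm//; lra.
apply: (@le_trans _ _ ((z.1 ^+ 2)%:E * ((n%:R ^+ 2)%:E * shift_diff z))).
  by rewrite lee_wpmul2l ?lee_fin ?sqr_ge0// shift_diff_muln.
rewrite muleA -EFinM lee_wpmul2r ?shift_diff_ge0// lee_fin -exprMn mulrC.
rewrite -real_normK ?num_real// lerXn2r ?nnegrE ?normr_ge0//.
  by rewrite addr_ge0// mulr_ge0// ltW.
by rewrite normrM normr_nat.
Qed.

Variables (Omega : set (plane R)) (k : plane R -> plane R -> R) (c d : R).
Hypothesis wO : forall x, ~ Omega x -> w x = 0%R.
Hypothesis mk : measurable_fun setT (fun q : plane R * plane R => k q.1 q.2).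
Hypothesis k0 : forall x y, (0 <= k x y)%R.
Hypotheses (d01 : (0 < d <= 1)%R) (c01 : (0 < c <= 1)%R).
Hypothesis kK : forall x y, Omega x \/ Omega y -> (norm2 (y - x) / d < c)%R ->
  (radial_kernel gamma d (y - x) <= 2 * k x y)%R.

Let d0 : (0 < d)%R. Proof. by case/andP : d01. Qed.

Let near (z : plane R) : R := (\1_(`]-oo, c[%classic) (norm2 z / d) * radial_kernel gamma d z)%R.

Let near_ge0 z : (0 <= near z)%R.
Proof. by rewrite mulr_ge0// (radial_kernel_ge0 KC). Qed.

Let mnear : measurable_fun setT near.
Proof.
apply: measurable_funM; last exact: measurable_radial_kernel KC d.
apply: (measurableT_comp (f := \1_(`]-oo, c[%classic) : R -> R)) => //.
by apply: measurable_funM => //; exact: measurable_norm2.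
Qed.

Lemma poincare :
  (Phi gamma c)%:E * \int[leb2]_x (w x ^+ 2)%:E <=
  (2 * (2 * B + 1) ^+ 2)%:E * \int[leb2]_x \int[leb2]_y ((w y - w x) ^+ 2 * k x y)%:E.
Proof.
set I := \int[leb2]_x (w x ^+ 2)%:E; set D := (2 * B + 1)%R.
have I0 : 0 <= I by apply: integral_ge0 => x _; rewrite lee_fin sqr_ge0.
have D0 : (0 <= D)%R by rewrite /D addr_ge0// mulr_ge0// ltW.
have mdiff : measurable_fun setT (fun q : plane R * plane R => (w q.2 - w q.1)%R).
  apply: measurable_funB; apply: (measurableT_comp mw).
    exact: measurable_snd.
  exact: measurable_fst.
have mqs : measurable_fun setT (fun q : plane R * plane R => (q.2 + q.1)%R : plane R).
  by apply: measurable_fun_pair => /=; apply: measurable_funD;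
    do ?[exact: (measurableT_comp measurable_fst measurable_snd)
        |exact: (measurableT_comp measurable_fst measurable_fst)
        |exact: (measurableT_comp measurable_snd measurable_snd)
        |exact: (measurableT_comp measurable_snd measurable_fst)].
pose F (q : plane R * plane R) := ((w (q.2 + q.1)%R - w q.2) ^+ 2 * near q.1)%:E.
have mF : measurable_fun setT F.
  apply/measurable_EFinP; apply: measurable_funM.
    apply: measurable_funX; apply: measurable_funB; first exact: (measurableT_comp mw mqs).
    exact: (measurableT_comp mw measurable_snd).
  exact: (measurableT_comp mnear measurable_fst).
have F0 q : 0 <= F q by rewrite lee_fin mulr_ge0 ?sqr_ge0.
have innerF z : \int[leb2]_x F (z, x) = (near z)%:E * shift_diff z.
  rewrite -ge0_integralZl_EFin//.
  - by apply: eq_integral => x _; rewrite -EFinM mulrC.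
  - by move=> x _; rewrite lee_fin sqr_ge0.
  - exact: msq.
apply: (@le_trans _ _ ((D ^+ 2)%:E * \int[leb2]_z \int[leb2]_x F (z, x))).
  have c01' : (0 <= c <= 1)%R by case/andP: c01 => c0 ->; rewrite ltW.
  rewrite -(radial_kernel_moment2 KC false d0 c01').
  have mcoord : measurable_fun setT (fun z : plane R => (coord false z ^+ 2 *
      \1_(`]-oo, c[%classic) (norm2 z / d) * radial_kernel gamma d z)%:E).
    apply/measurable_EFinP; apply: eq_measurable_fun (measurable_funM _ mnear).
      by move=> z _; rewrite /= mulrA.
    by apply: measurable_funX; exact: measurable_fst.
  have coord0 (z : plane R) : 0 <= (coord false z ^+ 2 *
      \1_(`]-oo, c[%classic) (norm2 z / d) * radial_kernel gamma d z)%:E.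
    by rewrite -mulrA lee_fin mulr_ge0 ?sqr_ge0//; exact: near_ge0.
  rewrite -ge0_integralZr//.
  rewrite -ge0_integralZl//; last 3 first.
  - exact: (measurable_fun_fubini_tonelli_F (m2 := area) F mF F0).
  - by move=> z _; apply: integral_ge0.
  - by rewrite lee_fin sqr_ge0.
  apply: ge0_le_integral => //.
  - by move=> z _; rewrite mule_ge0.
  - exact: emeasurable_funM.
  - by apply: emeasurable_funM => //; exact: (measurable_fun_fubini_tonelli_F (m2 := area) F mF F0).
  - move=> z _; rewrite innerF muleCA -mulrA [(_ * (\1_ _ _ * _))%R]mulrC EFinM -/(near z) -muleA.
    have [zc|zc] := ltP (norm2 z / d)%R c.
      rewrite lee_wpmul2l//; first by rewrite lee_fin.
      apply: shift_diff_far; have [z1 _] := norm2_coord z; apply: le_trans z1 _.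
      apply: ltW; move: zc; rewrite ltr_pdivrMr// => zc; apply: lt_le_trans zc _.
      by case/andP: c01 => c0 c1; case/andP: d01 => _ d1; rewrite mulr_ile1// ltW.
    have -> : near z = 0%R by rewrite /near indicE memNset ?mul0r//= in_itv/= ltNge zc.
    by rewrite !mul0e.
(* With the base point outside, the displacement z can be replaced by the second point y = x + z,
   and the radial kernel compared with [k]. *)
rewrite (fubini_tonelli (m1 := area) (m2 := area))//.
have -> : (2 * D ^+ 2)%:E = (D ^+ 2)%:E * 2%:E by rewrite -EFinM mulrC.
rewrite -muleA; apply: lee_wpmul2l; first by rewrite lee_fin sqr_ge0.
rewrite -ge0_integralZl//; last 2 first.
- apply: (measurable_fun_fubini_tonelli_F (m2 := area) (fun q => ((w q.2 - w q.1) ^+ 2 * k q.1 q.2)%:E)).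
    by apply/measurable_EFinP; apply: measurable_funM => //; exact: measurable_funX.
  by move=> q; rewrite lee_fin mulr_ge0 ?sqr_ge0.
- by move=> x _; apply: integral_ge0 => y _; rewrite lee_fin mulr_ge0 ?sqr_ge0.
apply: ge0_le_integral => //.
- by move=> x _; apply: integral_ge0.
- exact: (measurable_fun_fubini_tonelli_G (m1 := area) F mF F0).
- apply: emeasurable_funM => //.
  apply: (measurable_fun_fubini_tonelli_F (m2 := area) (fun q => ((w q.2 - w q.1) ^+ 2 * k q.1 q.2)%:E)).
    by apply/measurable_EFinP; apply: measurable_funM => //; exact: measurable_funX.
  by move=> q; rewrite lee_fin mulr_ge0 ?sqr_ge0.
move=> x _.
have mky : measurable_fun setT (k x) by exact: (measurableT_comp mk (pair1_measurable x)).
have mdx : measurable_fun setT (fun y : plane R => (y - x)%R).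
  by apply: measurable_fun_pair => /=; exact: measurable_funB.
pose g (y : plane R) := ((w y - w x) ^+ 2 * near (y - x)%R)%:E.
have mg : measurable_fun setT g.
  apply/measurable_EFinP; apply: measurable_funM.
    by apply: measurable_funX; exact: measurable_funB.
  exact: (measurableT_comp mnear mdx).
have g0 y : 0 <= g y by rewrite lee_fin mulr_ge0 ?sqr_ge0.
rewrite (_ : \int[_]_y F (y, x) = \int[leb2]_y g (y + x)%R); last first.
  by apply: eq_integral => y _; rewrite /F /g /= [(x + y)%R]addrC addrK.
rewrite ge0_integral_leb2_shift// -ge0_integralZl_EFin//; last 2 first.
- by move=> y _; rewrite lee_fin mulr_ge0 ?sqr_ge0.
- apply/measurable_EFinP; apply: measurable_funM => //.
  by apply: measurable_funX; exact: measurable_funB.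
apply: ge0_le_integral => //.
- under eq_fun do rewrite -EFinM; apply/measurable_EFinP; do 2!apply: measurable_funM => //.
  by apply: measurable_funX; exact: measurable_funB.
move=> y _; rewrite -EFinM lee_fin mulrCA /near.
(* The comparison of kernels is available only if one of the points is in Omega; for the other pairs
   w vanishes at both. *)
have [xy|/not_orP[nx ny]] := pselect (Omega x \/ Omega y); last first.
  by rewrite !wO// subrr expr0n !mul0r !mulr0.
rewrite mulrCA [leRHS]mulrCA; apply: ler_wpM2l; first exact: sqr_ge0.
rewrite indicE; case: (boolP (_ \in _)) => [|_]; last by rewrite mul0r mulr_ge0.
by rewrite in_setE /= in_itv/= mul1r => ?; exact: kK.
Qed.

End Poincare.

(** * The polygonally truncated kernel *)

Section InscribedDisc.
Context {R : realType}.
Implicit Types (x y : plane R) (s : seq (plane R)).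

Lemma inner_radius_disc x s (r y : R) : 0 < y -> y <= inner_radius x s -> r < y -> disc x r `<=` region s.
Proof.
move=> y0 yr ry; rewrite /inner_radius in yr; set A := [set r | _] in yr.
have A0 : A !=set0 by exists 0; split => // z; rewrite /disc/= ltNge dist2_ge0.
(* If the radii are unbounded, [sup] takes its default value 0, which [0 < y] rules out. *)
have [bA|nbA] := pselect (has_ubound A); last first.
  move: yr; rewrite sup_out; last by case.
  by rewrite leNgt y0.
have [r' [r'0 Ar'] rr'] := @sup_adherent _ A (y - r) (ltac:(by rewrite subr_gt0)) (conj A0 bA).
move=> z xz; apply: Ar'; apply: lt_trans xz _.
by apply: le_lt_trans rr'; rewrite lerBrDr addrC subrK.
Qed.

Lemma inscribed_size x d s : inscribed x d s -> (1 < size s)%N.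
Proof.
move=> [[s0 sne _] _]; rewrite ltn_neqAle s0 andbT; apply/eqP => s1.
by have := sne _ s0; rewrite /next_vertex -s1 eqxx.
Qed.

Lemma sin_le_id (a : R) : 0 <= a -> sin a <= a.
Proof.
move=> a0; have [|c _] := @MVT_segment R sin cos 0 a a0.
  by apply: continuous_subspaceT => x; exact: continuous_sin.
by rewrite sin0 !subr0 => ->; rewrite ler_piMl// cos_le1.
Qed.

(** The side is at most 2 C sin(pi / n), and sin a <= a. A polygon has at least two sides, which
    makes the sine positive and the denominator legitimate. *)
Lemma longest_side_le x d s (C : R) : inscribed x d s ->
  longest_side s / (2 * sin (pi / (size s)%:R)) <= C -> 0 <= C ->
  longest_side s <= 2 * pi * C / (size s)%:R.
Proof.
move=> /inscribed_size s1 lC C0.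
have n0 : 0 < (size s)%:R :> R by rewrite ltr0n (ltn_trans _ s1).
have n2 : 2 <= (size s)%:R :> R by rewrite ler_nat.
have p0 := @pi_gt0 R.
have a0 : 0 < pi / (size s)%:R :> R by rewrite divr_gt0.
have s0 : 0 < sin (pi / (size s)%:R : R).
  apply: sin_gt0_pi; rewrite a0 /= ltr_pdivrMr//.
  have : pi * 2 <= pi * (size s)%:R :> R by rewrite ler_wpM2l// ltW.
  lra.
have sle : sin (pi / (size s)%:R) <= pi / (size s)%:R :> R by exact/sin_le_id/ltW.
move: lC; rewrite ler_pdivrMr ?mulr_gt0// => /le_trans; apply.
have -> : C * (2 * sin (pi / (size s)%:R)) = 2 * (C * sin (pi / (size s)%:R)) by ring.
have -> : 2 * pi * C / (size s)%:R = 2 * (C * (pi / (size s)%:R)) by ring.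
by do 2!rewrite ler_wpM2l//.
Qed.

(** The radius is the distance from the centre to a chord of length H. When H > 2 d the square root
    is 0 and the disc is empty. *)
Lemma inscribed_disc x d s (H y2 : R) y : inscribed x d s -> 0 < d -> longest_side s <= H -> 0 <= longest_side s ->
  0 < y2 -> y2 <= inner_radius x s ->
  dist2 x y < Num.sqrt (1 - H ^+ 2 / (4 * d ^+ 2)) * d -> region s y.
Proof.
move=> ins d0 sH s0 y20 y2r xy.
have [a0|a0] := ltP (1 - H ^+ 2 / (4 * d ^+ 2)) 0.
  by move: xy; rewrite ltr0_sqrtr// mul0r ltNge dist2_ge0.
apply: (@inscribed_region _ _ _ _ ins (y2 / 2)).
- by rewrite divr_gt0.
- by apply: (inner_radius_disc y20 y2r); rewrite ltr_pdivrMr// ltr_pMr// ltr1n.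
rewrite sqdistE; apply: (@lt_le_trans _ _ ((Num.sqrt (1 - H ^+ 2 / (4 * d ^+ 2)) * d) ^+ 2)).
  by rewrite ltr_sqr// nnegrE ?dist2_ge0// (le_trans _ (ltW xy))// dist2_ge0.
rewrite exprMn sqr_sqrtr// mulrBl mul1r.
have -> : H ^+ 2 / (4 * d ^+ 2) * d ^+ 2 = H ^+ 2 / 4 by field; rewrite gt_eqF.
by rewrite lerB// ler_pM2r// lerXn2r ?nnegrE// (le_trans s0).
Qed.

Lemma one_sub_sqrt (a : R) : 0 <= a -> 1 - Num.sqrt (1 - a) <= a.
Proof.
move=> a0; have [a1|a1] := ltP 1 a.
  by apply: le_trans (ltW a1); rewrite gerDl oppr_le0 sqrtr_ge0.
have := sqr_sqrtr (a := 1 - a); rewrite subr_ge0 => /(_ a1).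
have := sqrtr_ge0 (1 - a); set s := Num.sqrt _ => s0 sa.
have : s <= 1 by rewrite -sqrtr1 /s ler_sqrt// gerDl oppr_le0.
move=> s1; have : s ^+ 2 <= s by rewrite expr2 ler_piMl.
lra.
Qed.

End InscribedDisc.

(** * The symmetric cut-off kernel on the whole plane *)

Section TruncatedKernel.
Context {R : realType}.
Variables (gam : R -> plane R -> plane R -> R) (gamt : R -> R -> R) (gamma : R -> R).
Hypothesis KC : kernel_conditions gam gamt gamma.
Variables (E : set (plane R)) (d : R) (p : plane R -> seq (plane R)).
Hypotheses (mE : measurable E) (d0 : 0 < d).
Let S : set (plane R * plane R) := [set q | [/\ E q.1, E q.2 & region (p q.1) q.2]].
Hypothesis mS : measurable S.

(** The mean of the two polygon indicators, restricted to pairs of points of E: the polygons are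
    assumed measurable on such pairs, and a kernel supported in a set of finite area is integrable
    over the whole product. The condition |y - x| < d is left to the radial factor. *)
Definition cut (x y : plane R) : R := 2^-1 * (\1_S (x, y) + \1_S (y, x)).
Definition cut_kernel (x y : plane R) : R := radial_kernel gamma d (y - x) * cut x y.

Lemma cut01 x y : 0 <= cut x y <= 1.
Proof.
rewrite /cut !indicE; case: (_ \in S); case: (_ \in S) => /=; lra.
Qed.

Lemma cutC x y : cut x y = cut y x.
Proof. by rewrite /cut addrC. Qed.

Lemma cut_ge (y x : plane R) : E x -> E y -> region (p x) y -> 1 <= 2 * cut x y.
Proof.
move=> Ex Ey xy; rewrite /cut mulrA mulfV ?pnatr_eq0// mul1r indicE mem_set//= lerDl.
by rewrite indicE ler0n.
Qed.

Lemma cut1 x y : E x -> E y -> region (p x) y -> region (p y) x -> cut x y = 1.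
Proof. by move=> Ex Ey xy yx; rewrite /cut !indicE !mem_set//=; lra. Qed.

Lemma cut0 x y : ~ (E x /\ E y) -> cut x y = 0.
Proof.
move=> nE; rewrite /cut !indicE !memNset/= ?addr0 ?mulr0//; first by move=> [? ? _]; apply: nE.
by move=> [? ? _]; apply: nE.
Qed.

Lemma radial_kernelC (x y : plane R) : radial_kernel gamma d (y - x) = radial_kernel gamma d (x - y).
Proof. by rewrite -opprB /radial_kernel /norm2 /= !sqrrN. Qed.

Lemma cut_kernelC x y : cut_kernel x y = cut_kernel y x.
Proof. by rewrite /cut_kernel radial_kernelC cutC. Qed.

Lemma cut_kernel_ge0 x y : 0 <= cut_kernel x y.
Proof.
by rewrite mulr_ge0//; [exact: radial_kernel_ge0 KC _ _ | case/andP: (cut01 x y)].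
Qed.

Lemma cut_kernel0 x y : ~ (E x /\ E y) -> cut_kernel x y = 0.
Proof. by move=> nE; rewrite /cut_kernel cut0// mulr0. Qed.

(* The kernels differ on the diagonal, where gam is not given by gamma. *)
Lemma poly_kernelE x y (a : R) : E x -> E y -> (x = y -> a = 0) ->
  a * poly_kernel (gam d) d p x y = a * cut_kernel x y.
Proof.
move=> Ex Ey a0; have [xy|xy] := eqVneq x y; first by rewrite a0// !mul0r.
congr (a * _); rewrite /poly_kernel (kernelE KC d0 xy) /cut_kernel /cut.
rewrite [2^-1 * _]mulrC -mulrA; have [xyd|xyd] := ltP (norm2 (y - x)) d; last first.
  by rewrite radial_kernel_out// !mul0r.
congr (_ * (_ * (_ + _))).
  rewrite !indicE; congr ((nat_of_bool _)%:R); apply/idP/idP; rewrite !in_setE//=.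
  by case.
rewrite !indicE; congr ((nat_of_bool _)%:R); apply/idP/idP; rewrite !in_setE/=; first by case.
by case.
Qed.

Let mS' : measurable_fun setT (fun q : plane R * plane R => \1_S (q.2, q.1) : R).
Proof.
apply: (measurableT_comp (f := \1_S : plane R * plane R -> R)) => //.
by apply: measurable_fun_pair => /=; [exact: measurable_snd | exact: measurable_fst].
Qed.

Lemma measurable_cut : measurable_fun setT (fun q : plane R * plane R => cut q.1 q.2).
Proof.
apply: measurable_funM => //; apply: measurable_funD => //.
apply: eq_measurable_fun (measurable_indic mS) => q _ /=.
by rewrite -surjective_pairing.
Qed.

Lemma measurable_diff : measurable_fun setT (fun q : plane R * plane R => q.2 - q.1 : plane R).
Proof.
by apply: measurable_fun_pair => /=; apply: measurable_funB;
    do ?[exact: (measurableT_comp measurable_fst measurable_snd)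
        |exact: (measurableT_comp measurable_fst measurable_fst)
        |exact: (measurableT_comp measurable_snd measurable_snd)
        |exact: (measurableT_comp measurable_snd measurable_fst)].
Qed.

Lemma measurable_cut_kernel : measurable_fun setT (fun q : plane R * plane R => cut_kernel q.1 q.2).
Proof.
apply: measurable_funM; last exact: measurable_cut.
exact: (measurableT_comp (measurable_radial_kernel KC d) measurable_diff).
Qed.

Let A : R := d ^- 2 * mass0 gamma.

Lemma cut_kernel_mass x : (\int[area]_y (cut_kernel x y)%:E <= A%:E)%E.
Proof.
rewrite areaE /A -(radial_kernel_mass KC d0).
pose f (z : plane R) := (radial_kernel gamma d (z - x))%:E.
rewrite -(ge0_integral_leb2_shift (f := fun z => (radial_kernel gamma d z)%:E) (- x)); last 2 first.
- by apply/measurable_EFinP; exact: measurable_radial_kernel KC d.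
- by move=> z; rewrite lee_fin; exact: radial_kernel_ge0 KC _ _.
apply: ge0_le_integral => //.
- by move=> y _; rewrite lee_fin cut_kernel_ge0.
- apply/measurable_EFinP; exact: (measurableT_comp measurable_cut_kernel (pair1_measurable x)).
- apply/measurable_EFinP; apply: (measurableT_comp (measurable_radial_kernel KC d)).
  by apply: measurable_fun_pair => /=; exact: measurable_funD.
- move=> y _; rewrite lee_fin /cut_kernel ler_piMr//; first exact: radial_kernel_ge0 KC _ _.
  by case/andP: (cut01 x y).
Qed.

Variable V : R.
Hypothesis EV : (leb2 E <= V%:E)%E.

Lemma cut_kernel_integrable :
  (area \x area)%E.-integrable setT (fun q => (cut_kernel q.1 q.2)%:E).
Proof.
have mk : measurable_fun setT (fun q : plane R * plane R => (cut_kernel q.1 q.2)%:E).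
  by apply/measurable_EFinP; exact: measurable_cut_kernel.
apply/integrable12ltyP => //.
have A0 : 0 <= A by rewrite mulr_ge0// ?invr_ge0 ?exprn_ge0 ?(ltW d0)// (mass0_ge0 KC).
apply: (@le_lt_trans _ _ (\int[area]_x (A%:E * (\1_E x)%:E))%E).
  apply: ge0_le_integral => //.
  - by move=> x _; exact: integral_ge0.
  - apply: (measurable_fun_fubini_tonelli_F (m2 := area) (fun q => `|(cut_kernel q.1 q.2)%:E|%E)) => //.
    exact: measurableT_comp.
  - by apply: emeasurable_funM => //; apply/measurable_EFinP.
  - move=> x _; have [Ex|nEx] := pselect (E x).
      rewrite indicE mem_set// mule1.
      rewrite (eq_integral (fun y => (cut_kernel x y)%:E)); first exact: cut_kernel_mass.
      by move=> y _ /=; rewrite ger0_norm// cut_kernel_ge0.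
    rewrite integral0_eq ?mule_ge0 ?lee_fin ?indicE//.
    by move=> y _ /=; rewrite cut_kernel0 ?normr0// => -[].
rewrite ge0_integralZl_EFin//; last by apply/measurable_EFinP.
rewrite areaE integral_indic// setIT; apply: (@le_lt_trans _ _ (A%:E * V%:E)%E).
  by rewrite lee_wpmul2l.
by rewrite -EFinM ltry.
Qed.

End TruncatedKernel.

(** * Galerkin error at a fixed pair (delta, h) *)

Section Galerkin.
Context {R : realType}.
Variables (gam : R -> plane R -> plane R -> R) (gamt : R -> R -> R) (gamma : R -> R).
Hypothesis KC : kernel_conditions gam gamt gamma.
Variables (Omega : set (plane R)) (B : R).
Hypotheses (oO : open Omega) (bO : boundary Omega !=set0) (OB : Omega `<=` box 0 B) (B0 : 0 < B).
Variables (d : R) (d01 : 0 < d <= 1) (p : plane R -> seq (plane R)).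
Let E := enlarged Omega d.
Let ker := poly_kernel (gam d) d p.
Hypothesis mS : measurable [set q : plane R * plane R | [/\ E q.1, E q.2 & region (p q.1) q.2]].
Variables (V Vc : R).
Hypotheses (EV : (leb2 E <= V%:E)%E) (cV : (leb2 (collar Omega d) <= Vc%:E)%E).

Let d0 : 0 < d. Proof. by case/andP : d01. Qed.
Let mO : measurable Omega := open_measurable_plane oO.
Let mE : measurable E := enlarged_measurable d oO bO.
Let mC : measurable (collar Omega d) := collar_measurable d oO bO.
Let k := cut_kernel gamma E d p.
Let k0 := cut_kernel_ge0 KC E d p : forall x y, 0 <= k x y.
Let kC := @cut_kernelC R gamma E d p : forall x y, k x y = k y x.
Let mk : measurable_fun setT (fun q : plane R * plane R => k q.1 q.2) := measurable_cut_kernel KC d mS.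
Let kA : forall x, (\int[area]_y (k x y)%:E <= (d ^- 2 * mass0 gamma)%:E)%E := cut_kernel_mass KC d0 mS.
Let ik : (area \x area)%E.-integrable setT (fun q : plane R * plane R => (k q.1 q.2)%:E) :=
  cut_kernel_integrable KC mE d0 mS EV.
Let J := double_integral area k.
Let form := energy_form area k.

Let OE : Omega `<=` E. Proof. by move=> x; left. Qed.
Let CE : collar Omega d `<=` E. Proof. by move=> x; right. Qed.
Let OC x : Omega x -> ~ collar Omega d x. Proof. by move=> Ox [/(_ Ox)]. Qed.

Let V0 : 0 <= V.
Proof. by rewrite -lee_fin; apply: le_trans EV; exact: measure_ge0. Qed.

Lemma bmeasB (u v : plane R -> R) : bmeas u -> bmeas v -> bmeas (fun x => u x - v x).
Proof.
move=> [mu [M uM]] [mv [N vN]]; split; first exact: measurable_funB.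
by exists (M + N) => x; apply: le_trans (ler_normB _ _) _; exact: lerD.
Qed.

Lemma bmeasD (u v : plane R -> R) : bmeas u -> bmeas v -> bmeas (fun x => u x + v x).
Proof.
move=> [mu [M uM]] [mv [N vN]]; split; first exact: measurable_funD.
by exists (M + N) => x; apply: le_trans (ler_normD _ _) _; exact: lerD.
Qed.

Lemma bmeas_sqr (u : plane R -> R) : bmeas u -> bmeas (fun x => u x ^+ 2).
Proof.
move=> [mu [M uM]]; split; first exact: measurable_funX.
have M0 : 0 <= M := le_trans (normr_ge0 _) (uM 0).
by exists (M ^+ 2) => x; rewrite normrX lerXn2r ?nnegrE.
Qed.

Lemma bmeas_integrable (u : plane R -> R) : bmeas u -> (forall x, ~ E x -> u x = 0) ->
  area.-integrable setT (fun x => (u x)%:E).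
Proof.
move=> [mu [M uM]] u0; have M0 : 0 <= M := le_trans (normr_ge0 _) (uM 0).
apply: (@le_integrable _ _ _ area _ _ _ (fun x => (M%:E * (\1_E x)%:E)%E)) => //.
- exact/measurable_EFinP.
- move=> x _; rewrite /= lee_fin [leRHS]ger0_norm; last by rewrite mulr_ge0// indicE ler0n.
  have [Ex|nEx] := pselect (E x); first by rewrite indicE mem_set// mulr1.
  by rewrite u0// normr0 mulr_ge0// indicE ler0n.
- apply: integrableZl => //; apply/integrableP; split; first exact/measurable_EFinP.
  rewrite (eq_integral (fun x => (\1_E x)%:E)); last by move=> x _ /=; rewrite ger0_norm// indicE ler0n.
  by rewrite integral_indic// setIT (le_lt_trans EV)// ltry.
Qed.

Lemma kernel_restrict (A : set (plane R)) (g : plane R -> R) x : A `<=` E -> E x ->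
  (forall y, A y -> x = y -> g y = 0) ->
  \int[leb2]_(y in A) (g y * ker x y) = \int[area]_y (\1_A y * g y * k x y).
Proof.
move=> AE Ex g0; rewrite Rintegral_mkcond; apply: eq_Rintegral => y _.
rewrite patchE indicE; case: ifPn => /= Ay; last by rewrite !mul0r.
rewrite mul1r; have {}Ay : A y by rewrite in_setE in Ay.
by rewrite (poly_kernelE KC p d0 Ex (AE _ Ay))// => /(g0 _ Ay).
Qed.

Lemma energy_cut (u v : plane R -> R) : (forall x, E x -> u x = v x) ->
  (\int[leb2]_(x in E) \int[leb2]_(y in E) ((u y - u x) ^+ 2 * ker x y)%:E =
   \int[area]_x \int[area]_y ((v y - v x) ^+ 2 * k x y)%:E)%E.
Proof.
move=> uv; rewrite integral_mkcond; apply: eq_integral => x _.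
rewrite patchE; case: ifPn => Ex; last first.
  rewrite integral0_eq// => y _; rewrite /k cut_kernel0 ?mulr0// => -[]/mem_set h _.
  by rewrite h in Ex.
rewrite integral_mkcond; apply: eq_integral => y _; rewrite patchE.
rewrite in_setE in Ex; case: ifPn => Ey.
  rewrite in_setE in Ey; rewrite -!uv// (poly_kernelE KC p d0 Ex Ey)// => ->.
  by rewrite subrr expr0n.
by rewrite /k cut_kernel0 ?mulr0// => -[_ /mem_set h]; rewrite h in Ey.
Qed.

Variables (c t Ca : R).
Hypothesis c01 : 0 < c <= 1.
Hypothesis pc : forall x y, E x -> dist2 x y < c * d -> region (p x) y.
Hypothesis pt : forall x y, E x -> dist2 x y < t * d -> region (p x) y.
Hypothesis annulus : (\int[leb2]_z (\1_(`[t, +oo[%classic) (norm2 z / d) * radial_kernel gamma d z)%:E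
     <= (d ^- 2 * (Ca * (1 - t)))%:E)%E.

Variables (D : set (plane R)) (ut0 : plane R -> R) (M : R).
Hypotheses (ED : E `<=` D) (mut : measurable_fun E ut0).
Hypothesis du : forall s i x, (size s < 4)%N -> D x -> derivable (partial s ut0) x (unit_vec i).
Hypothesis Mu : forall s x, (size s <= 4)%N -> D x -> `|partial s ut0 x| <= M.

Variables (f gh u0h : plane R -> R) (T0 Tc : seq (tri R)) (ef e1 e2 : R).
Hypothesis mf : measurable_fun Omega f.
Hypothesis f_lap : forall x, Omega x -> `|f x + laplacian ut0 x| <= ef.
Hypothesis T0_nd : forall s, s \in T0 -> nondegenerate s.
Hypothesis Tc_nd : forall s, s \in Tc -> nondegenerate s.
Hypotheses (T0_conf : conforming T0) (T0_cov : Omega `<=` covered T0).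
Hypothesis Tc_cov : collar Omega d `<=` covered Tc.
Hypothesis gh_fe : fe_space Tc (collar Omega d) gh.
Hypothesis u0h_sol : CDG_solution Omega d ker f gh T0 u0h.
Hypothesis interp_le : forall x, Omega x -> `|interpolant ut0 T0 x - ut0 x| <= e1.
Hypothesis gh_le : forall x, collar Omega d x -> `|gh x - ut0 x| <= e2.

Let uh x := u0h x + gh x.
Let U : plane R -> R := ut0 \_ E.
Let vI : plane R -> R := interpolant ut0 T0 \_ Omega.
(** On the collar the interpolant and the approximation both equal [gh], which cancels; so [w]
    vanishes off Omega and is in the test space. *)
Let w x := vI x - u0h x.
Let eta x := vI x + gh x - U x.
Let e x := U x - uh x.

Let bu0h : bmeas u0h.
Proof. by have [fe _] := u0h_sol; exact: (fe_measurable_bounded T0_nd T0_cov mO fe). Qed.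
Let fe_vI : fe_space T0 Omega vI := interpolant_fe ut0 Omega T0_nd T0_conf.
Let bvI : bmeas vI := fe_measurable_bounded T0_nd T0_cov mO fe_vI.
Let bgh : bmeas gh := fe_measurable_bounded Tc_nd Tc_cov mC gh_fe.
Let buh : bmeas uh := bmeasD bu0h bgh.
Let bw : bmeas w := bmeasB bvI bu0h.
Let bU : bmeas U.
Proof.
split; first exact: (measurable_restrictT _ mE).1.
exists (Num.max M 0) => x; rewrite /U patchE le_max; case: ifPn => [|_]; last by rewrite normr0 lexx orbT.
by rewrite in_setE => Ex; rewrite (Mu (s := [::]))//; exact: ED.
Qed.
Let beta : bmeas eta := bmeasB (bmeasD bvI bgh) bU.
Let be : bmeas e := bmeasB bU buh.

Let u0h0 x : ~ Omega x -> u0h x = 0.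
Proof. by have [[phi [_ _ _ h]] _] := u0h_sol; exact: h. Qed.
Let gh0 x : ~ collar Omega d x -> gh x = 0.
Proof. by have [phi [_ _ _ h]] := gh_fe; exact: h. Qed.
Let w0 x : ~ Omega x -> w x = 0.
Proof. by move=> nO; rewrite /w /vI patchE memNset// u0h0// subrr. Qed.
Let out x : ~ E x -> ~ Omega x /\ ~ collar Omega d x.
Proof. by move=> nE; split=> h; apply: nE; [left | right]. Qed.
Let e0 x : ~ E x -> e x = 0.
Proof.
move=> nE; have [nO nC] := out nE.
by rewrite /e /U patchE memNset// /uh u0h0// gh0// addr0 subrr.
Qed.
Let eta0 x : ~ E x -> eta x = 0.
Proof.
move=> nE; have [nO nC] := out nE.
by rewrite /eta /U /vI !patchE !memNset// gh0// addr0 subrr.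
Qed.
Let w_split x : w x = eta x + e x.
Proof. by rewrite /w /eta /e /uh; ring. Qed.

Let mdiff (a b : plane R -> R) : measurable_fun setT a -> measurable_fun setT b ->
  measurable_fun setT (fun q : plane R * plane R => a q.2 - b q.1).
Proof.
move=> ma mb; apply: measurable_funB.
  exact: (measurableT_comp ma measurable_snd).
exact: (measurableT_comp mb measurable_fst).
Qed.

(** Turns the nested integrals of the CDG equation into double integrals against the cut-off kernel.
    The last hypothesis makes the integrand vanish on the diagonal, where the two kernels may
    differ. *)
Let weighted (A : set (plane R)) (a b : plane R -> R) : measurable A -> A `<=` E ->
  bmeas a -> bmeas b -> (forall x, Omega x -> A x -> a x - b x = 0) ->
  exists C, [/\ measurable_fun setT (fun q : plane R * plane R => \1_A q.2 * (a q.2 - b q.1)),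
    forall q : plane R * plane R, `|\1_A q.2 * (a q.2 - b q.1)| <= C &
    \int[leb2]_(x in Omega) (w x * \int[leb2]_(y in A) ((a y - b x) * ker x y)) =
    J (fun q => w q.1 * (\1_A q.2 * (a q.2 - b q.1)))].
Proof.
move=> mA AE [ma [M1 aM]] [mb [M2 bM]] ab0; exists (M1 + M2).
have mG : measurable_fun setT (fun q : plane R * plane R => \1_A q.2 * (a q.2 - b q.1)).
  apply: measurable_funM; last exact: mdiff.
  exact: (measurableT_comp (measurable_indic mA) measurable_snd).
have GC (q : plane R * plane R) : `|\1_A q.2 * (a q.2 - b q.1)| <= M1 + M2.
  rewrite normrM; apply: le_trans (_ : `|a q.2 - b q.1| <= _).
    by rewrite ler_piMl// indicE; case: (_ \in A); rewrite ?normr1 ?normr0.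
  by apply: le_trans (ler_normB _ _) _; exact: lerD.
split => //; have [mw [Mw wM]] := bw.
have [_ JE] := double_integral_iterM mk k0 kA ik mw wM mG GC; rewrite /J JE.
rewrite Rintegral_mkcond; apply: eq_Rintegral => x _; rewrite patchE; case: ifPn => [|nO]; last first.
  by rewrite w0 ?mul0r// => /mem_set h; rewrite h in nO.
rewrite in_setE => Ox; congr (_ * _); rewrite kernel_restrict//; first exact: OE.
by move=> y Ay xy; rewrite -xy; apply: ab0 => //; rewrite xy.
Qed.

(** The CDG equation for the test function [w], with its integrals over y in Omega and y in the
    collar merged: uh(x) = u0h(x) for x in Omega, and uh(y) is u0h(y) or gh(y) according to the
    place of y. *)
Let galerkin : - 2 * \int[area]_x (w x * \int[area]_y ((uh y - uh x) * k x y)) =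
  \int[leb2]_(x in Omega) (f x * w x).
Proof.
have [fe sol] := u0h_sol; have {sol} := sol w (fe_spaceB fe_vI fe).
have [C1 [m1 b1 ->]] := weighted mO OE bu0h bu0h (fun x _ _ => subrr (u0h x)).
have [C2 [m2 b2 ->]] := weighted mC CE bgh bu0h (fun x Ox Cx => False_ind _ (OC Ox Cx)).
set J1 := J _; set J2 := J _ => J12.
have -> : \int[leb2]_(x in Omega) (f x * w x) = - 2 * (J1 + J2).
  by move: J12; set I := Rintegral _ _ _; lra.
congr (_ * _); have [mw [Mw wM]] := bw; have [muh [Muh uhM]] := buh.
have [_ <-] := double_integral_iterM mk k0 kA ik mw wM (mdiff muh muh)
  (fun q => le_trans (ler_normB _ _) (lerD (uhM q.2) (uhM q.1))).
have mw1 : measurable_fun setT (fun q : plane R * plane R => w q.1).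
  exact: (measurableT_comp mw measurable_fst).
rewrite /J1 /J2 /J -(@double_integralD _ _ _ _ _ mk k0 ik _ _ (Num.max (Mw * C1) (Mw * C2))); first last.
- by move=> q; rewrite le_max normrM; apply/orP; right; apply: ler_pM.
- by move=> q; rewrite le_max normrM; apply/orP; left; apply: ler_pM.
- exact: measurable_funM.
- exact: measurable_funM.
apply: eq_Rintegral => q _ /=.
have [Ox|nO] := pselect (Omega q.1); last by rewrite w0// !mul0r addr0 mul0r.
have [Ey|nE] := pselect (E q.2); last by rewrite /k cut_kernel0 ?mulr0// => -[].
congr (_ * _); rewrite -mulrDr; congr (_ * _); rewrite /uh [gh q.1]gh0; last exact: OC.
rewrite !indicE; have [Oy|Cy] := Ey.
  by rewrite mem_set// memNset; [rewrite gh0 /=; [ring | exact: OC] | exact: OC].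
rewrite memNset; last by move=> Oy; exact: OC Oy Cy.
by rewrite mem_set// u0h0 /=; [ring | move=> Oy; exact: OC Oy Cy].
Qed.

Let L x := \int[area]_y ((U y - U x) * k x y).

Let residual : form w e = - 2 * \int[area]_x (w x * L x) - \int[leb2]_(x in Omega) (f x * w x).
Proof.
rewrite -galerkin -!(form_nonlocal mk k0 kC kA ik)//.
rewrite -/(form w U) -/(form w uh).
have <- : form w e + form w uh = form w U.
  rewrite /form -(formDr mk k0 ik be buh bw); congr (energy_form _ _ _ _).
  by apply/funext => x; rewrite /e; ring.
by rewrite addrK.
Qed.

Let rho := 4 * M * d ^+ 2 + 4 * M * (Ca * ((1 - t) / d)) + ef.

(** Where the discs of radius t d about x and y lie in their polygons, both indicators are 1 and the
    kernel is not cut for |y - x| < t d. This makes [truncation_error] applicable with the factor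
    [cut]. *)
Let consistency x : Omega x -> `|- 2 * L x - f x| <= rho.
Proof.
move=> Ox; have Ex := OE Ox.
have LE : L x = \int[leb2]_(y in E) ((ut0 y - ut0 x) * (radial_kernel gamma d (y - x) * cut E p x y)).
  rewrite [RHS]Rintegral_mkcond; apply: eq_Rintegral => y _; rewrite /U !patchE [x \in E]mem_set//.
  case: ifPn => // nE; rewrite /k cut_kernel0 ?mulr0// => -[_ /mem_set h].
  by rewrite h in nE.
have mcx : measurable_fun E (cut E p x).
  apply: (measurable_funS measurableT) => //.
  exact: (measurableT_comp (measurable_cut mS) (pair1_measurable x)).
have dE : disc x d `<=` E by move=> y; exact: enlarged_disc.
have cut1' y : E y -> dist2 x y < t * d -> cut E p x y = 1.
  move=> Ey xy; apply: cut1 => //; first exact: pt.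
  by apply: pt => //; rewrite /dist2 -opprB /norm2/= !sqrrN.
have := truncation_error KC d0 annulus mE ED dE du Mu mut mcx (fun y => cut01 E p x y) cut1'.
have := f_lap Ox; rewrite -LE /rho.
move: (laplacian ut0 x) (L x) (f x) (4 * M * d ^+ 2 + 4 * M * (Ca * ((1 - t) / d))) => a b g r.
by rewrite !ler_norml => /andP[? ?] /andP[? ?]; apply/andP; split; lra.
Qed.

(** The constant of [poincare]; it depends on the size of Omega and on c, not on delta. *)
Let K := 2 * (2 * B + 1) ^+ 2 / Phi gamma c.

Let Phi0 : 0 < Phi gamma c := Phi_gt0 KC c01.
Let K0 : 0 < K.
Proof.
have D0 : 0 < 2 * B + 1 by rewrite addr_gt0// mulr_gt0.
by apply: divr_gt0 => //; apply: mulr_gt0 => //; exact: exprn_gt0.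
Qed.

Let iw2 : area.-integrable setT (fun x => (w x ^+ 2)%:E).
Proof.
apply: bmeas_integrable; first exact: bmeas_sqr.
by move=> x nE; rewrite w0 ?expr0n//; move=> Ox; apply/nE/OE.
Qed.

Let w_poincare : \int[area]_x (w x ^+ 2) <= K * form w w.
Proof.
have wB x : ~ box 0 B x -> w x = 0 by move=> nB; apply: w0 => Ox; apply/nB/OB.
have kK x y : Omega x \/ Omega y -> norm2 (y - x) / d < c ->
    radial_kernel gamma d (y - x) <= 2 * k x y.
  move=> xy; rewrite ltr_pdivrMr// => nc.
  have nd : dist2 x y < d by apply: lt_le_trans nc _; rewrite ler_piMl// ?(ltW d0)//; case/andP: c01.
  have [Ex Ey] : E x /\ E y.
    case: xy => [Ox|Oy]; first by split; [exact: OE | exact: enlarged_disc nd].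
    split; last exact: OE.
    by apply: (enlarged_disc Oy); move: nd; rewrite /dist2 -opprB /norm2/= !sqrrN.
  rewrite /k /cut_kernel mulrCA ler_peMr ?(radial_kernel_ge0 KC)//.
  by apply: cut_ge => //; exact: pc.
have := poincare KC bw.1 wB B0 w0 mk k0 d01 c01 kK.
rewrite -areaE -[X in (_ <= _ * X)%E]/(\int[area]_x \int[area]_y ((w y - w x) ^+ 2 * k x y)%:E)%E.
rewrite (form_energy mk k0 ik bw) -/(form w w).
have -> : (\int[area]_x (w x ^+ 2)%:E)%E = (\int[area]_x (w x ^+ 2))%:E.
  by rewrite /Rintegral fineK// (integrable_fin_num _ iw2).
rewrite -!EFinM lee_fin /K => h.
rewrite -(ler_pM2l Phi0); apply: le_trans h _.
rewrite [leRHS](_ : _ = 2 * (2 * B + 1) ^+ 2 * form w w)//.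
by field; rewrite gt_eqF.
Qed.

(** Young's inequality at each point, a b <= K a^2 + b^2 / (4 K), with a the consistency error and b
    = w; the weight is the one that [energy_estimate] can absorb. *)
Let residual_le : form w e <= K * rho ^+ 2 * V + (4 * K)^-1 * \int[area]_x (w x ^+ 2).
Proof.
have [mw [Mw wM]] := bw; have [mU' [MU UM]] := bU.
have [iwL _] := double_integral_iterM mk k0 kA ik mw wM (mdiff mU' mU')
  (fun q => le_trans (ler_normB _ _) (lerD (UM q.2) (UM q.1))).
pose fw x := (f \_ Omega) x * w x.
(* [f] is within [ef] of minus the Laplacian of [ut0], which is at most 2 M. *)
have bf : bmeas (f \_ Omega).
  split; first exact: (measurable_restrictT _ mO).1.
  exists (Num.max (ef + 2 * M) 0) => x; rewrite patchE le_max; case: ifPn; last by rewrite normr0 lexx orbT.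
  rewrite in_setE => Ox; apply/orP; left.
  have := f_lap Ox; have := Mu (s := [:: false; false]) isT (ED (OE Ox)).
  have := Mu (s := [:: true; true]) isT (ED (OE Ox)); rewrite /laplacian.
  move: (partial [:: true; true] ut0 x) (partial [:: false; false] ut0 x) (f x) => a b g.
  by rewrite !ler_norml => /andP[? ?] /andP[? ?] /andP[? ?]; apply/andP; split; lra.
have bfw : bmeas fw.
  have [mf' [Mf fM]] := bf; split; first exact: measurable_funM.
  by exists (Mf * Mw) => x; rewrite normrM ler_pM.
have ifw : area.-integrable setT (EFin \o fw).
  apply: bmeas_integrable bfw _ => x nE; rewrite /fw w0 ?mulr0// => Ox.
  exact/nE/OE.
have i1 : area.-integrable setT (fun x => (\1_E x)%:E).
  apply: bmeas_integrable; last by move=> x nE; rewrite indicE memNset.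
  by split => //; exists 1 => x; rewrite indicE; case: (_ \in E); rewrite ?normr1 ?normr0.
rewrite residual.
have -> : \int[leb2]_(x in Omega) (f x * w x) = \int[area]_x fw x.
  rewrite Rintegral_mkcond; apply: eq_Rintegral => x _; rewrite /fw !patchE.
  by case: ifP => // _; rewrite mul0r.
rewrite -RintegralZl// -RintegralB//; last exact: (integrableZl measurableT (-2) iwL).
have VE : \int[area]_x \1_E x <= V.
  rewrite /Rintegral -lee_fin fineK; last exact: integrable_fin_num i1.
  by rewrite integral_indic// setIT.
apply: (@le_trans _ _ (\int[area]_x (K * rho ^+ 2 * \1_E x + (4 * K)^-1 * w x ^+ 2))); last first.
  rewrite RintegralD//; last 2 first.
  - exact: (integrableZl measurableT (K * rho ^+ 2) i1).
  - exact: (integrableZl measurableT (4 * K)^-1 iw2).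
  rewrite !RintegralZl// lerD2r; apply: ler_wpM2l => //.
  by rewrite mulr_ge0 ?sqr_ge0// ltW.
apply: le_Rintegral => //.
- have := integrableB measurableT (integrableZl measurableT (-2) iwL) ifw.
  by apply: eq_integrable => // x _; rewrite /= EFinB EFinM.
- exact: (integrableD measurableT (integrableZl measurableT (K * rho ^+ 2) i1)
    (integrableZl measurableT (4 * K)^-1 iw2)).
- move=> x _; rewrite /fw indicE patchE.
  have [Ox|nO] := pselect (Omega x); last first.
    rewrite w0// !mul0r mulr0 expr0n !mulr0 subr0 addr0 mulr_ge0//.
    by rewrite mulr_ge0 ?sqr_ge0// ltW.
  rewrite mem_set// mem_set; last exact: OE.
  rewrite mulr1; have := consistency Ox; rewrite -/(L x).
  have -> : -2 * (w x * L x) - f x * w x = (- 2 * L x - f x) * w x by ring.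
  move: (- 2 * L x - f x) (w x) => a b ar.
  have a2 : a ^+ 2 <= rho ^+ 2.
    by rewrite -[a ^+ 2]real_normK ?num_real// lerXn2r ?nnegrE// (le_trans _ ar).
  apply: (@le_trans _ _ (K * a ^+ 2 + (4 * K)^-1 * b ^+ 2)); last first.
    by rewrite lerD2r ler_wpM2l// ltW.
  rewrite -subr_ge0 (_ : _ - _ = K * (a - (2 * K)^-1 * b) ^+ 2).
    by rewrite mulr_ge0 ?sqr_ge0// ltW.
  by field; rewrite gt_eqF.
Qed.

Let X := 4 * (d ^- 2 * mass0 gamma) * (e1 ^+ 2 * V + e2 ^+ 2 * Vc).

Let eta_L2 : \int[area]_x (eta x ^+ 2) <= e1 ^+ 2 * V + e2 ^+ 2 * Vc.
Proof.
have iA (A : set (plane R)) : measurable A -> A `<=` E -> area.-integrable setT (fun x => (\1_A x)%:E).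
  move=> mA AE; apply: bmeas_integrable; last by move=> x nE; rewrite indicE memNset// => /AE.
  by split => //; exists 1 => x; rewrite indicE; case: (_ \in A); rewrite ?normr1 ?normr0.
have IA (A : set (plane R)) v : measurable A -> A `<=` E -> (leb2 A <= v%:E)%E -> \int[area]_x \1_A x <= v.
  move=> mA AE Av; rewrite /Rintegral -lee_fin fineK; last exact: integrable_fin_num (iA A mA AE).
  by rewrite integral_indic// setIT.
have i1 := integrableZl measurableT (e1 ^+ 2) (iA _ mO OE).
have i2 := integrableZl measurableT (e2 ^+ 2) (iA _ mC CE).
apply: (@le_trans _ _ (\int[area]_x (e1 ^+ 2 * \1_Omega x + e2 ^+ 2 * \1_(collar Omega d) x))).
  apply: le_Rintegral => //.
  - apply: bmeas_integrable; first exact: bmeas_sqr.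
    by move=> x nE; rewrite eta0// expr0n.
  - exact: (integrableD measurableT i1 i2).
  - move=> x _; have [Ex|nE] := pselect (E x); last first.
      by rewrite eta0// expr0n addr_ge0// mulr_ge0 ?sqr_ge0// indicE ler0n.
    rewrite /eta /vI /U !patchE [x \in E]mem_set// !indicE; case: Ex => [Ox|Cx].
      rewrite mem_set// [x \in collar _ _]memNset; last exact: OC.
      rewrite gh0; last exact: OC.
      rewrite mulr1 mulr0 !addr0; have := interp_le Ox.
      by move=> h; rewrite -real_normK ?num_real// lerXn2r ?nnegrE// (le_trans _ h).
    rewrite memNset; last by move=> Ox; exact: OC Ox Cx.
    rewrite mem_set// mulr0 mulr1 !add0r; have := gh_le Cx.
    by move=> h; rewrite -real_normK ?num_real// lerXn2r ?nnegrE// (le_trans _ h).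
rewrite RintegralD// !RintegralZl//; [|exact: iA..].
apply: lerD; apply: ler_wpM2l; rewrite ?sqr_ge0//; apply: IA => //.
by apply: le_trans EV; apply: le_measure => //; rewrite inE.
Qed.

Let eta_form : form eta eta <= X.
Proof.
apply: le_trans (form_le_L2 mk k0 kC kA ik beta _) _.
  apply: bmeas_integrable; first exact: bmeas_sqr.
  by move=> x nE; rewrite eta0// expr0n.
rewrite /X ler_wpM2l// mulr_ge0// mulr_ge0 ?invr_ge0 ?exprn_ge0 ?(ltW d0)//.
exact: mass0_ge0 KC.
Qed.

Let w_form : form w w <= 2 * X + 2 * (K * rho ^+ 2 * V).
Proof.
have := energy_estimate mk k0 ik bw beta be w_split iw2 K0 w_poincare residual_le.
rewrite -/(form w w) -/(form eta eta) => /le_trans; apply.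
by rewrite lerD2r ler_wpM2l.
Qed.

Let e_form : form e e <= 2 * form w w + 2 * form eta eta.
Proof.
have bs (u v : plane R -> R) : bmeas u -> bmeas v -> exists C,
    measurable_fun setT (fun q : plane R * plane R => (u q.2 - u q.1) * (v q.2 - v q.1)) /\
    forall q : plane R * plane R, `|(u q.2 - u q.1) * (v q.2 - v q.1)| <= C.
  move=> [mu' [Mu' uM]] [mv' [Mv' vM]]; exists ((Mu' + Mu') * (Mv' + Mv')); split.
    by apply: measurable_funM; exact: mdiff.
  by move=> q; rewrite normrM; apply: ler_pM => //; apply: le_trans (ler_normB _ _) _; exact: lerD.
have [C1 [m1 b1]] := bs e e be be.
have [C2 [m2 b2]] := bs w w bw bw.
have [C3 [m3 b3]] := bs eta eta beta beta.
have -> : 2 * form w w + 2 * form eta eta = 2 * (form w w + form eta eta) by ring.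
pose C := Num.max C2 C3.
have b2' q : `|(w q.2 - w q.1) * (w q.2 - w q.1)| <= C by rewrite le_max b2.
have b3' q : `|(eta q.2 - eta q.1) * (eta q.2 - eta q.1)| <= C by rewrite le_max b3 orbT.
have bC q : `|(w q.2 - w q.1) * (w q.2 - w q.1) + (eta q.2 - eta q.1) * (eta q.2 - eta q.1)| <= C + C.
  by apply: le_trans (ler_normD _ _) _; exact: lerD.
rewrite /form /energy_form -(double_integralD mk k0 ik m2 m3 b2' b3').
rewrite -(double_integralZ mk k0 ik _ (measurable_funD m2 m3) bC).
apply: (le_double_integral mk k0 ik (B := Num.max C1 (2 * (C + C)))) => //.
- by apply: measurable_funM => //; exact: measurable_funD.
- by move=> q; rewrite le_max b1.
- move=> q; rewrite le_max; apply/orP; right; rewrite normrM (ger0_norm (ler0n _ 2)).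
  by apply: ler_wpM2l => //; exact: bC.
- move=> q /=; have eE x : e x = w x - eta x by rewrite w_split addrC addKr.
  rewrite !eE; move: (w q.2) (w q.1) (eta q.2) (eta q.1) => a b a' b'.
  by have := sqr_ge0 (a - b + (a' - b')); lra.
Qed.

(** From e = w - eta, twice the energy of w plus twice that of eta: 2 (2 X + 2 K rho^2 V) + 2 X. *)
Lemma galerkin_energy_error :
  (\int[leb2]_(x in E) \int[leb2]_(y in E)
     (((ut0 y - uh y) - (ut0 x - uh x)) ^+ 2 * ker x y)%:E <=
   (6 * X + 4 * (K * rho ^+ 2 * V))%:E)%E.
Proof.
rewrite (@energy_cut (fun x => ut0 x - uh x) e); last first.
  by move=> x Ex; rewrite /e /U patchE mem_set.
rewrite (form_energy mk k0 ik be) lee_fin -/(form e e).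
have := w_form; have := eta_form; have := e_form.
move: (form e e) (form w w) (form eta eta) X (K * rho ^+ 2 * V) => a b b' x y; lra.
Qed.

(** The Poincare inequality is applied to [w], which vanishes off Omega, and not to [e], which need
    not vanish on the collar; [eta] is estimated directly. *)
Lemma galerkin_L2_error :
  (\int[leb2]_(x in Omega) ((ut0 x - uh x) ^+ 2)%:E <=
   (2 * (e1 ^+ 2 * V + e2 ^+ 2 * Vc) + 2 * (K * (2 * X + 2 * (K * rho ^+ 2 * V))))%:E)%E.
Proof.
have ie : area.-integrable setT (fun x => (eta x ^+ 2)%:E).
  apply: bmeas_integrable; first exact: bmeas_sqr.
  by move=> x nE; rewrite eta0// expr0n.
have i2e := integrableZl measurableT 2 ie; have i2w := integrableZl measurableT 2 iw2.
apply: (@le_trans _ _ (\int[area]_x (2 * eta x ^+ 2 + 2 * w x ^+ 2))%:E).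
  rewrite /Rintegral fineK; last exact: integrable_fin_num (integrableD measurableT i2e i2w).
  have -> : (\int[leb2]_(x in Omega) ((ut0 x - uh x) ^+ 2)%:E = \int[area]_(x in Omega) (e x ^+ 2)%:E)%E.
    by apply: eq_integral => x /[!in_setE] Ox; rewrite /e /U patchE mem_set//; left.
  have me2 : measurable_fun setT (fun x => (e x ^+ 2)%:E).
    by apply/measurable_EFinP; apply: measurable_funX; case: be.
  apply: (@le_trans _ _ (\int[area]_x (e x ^+ 2)%:E)%E).
    by apply: ge0_subset_integral => // x _; rewrite lee_fin sqr_ge0.
  apply: ge0_le_integral => //.
  - by move=> x _; rewrite lee_fin sqr_ge0.
  - by apply/measurable_EFinP; apply: measurable_funD; apply: measurable_funM => //;
      apply: measurable_funX; [case: beta | case: bw].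
  - move=> x _; rewrite lee_fin (_ : e x = w x - eta x); last by rewrite w_split addrC addKr.
    by have := sqr_ge0 (w x + eta x); move: (w x) (eta x) => a b; lra.
rewrite lee_fin RintegralD// !RintegralZl//; apply: lerD; first by rewrite ler_wpM2l.
rewrite ler_wpM2l//; apply: le_trans w_poincare _; rewrite ler_wpM2l//; exact: ltW.
Qed.

End Galerkin.

(** * Convergence rates *)

Section Rates.
Context {R : realType}.
Implicit Types (d h : R).

Lemma half_power_sqr d (mu : nat) : 0 <= d -> (d `^ ((3 + mu%:R) / 2)) ^+ 2 = d ^+ (3 + mu).
Proof.
move=> d0; rewrite -powR_mulrn ?powR_ge0// -powRrM mulrAC -mulrA mulfV ?pnatr_eq0// mulr1.
by rewrite -natrD powR_mulrn.
Qed.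

(** On Omega the mass delta^-2 turns h^4 into (delta^-1 h^2)^2. On the collar its area leaves
    delta^-1 (h^4 + delta^(4 + 2 mu)), and delta^(3 + 2 mu) <= delta^(3 + mu) = a^2. The
    half-integral power a enters through its square only. *)
Lemma interpolation_rate d h (a q V Vc e1 e2 : R) (mu : nat) : 0 < d <= 1 -> 0 <= h ->
  0 <= V -> 0 <= Vc ->
  0 <= e1 <= q * h ^+ 2 -> 0 <= e2 <= q * (h ^+ 2 + d ^+ (2 + mu)) ->
  a ^+ 2 = d ^+ (3 + mu) -> 0 <= a ->
  d ^- 2 * (e1 ^+ 2 * V + e2 ^+ 2 * (Vc * d)) <=
    q ^+ 2 * (V + 2 * Vc) * (a + d^-1 * h ^+ 2 + d ^- 3 * h ^+ 2) ^+ 2.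
Proof.
move=> /andP[d0 d1] h0 V0 Vc0 /andP[e10 e1q] /andP[e20 e2q] a2 a0.
pose b := d^-1 * h ^+ 2; pose z := d ^- 3 * h ^+ 2.
have b0 : 0 <= b by rewrite mulr_ge0 ?sqr_ge0// invr_ge0 ltW.
have z0 : 0 <= z by rewrite mulr_ge0 ?sqr_ge0// invr_ge0 exprn_ge0// ltW.
have s2 : b ^+ 2 + a ^+ 2 <= (a + b + z) ^+ 2.
  rewrite -subr_ge0 (_ : _ - _ = z ^+ 2 + 2 * (a * b + a * z + b * z)); last by ring.
  by rewrite addr_ge0 ?sqr_ge0// mulr_ge0// !addr_ge0// mulr_ge0.
have E1 : d ^- 2 * e1 ^+ 2 <= q ^+ 2 * b ^+ 2.
  rewrite (_ : q ^+ 2 * b ^+ 2 = d ^- 2 * (q * h ^+ 2) ^+ 2); last by rewrite /b -exprVn; ring.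
  rewrite ler_wpM2l ?invr_ge0 ?exprn_ge0 ?(ltW d0)// lerXn2r ?nnegrE//.
  exact: le_trans e1q.
have E2 : d ^- 2 * (e2 ^+ 2 * d) <= 2 * (q ^+ 2 * (b ^+ 2 + a ^+ 2)).
  have -> : d ^- 2 * (e2 ^+ 2 * d) = d^-1 * e2 ^+ 2 by field; rewrite gt_eqF.
  apply: (@le_trans _ _ (d^-1 * (q * (h ^+ 2 + d ^+ (2 + mu))) ^+ 2)).
    rewrite ler_wpM2l ?invr_ge0 ?(ltW d0)// lerXn2r ?nnegrE//.
    exact: le_trans e2q.
  rewrite exprMn mulrCA [leRHS]mulrCA ler_wpM2l ?sqr_ge0//.
  apply: (@le_trans _ _ (d^-1 * (2 * (h ^+ 4 + (d ^+ (2 + mu)) ^+ 2)))).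
    rewrite ler_wpM2l ?invr_ge0 ?(ltW d0)//.
    have := sqr_ge0 (h ^+ 2 - d ^+ (2 + mu)); rewrite (_ : h ^+ 4 = (h ^+ 2) ^+ 2); last by ring.
    by move: (h ^+ 2) (d ^+ (2 + mu)) => x y; lra.
  rewrite mulrCA ler_wpM2l// mulrDr; apply: lerD.
    rewrite (_ : b ^+ 2 = d^-1 * (d^-1 * h ^+ 4)); last by rewrite /b; ring.
    rewrite ler_wpM2l ?invr_ge0 ?(ltW d0)// ler_peMl ?exprn_ge0// invf_ge1//.
  rewrite a2 -exprM (_ : ((2 + mu) * 2 = (3 + mu * 2).+1)%N); last by rewrite mulnDl.
  rewrite exprS mulKf ?gt_eqF//; apply: ler_wiXn2l; [exact: ltW | exact: d1 |].
  by rewrite leq_add2l leq_pmulr.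
have q2 := sqr_ge0 q.
apply: (@le_trans _ _ (q ^+ 2 * (V + 2 * Vc) * (b ^+ 2 + a ^+ 2))); last first.
  by rewrite ler_wpM2l// mulr_ge0// addr_ge0// mulr_ge0.
have := ler_wpM2r V0 E1; have := ler_wpM2r Vc0 E2.
have : 0 <= q ^+ 2 * V * a ^+ 2 by nneg.
move: (d ^- 2) => D; move: (q ^+ 2) (a ^+ 2) (b ^+ 2) (e1 ^+ 2) (e2 ^+ 2) => Q A B' F1 F2; lra.
Qed.

(** The term delta^4 of rho^2 is absorbed by a^2 = delta^(3 + mu), because mu <= 1 and delta <=
    1. *)
Lemma consistency_rate d h (a r rho : R) (mu : nat) : 0 < d <= 1 -> 0 <= h -> (mu <= 1)%N ->
  0 <= rho <= r * (d ^+ 2 + d ^- 3 * h ^+ 2) -> a ^+ 2 = d ^+ (3 + mu) -> 0 <= a ->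
  rho ^+ 2 <= 2 * r ^+ 2 * (a + d^-1 * h ^+ 2 + d ^- 3 * h ^+ 2) ^+ 2.
Proof.
move=> /andP[d0 d1] h0 mu1 /andP[rho0 rhor] a2 a0.
pose b := d^-1 * h ^+ 2; pose z := d ^- 3 * h ^+ 2; rewrite -/b -/z in rhor *.
have b0 : 0 <= b by rewrite mulr_ge0 ?sqr_ge0// invr_ge0 ltW.
have z0 : 0 <= z by rewrite mulr_ge0 ?sqr_ge0// invr_ge0 exprn_ge0// ltW.
have s2 : z ^+ 2 + a ^+ 2 <= (a + b + z) ^+ 2.
  rewrite -subr_ge0 (_ : _ - _ = b ^+ 2 + 2 * (a * b + a * z + b * z)); last by ring.
  by rewrite addr_ge0 ?sqr_ge0// mulr_ge0// !addr_ge0// mulr_ge0.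
have d4 : d ^+ 4 <= a ^+ 2 by rewrite a2; apply: ler_wiXn2l; [exact: ltW | exact: d1 | rewrite (leq_add2l 3 mu 1)].
apply: (@le_trans _ _ ((r * (d ^+ 2 + z)) ^+ 2)).
  by rewrite lerXn2r ?nnegrE//; exact: le_trans rhor.
have -> : 2 * r ^+ 2 * (a + b + z) ^+ 2 = r ^+ 2 * (2 * (a + b + z) ^+ 2) by ring.
rewrite exprMn; apply: ler_wpM2l; first exact: sqr_ge0.
have := sqr_ge0 (d ^+ 2 - z); rewrite (_ : d ^+ 4 = (d ^+ 2) ^+ 2) in d4; last by ring.
move: (d ^+ 2) d4 => D; lra.
Qed.

Lemma sqrt_rate (Q q s : R) : 0 <= Q -> Q <= q * s ^+ 2 -> 0 <= q -> 0 <= s ->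
  Num.sqrt Q <= Num.sqrt q * s.
Proof.
move=> Q0 Qq q0 s0; rewrite -[X in _ * X](@ger0_norm _ s)// -sqrtr_sqr -sqrtrM//.
by rewrite ler_wsqrtr.
Qed.

Lemma poweR_half_le (Y : \bar R) (Q q s : R) : (0 <= Y)%E -> (Y <= Q%:E)%E -> Q <= q * s ^+ 2 ->
  0 <= q -> 0 <= s -> (Y `^ 2^-1 <= (Num.sqrt q * s)%:E)%E.
Proof.
move=> Y0 YQ Qq q0 s0; have Q0 : 0 <= Q by rewrite -lee_fin (le_trans Y0).
apply: (@le_trans _ _ (Q%:E `^ 2^-1)%E).
  by apply: gt0_ler_poweR => //; rewrite in_itv/= leey andbT.
by rewrite poweR_EFin lee_fin powR12_sqrt// sqrt_rate.
Qed.

Lemma L2norm_le D (u : plane R -> R) (Q q s : R) :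
  (\int[leb2]_(x in D) (u x ^+ 2)%:E <= Q%:E)%E -> Q <= q * s ^+ 2 -> 0 <= q -> 0 <= s ->
  (L2norm D u <= (Num.sqrt q * s)%:E)%E.
Proof.
move=> uQ Qq q0 s0; rewrite /L2norm unlock /Lnorm.
apply: poweR_half_le Qq q0 s0; first by apply: integral_ge0 => x _; exact: poweR_ge0.
apply: le_trans uQ; rewrite [leRHS]integral_mkcond le_eqVlt; apply/orP; left; apply/eqP.
apply: eq_integral => x _; rewrite -[LHS]/((`|(u \_ D) x|%:E `^ 2)%E) poweR_EFin powR_mulrn// real_normK ?num_real//.
by rewrite !patchE; case: ifP => // _; rewrite expr0n.
Qed.

Lemma supnormP D (g : plane R -> R) (C : R) x : (supnorm D g <= C%:E)%E -> D x -> `|g x| <= C.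
Proof.
move=> gC Dx; rewrite -lee_fin; apply: le_trans gC.
by apply: ereal_sup_ubound; exists x.
Qed.

Lemma partial_local D (u v : plane R -> R) s x : open D -> (forall x, D x -> u x = v x) ->
  D x -> partial s u x = partial s v x.
Proof.
move=> oD uv; elim: s x => [|i s IH] x Dx; first exact: uv.
apply: near_eq_derive; near=> y; apply: IH; near: y.
exact: open_nbhs_nbhs.
Unshelve. all: by end_near. Qed.

Lemma min_sides_le (D : set (plane R)) (p : plane R -> seq (plane R)) x : D x ->
  min_sides D p <= (size (p x))%:R.
Proof.
move=> Dx; apply: ge_inf; last by exists x.
by exists 0 => _ [y _ <-]; rewrite ler0n.
Qed.


Lemma norm2_le (z : plane R) h : `|z.1| <= h -> `|z.2| <= h -> norm2 z <= 2 * h.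
Proof.
move=> z1 z2; have h0 : 0 <= h := le_trans (normr_ge0 _) z1.
rewrite -[leRHS]ger0_norm ?mulr_ge0// -sqrtr_sqr /norm2; apply: ler_wsqrtr.
rewrite -[z.1 ^+ 2]real_normK ?num_real// -[z.2 ^+ 2]real_normK ?num_real//.
have l1 : `|z.1| ^+ 2 <= h ^+ 2 by rewrite lerXn2r ?nnegrE.
have l2 : `|z.2| ^+ 2 <= h ^+ 2 by rewrite lerXn2r ?nnegrE.
by have := sqr_ge0 h; rewrite exprMn; lra.
Qed.

Lemma consistency_const (M Ca Cf C D Z L : R) : 0 <= M -> 0 <= Ca -> 0 <= Cf -> 0 <= D -> 0 <= Z ->
  L <= C ^+ 2 / 4 * Z ->
  4 * M * D + 4 * M * (Ca * L) + Cf * D <= (4 * M + Cf + M * Ca * C ^+ 2) * (D + Z).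
Proof.
move=> M0 Ca0 Cf0 D0 Z0 LZ; have := ler_wpM2l (mulr_ge0 M0 Ca0) LZ.
have : 0 <= M * Z by nneg.
have : 0 <= Cf * Z by nneg.
have : 0 <= M * Ca * C ^+ 2 * D by nneg.
by move: (C ^+ 2) => E; lra.
Qed.

Lemma interpolation_const (M Ch Cg Y Z : R) : 0 <= M -> 0 <= Ch -> 0 <= Cg -> 0 <= Y -> 0 <= Z ->
  (3 * (M * Z) <= (3 * M + Ch + Cg) * Z) * (Ch * Z + Cg * Y <= (3 * M + Ch + Cg) * (Z + Y)).
Proof.
move=> M0 Ch0 Cg0 Y0 Z0.
have := mulr_ge0 Ch0 Z0; have := mulr_ge0 Cg0 Z0; have := mulr_ge0 M0 Z0.
have := mulr_ge0 Ch0 Y0; have := mulr_ge0 M0 Y0; split; lra.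
Qed.

Lemma energy_const (m q1 K V r s rho D Y : R) : 0 <= m -> 0 <= K -> 0 <= V ->
  D * Y <= q1 * s -> rho <= 2 * r * s ->
  6 * (4 * (D * m) * Y) + 4 * (K * rho * V) <= (24 * m * q1 + 8 * (K * r * V)) * s.
Proof.
move=> m0 K0 V0 DY rs.
have := ler_wpM2l m0 DY; have := ler_wpM2l (mulr_ge0 K0 V0) rs; lra.
Qed.

Lemma L2_const (m q1 K V r s rho D Y : R) : 0 <= m -> 0 <= K -> 0 <= V ->
  Y <= q1 * s -> D * Y <= q1 * s -> rho <= 2 * r * s ->
  2 * Y + 2 * (K * (2 * (4 * (D * m) * Y) + 2 * (K * rho * V))) <=
    (2 * q1 + 2 * (K * (8 * m * q1 + 4 * (K * r * V)))) * s.
Proof.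
move=> m0 K0 V0 Ys DY rs.
have := ler_wpM2l (mulr_ge0 K0 m0) DY.
have := ler_wpM2l (mulr_ge0 K0 (mulr_ge0 K0 V0)) rs; lra.
Qed.

End Rates.

(** * The error estimate, uniform in delta, h and the discrete data *)

Section DiscreteEstimate.
Context {R : realType}.
Variables (Omega : set (plane R)) (u0 f0 : plane R -> R).
Variables (gam : R -> plane R -> plane R -> R) (gamt : R -> R -> R) (gamma : R -> R).
Variables (delta0 : R) (ut0 : plane R -> R).
Hypotheses (KC : kernel_conditions gam gamt gamma) (pO : bounded_open_polygon Omega).
Hypothesis cu : Cb 4 (enlarged Omega delta0) ut0.
Hypothesis uu : forall x, Omega x -> ut0 x = u0 x.
Hypothesis fu : forall x, Omega x -> - laplacian u0 x = f0 x.

(** The order of the quantifiers is the point: Q depends on Omega, the extension, the kernel profile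
    and the constants of the hypotheses, and is fixed before delta, h, the polygons, the meshes and
    the data. *)
Lemma discrete_estimate (l C1 C2 Cn Cf Cg Ch : R) (mu : nat) :
  (Phi gamma t - Phi gamma 1) / (t - 1) @[t --> 1^'-] --> l ->
  0 < C1 -> 0 < C2 -> 0 < Cn -> 0 < Cf -> 0 < Cg -> 0 < Ch -> (mu <= 1)%N ->
  exists2 Q : R, 0 < Q & forall (d h : R) (p : plane R -> seq (plane R))
      (f g gh u0h : plane R -> R) (T0 Tc : seq (tri R)),
    0 < h < d -> d <= 1 -> 2 * d <= delta0 ->
    (forall x, enlarged Omega d x -> inscribed x d (p x)) ->
    measurable [set q : plane R * plane R |
       [/\ enlarged Omega d q.1, enlarged Omega d q.2 & region (p q.1) q.2]] ->
    (forall x, enlarged Omega d x ->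
       longest_side (p x) / (2 * sin (pi / (size (p x))%:R)) <= C1 * d /\
       C2 * d <= inner_radius x (p x)) ->
    d / h <= Cn * min_sides (enlarged Omega d) p ->
    measurable_fun Omega f ->
    (supnorm Omega (fun x => f x - f0 x)%R <= (Cf * d ^+ 2)%:E)%E ->
    (supnorm (collar Omega d) (fun x => g x - ut0 x)%R <= (Cg * d ^+ (2 + mu))%:E)%E ->
    (supnorm (collar Omega d) (fun x => g x - gh x)%R <= (Ch * h ^+ 2)%:E)%E ->
    triangulation Omega d T0 Tc -> mesh_size (T0 ++ Tc) = h ->
    fe_space Tc (collar Omega d) gh ->
    CDG_solution Omega d (poly_kernel (gam d) d p) f gh T0 u0h ->
    let s := d `^ ((3 + mu%:R) / 2) + d^-1 * h ^+ 2 + d ^- 3 * h ^+ 2 in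
    (energy_norm (poly_kernel (gam d) d p) (enlarged Omega d)
       (fun x => ut0 x - (u0h x + gh x))%R <= (Q * s)%:E)%E /\
    (L2norm Omega (fun x => u0 x - (u0h x + gh x))%R <= (Q * s)%:E)%E.
Proof.
move=> hl C10 C20 Cn0 Cf0 Cg0 Ch0 mu1.
have [oO O0 _ bdO [sO sO1 sO2]] := pO; have bO := boundary_neq0 pO.
have [B B0 OB] := bounded_set_box bdO.
have [Cc Cc0 collar_le] := leb2_collar oO bO (ex_intro _ sO sO2).
have [M M0 Mu] := Cb_bounded cu.
have [Ca Ca0 annulus] := radial_kernel_annulus KC hl.
pose V := 4 * B ^+ 2 + Cc; have V0 : 0 <= V by rewrite /V; nneg.
(* Half of [C2], so that c d stays strictly below the inner radius; at most 1, because Phi is used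
   on [0, 1]. *)
pose c := Num.min (C2 / 2) 1.
have c01 : 0 < c <= 1 by rewrite lt_min divr_gt0//= ltr01 ge_min lexx orbT.
have Phic := Phi_gt0 KC c01.
(* Sides are at most 2 pi C1 d / n, and the lower bound on the number n of sides gives d / n <= Cn
   h; so [CH * h] bounds every side. *)
pose CH := 2 * pi * C1 * Cn.
have CH0 : 0 < CH by rewrite /CH !mulr_gt0// pi_gt0.
pose q := 3 * M + Ch + Cg.
pose r := 4 * M + Cf + M * Ca * CH ^+ 2.
have r0 : 0 <= r by rewrite /r; nneg.
pose K := 2 * (2 * B + 1) ^+ 2 / Phi gamma c.
have K0 : 0 <= K by rewrite /K; nneg.
have m0 := mass0_ge0 KC; set m := mass0 gamma in m0.
pose q1 := q ^+ 2 * (V + 2 * Cc).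
have q10 : 0 <= q1 by rewrite /q1; nneg.
pose QE := 24 * m * q1 + 8 * (K * r ^+ 2 * V).
pose QL := 2 * q1 + 2 * (K * (8 * m * q1 + 4 * (K * r ^+ 2 * V))).
have QE0 : 0 <= QE by rewrite /QE; nneg.
have QL0 : 0 <= QL by rewrite /QL; nneg.
exists (Num.sqrt QE + Num.sqrt QL + 1); first by rewrite ltr_wpDl// addr_ge0 ?sqrtr_ge0.
move=> d h p f g gh u0h T0 Tc /andP[h0 hd] d1 dd ins mS wqu nmin mf fC gC ghC tri mesh gh_fe sol.
have d0 : 0 < d := lt_trans h0 hd.
have d01 : 0 < d <= 1 by rewrite d0.
move=> s; set E := enlarged Omega d in ins mS wqu nmin *.
have s0 : 0 <= s.
  by apply: addr_ge0; [apply: addr_ge0; first exact: powR_ge0|]; nneg.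
have ED : E `<=` enlarged Omega delta0.
  by apply: enlarged_mono; apply: le_trans dd; rewrite ler_peMl// ltW// ltr1n.
have oE : open E := enlarged_open oO bO.
have [dcu ccu] := cu.
have mut : measurable_fun E ut0.
  apply: open_continuous_measurable_plane => // x Ex.
  by have [h1 _] := ccu [::] isT; apply: h1; exact: ED.
have cV := collar_le d d01.
have mO := open_measurable_plane oO; have mC := collar_measurable d oO bO.
have EV : (leb2 E <= V%:E)%E.
  apply: le_trans (measureU2 _ mO mC) _; rewrite /V EFinD; apply: leeD.
    rewrite -(leb2_box 0 (ltW B0)); apply: le_measure => //; rewrite inE//.
    exact: measurable_box.
  by apply: le_trans cV _; rewrite lee_fin ler_piMr// ltW.
pose H := CH * h.
have side x : E x -> longest_side (p x) <= H.
  move=> Ex; have [l1 _] := wqu x Ex.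
  have n1 := inscribed_size (ins x Ex).
  have n0 : 0 < (size (p x))%:R :> R by rewrite ltr0n (ltn_trans _ n1).
  apply: le_trans (longest_side_le (ins x Ex) l1 _) _; first by rewrite mulr_ge0// ltW.
  have nh : d / h <= Cn * (size (p x))%:R.
    by apply: le_trans nmin _; rewrite ler_wpM2l ?(ltW Cn0)//; exact: min_sides_le.
  have dn : d / (size (p x))%:R <= Cn * h.
    rewrite ler_pdivrMr// mulrAC -ler_pdivrMr//.
  rewrite /H /CH (_ : 2 * pi * (C1 * d) / _ = 2 * pi * C1 * (d / (size (p x))%:R)); last by ring.
  by rewrite -[leRHS]mulrA; apply: ler_wpM2l => //; nneg.
have side0 x : 0 <= longest_side (p x) by exact: bigmax_ge_id.
(* The relative radius of a disc contained in all the polygons, with 1 - t = O(h^2 / d^2). *)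
pose t := Num.sqrt (1 - H ^+ 2 / (4 * d ^+ 2)).
have Hd0 : 0 <= H ^+ 2 / (4 * d ^+ 2) by rewrite divr_ge0 ?sqr_ge0// mulr_ge0// sqr_ge0.
have t1 : t <= 1.
  by rewrite -[leRHS]sqrtr1 /t ler_wsqrtr// gerBl.
have tH : 1 - t <= H ^+ 2 / (4 * d ^+ 2) := one_sub_sqrt Hd0.
have C2d : 0 < C2 * d by rewrite mulr_gt0.
have pt x y : E x -> dist2 x y < t * d -> region (p x) y.
  move=> Ex xy; have [_ l2] := wqu x Ex.
  exact: (inscribed_disc (ins x Ex) d0 (side x Ex) (side0 x) C2d l2 xy).
have pc x y : E x -> dist2 x y < c * d -> region (p x) y.
  move=> Ex xy; have [_ l2] := wqu x Ex.
  apply: (inner_radius_disc C2d l2 _ xy); apply: (@le_lt_trans _ _ (C2 / 2 * d)).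
    by rewrite ler_wpM2r ?(ltW d0)// ge_min lexx.
  by rewrite ltr_pM2r// ltr_pdivrMr// ltr_pMr// ltr1n.
have [nd conf cov0 covc _] := tri.
have nd0 x : x \in T0 -> nondegenerate x by move=> xT; apply: nd; rewrite mem_cat xT.
have ndc x : x \in Tc -> nondegenerate x by move=> xT; apply: nd; rewrite mem_cat xT orbT.
have conf0 : conforming T0 by move=> x y xT yT; apply: conf; rewrite mem_cat ?xT ?yT.
have OT : Omega `<=` covered T0 by rewrite cov0; exact: subset_closure.
have CT : collar Omega d `<=` covered Tc by exact: subset_trans (@subset_closure _ _) covc.
pose e1 := 3 * (M * h ^+ 2); pose e2 := Ch * h ^+ 2 + Cg * d ^+ (2 + mu).
have he1 x : Omega x -> `|interpolant ut0 T0 x - ut0 x| <= e1.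
  move=> Ox; have [y yT xy] := OT x Ox.
  rewrite (interpolantE _ nd0 conf0 yT xy).
  apply: (interp_error dcu Mu (nd0 y yT) xy).
    by rewrite -mesh; apply: mesh_size_tri; rewrite mem_cat yT.
  (* The box of half-width h about x stays within distance 2 h < 2 d <= delta0 of x, where the
     extension is smooth; this is why 2 d and not d is compared with delta0. *)
  move=> z z1 z2; apply: (enlarged_disc Ox); apply: lt_le_trans dd.
  rewrite /dist2 addrC addKr; apply: (@le_lt_trans _ _ (2 * h)); last by rewrite ltr_pM2l.
  exact: norm2_le.
have he2 x : collar Omega d x -> `|gh x - ut0 x| <= e2.
  move=> Cx; have l1 := supnormP gC Cx; have l2 := supnormP ghC Cx.
  apply: le_trans (ler_distD (g x) _ _) _; rewrite distrC; exact: lerD.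
have f_lap x : Omega x -> `|f x + laplacian ut0 x| <= Cf * d ^+ 2.
  move=> Ox; have := supnormP fC Ox; rewrite -fu// opprK.
  by rewrite /laplacian !(partial_local _ oO (fun x Ox => esym (uu Ox)) Ox).
have EE := galerkin_energy_error KC oO bO OB B0 d01 mS EV cV c01 pc pt (annulus d t d0 t1) ED mut
  dcu Mu mf f_lap nd0 ndc conf0 OT CT gh_fe sol he1 he2.
have EL := galerkin_L2_error KC oO bO OB B0 d01 mS EV cV c01 pc pt (annulus d t d0 t1) ED mut
  dcu Mu mf f_lap nd0 ndc conf0 OT CT gh_fe sol he1 he2.
rewrite -/m -/K in EE EL.
set rho := 4 * M * d ^+ 2 + _ + _ in EE EL.
have a2 := half_power_sqr mu (ltW d0).
have rho_le : 0 <= rho <= r * (d ^+ 2 + d ^- 3 * h ^+ 2).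
  have z0 : 0 <= d ^- 3 * h ^+ 2 by rewrite mulr_ge0 ?sqr_ge0// invr_ge0 exprn_ge0// ltW.
  have l0 : 0 <= (1 - t) / d by rewrite divr_ge0 ?subr_ge0// ltW.
  have l1 : (1 - t) / d <= CH ^+ 2 / 4 * (d ^- 3 * h ^+ 2).
    rewrite ler_pdivrMr//; apply: le_trans tH _; rewrite le_eqVlt; apply/orP; left; apply/eqP.
    by rewrite /H; field; rewrite gt_eqF.
  have D0 := sqr_ge0 d.
  apply/andP; split.
    by rewrite /rho; nneg.
  by apply: consistency_const l1; rewrite ?(ltW M0) ?(ltW Ca0) ?(ltW Cf0).
have Z0 := sqr_ge0 h; have D0 : 0 <= d ^+ (2 + mu) by rewrite exprn_ge0// ltW.
have [q1l q2l] := interpolation_const (ltW M0) (ltW Ch0) (ltW Cg0) D0 Z0.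
have e1q : 0 <= e1 <= q * h ^+ 2 by rewrite q1l andbT /e1; nneg.
have e2q : 0 <= e2 <= q * (h ^+ 2 + d ^+ (2 + mu)) by rewrite q2l andbT /e2; nneg.
have I1 := interpolation_rate d01 (ltW h0) V0 (ltW Cc0) e1q e2q a2 (powR_ge0 _ _).
have I2 := consistency_rate d01 (ltW h0) mu1 rho_le a2 (powR_ge0 _ _).
rewrite -/s -/q1 in I1 I2; set Y := e1 ^+ 2 * V + e2 ^+ 2 * (Cc * d) in I1 EE EL.
have Y0 : 0 <= Y by rewrite /Y; nneg.
have I3 : Y <= q1 * s ^+ 2.
  apply: le_trans I1; by rewrite ler_peMl// invf_ge1 ?exprn_gt0// exprn_ile1// ltW.
have sqrt_le (a b : R) : 0 <= a -> 0 <= b -> Num.sqrt a * s <= (Num.sqrt a + b + 1) * s.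
  by move=> a0 b0; rewrite ler_wpM2r// -addrA lerDl addr_ge0.
split.
  apply: (@le_trans _ _ (Num.sqrt QE * s)%:E); last by rewrite lee_fin sqrt_le// sqrtr_ge0.
  apply: poweR_half_le EE _ QE0 s0.
    apply: integral_ge0 => x Ex; apply: integral_ge0 => y Ey; rewrite lee_fin mulr_ge0 ?sqr_ge0//.
    rewrite /poly_kernel !mulr_ge0 ?invr_ge0 ?addr_ge0 ?indicE//.
    by have [_ /(_ d d0)[h1 _ _ _ _]] := KC; have [] := h1 x y.
  exact: energy_const.
apply: (@le_trans _ _ (Num.sqrt QL * s)%:E); last first.
  by rewrite lee_fin [Num.sqrt QE + _]addrC sqrt_le// sqrtr_ge0.
apply: L2norm_le _ _ QL0 s0.
  apply: le_trans EL; rewrite le_eqVlt; apply/orP; left; apply/eqP.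
  by apply: eq_integral => x /[!in_setE] Ox; rewrite uu.
exact: L2_const.
Qed.

End DiscreteEstimate.

Theorem theorem4p2 (R : realType) (Omega : set (plane R))
  (u0 f0 g0 : plane R -> R)
  (gam : R -> plane R -> plane R -> R) (gamt : R -> R -> R) (gamma : R -> R)
  (dPhi1 : R)
  (delta0 : R) (ut0 : plane R -> R)
  (P : set (R * R))
  (poly : R -> R -> plane R -> seq (plane R))
  (f g : R -> plane R -> R)
  (T0 Tc : R -> R -> seq (tri R)) (kappa : R)
  (gh u0h : R -> R -> plane R -> R)
  (mu : nat) :
  let ker := fun d h => poly_kernel (gam d) d (poly d h) in
  let uh := fun d h x => u0h d h x + gh d h x in
  let lam := 2%N in
  (* the local problem *)
  bounded_open_polygon Omega ->
  Cb 4 Omega u0 ->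
  (forall x, Omega x -> - laplacian u0 x = f0 x) ->
  (forall z, boundary Omega z ->
     u0 x @[x --> within Omega (nbhs z)] --> g0 z) ->
  (* the kernels *)
  kernel_conditions gam gamt gamma ->
  (Phi gamma t - Phi gamma 1) / (t - 1) @[t --> 1^'-] --> dPhi1 ->
  dPhi1 != 0 ->
  (* the admissible pairs (delta, h) *)
  (forall d h, P (d, h) -> 0 < h < d) ->
  lesssim P (fun d _ => kernel_mass (gam d) d (enlarged Omega d))
    (fun d _ => d ^- 2) ->
  (* the inscribed polygons *)
  (forall d h x, P (d, h) -> enlarged Omega d x -> inscribed x d (poly d h x)) ->
  (forall d h, P (d, h) -> measurable [set q : plane R * plane R |
     [/\ enlarged Omega d q.1, enlarged Omega d q.2 &
         region (poly d h q.1) q.2]]) ->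
  weakly_quasi_uniform P Omega poly ->
  similar P (fun d h => max_sides (enlarged Omega d) (poly d h))
    (fun d h => d / h) ->
  similar P (fun d h => min_sides (enlarged Omega d) (poly d h))
    (fun d h => d / h) ->
  (* the C^4 extension of u0 *)
  0 < delta0 ->
  Cb 4 (enlarged Omega delta0) ut0 ->
  (forall x, Omega x -> ut0 x = u0 x) ->
  (* the data of the nonlocal problem *)
  (mu = 0 \/ mu = 1)%N ->
  (forall d h, P (d, h) -> measurable_fun Omega (f d)) ->
  lesssim P (fun d _ => supnorm Omega (fun x => f d x - f0 x))
    (fun d _ => d ^+ 2) ->
  lesssim P (fun d _ => supnorm (collar Omega d) (fun x => g d x - ut0 x))
    (fun d _ => d ^+ (2 + mu)) ->
  (* the CDG approximation *)
  0 < kappa ->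
  (forall d h, P (d, h) -> triangulation Omega d (T0 d h) (Tc d h) /\
     quasi_uniform kappa h (T0 d h ++ Tc d h)) ->
  (forall d h, P (d, h) -> fe_space (Tc d h) (collar Omega d) (gh d h)) ->
  lesssim P (fun d h => supnorm (collar Omega d) (fun x => g d x - gh d h x))
    (fun _ h => h ^+ 2) ->
  (forall d h, P (d, h) ->
     CDG_solution Omega d (ker d h) (f d) (gh d h) (T0 d h) (u0h d h)) ->
  (* the first moments vanish as delta -> 0 *)
  (forall (i : bool) x, Omega x -> forall e : R, 0 < e ->
     exists2 d1 : R, 0 < d1 & forall d h, P (d, h) -> d < d1 ->
       `|first_moment (ker d h) (enlarged Omega d) i x| < e) ->
  let rate := fun d h : R => d `^ ((3 + mu%:R) / 2) + d^-1 * h ^+ 2 +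
                             d ^- (lam + 1) * h ^+ lam in
  [/\ lesssim P (fun d h => energy_norm (ker d h) (enlarged Omega d)
                              (fun x => ut0 x - uh d h x)) rate,
      lesssim P (fun d h => L2norm Omega (fun x => u0 x - uh d h x)) rate &
      similar P rate
        (fun d h => d `^ ((3 + mu%:R) / 2) + d ^- 3 * h ^+ 2)].
Proof.
move=> ker uh lam pO _ fu _ KC hl _ hP _ ins mS [C1 [C2 [C10 C20 wqu]]] _ [_ [Cn [dn [Cn0 dn0 nmin]]]]
  delta00 cu uu mu01 mf [Cf [df [Cf0 df0 fC]]] [Cg [dg [Cg0 dg0 gC]]] _ tri gh_fe
  [Ch [dh [Ch0 dh0 ghC]]] sol _ rate.
have mu1 : (mu <= 1)%N by case: mu01 => ->.
have [Q Q0 est] := discrete_estimate KC pO cu uu fu hl C10 C20 Cn0 Cf0 Cg0 Ch0 mu1.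
(* The smallest of the thresholds in the asymptotic hypotheses, together with delta <= 1 and 2 delta
   <= delta0. *)
pose D := Num.min (Num.min (Num.min dn df) (Num.min dg dh)) (Num.min 1 (delta0 / 2)).
have D0 : 0 < D by rewrite !lt_min dn0 df0 dg0 dh0 ltr01 divr_gt0.
have bound d h : P (d, h) -> d < D ->
    (energy_norm (ker d h) (enlarged Omega d) (fun x => ut0 x - uh d h x)%R <= (Q * rate d h)%:E)%E /\
    (L2norm Omega (fun x => u0 x - uh d h x)%R <= (Q * rate d h)%:E)%E.
  move=> Pdh; rewrite !lt_min -!andbA => /andP[ddn /and5P[ddf ddg ddh dd1 ddd]].
  have [trdh [mesh _]] := tri d h Pdh.
  apply: (est d h (poly d h) (f d) (g d) (gh d h) (u0h d h) (T0 d h) (Tc d h)) => //.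
  - exact: hP.
  - exact: ltW.
  - by move: ddd; rewrite ltr_pdivlMr// mulrC => /ltW.
  - by move=> x Ex; exact: (ins d h x Pdh Ex).
  - exact: (mS d h Pdh).
  - by move=> x Ex; exact: (wqu d h x Pdh Ex).
  - by rewrite -lee_fin; exact: (nmin d h Pdh ddn).
  - exact: (mf d h Pdh).
  - exact: (fC d h Pdh ddf).
  - exact: (gC d h Pdh ddg).
  - exact: (ghC d h Pdh ddh).
  - exact: (gh_fe d h Pdh).
  - exact: (sol d h Pdh).
split.
- by exists Q, D; split => // d h Pdh dD; case: (bound d h Pdh dD).
- by exists Q, D; split => // d h Pdh dD; case: (bound d h Pdh dD).
have b0 d h : P (d, h) -> 0 <= d^-1 * h ^+ 2.
  by move=> /hP/andP[h0 hd]; rewrite mulr_ge0 ?sqr_ge0// invr_ge0 (ltW (lt_trans h0 hd)).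
split.
(* For delta < 1 the middle term delta^-1 h^2 is at most the last one, so the two rates differ by a
   factor of at most 2. *)
- exists 2, 1; split => // d h Pdh d1; rewrite lee_fin /rate.
  have /andP[h0 hd] := hP _ _ Pdh; have d0 := lt_trans h0 hd.
  have : d^-1 * h ^+ 2 <= d ^- 3 * h ^+ 2.
    rewrite ler_wpM2r ?sqr_ge0// lef_pV2 ?posrE ?exprn_gt0//.
    by rewrite -[leRHS]expr1 ler_wiXn2l// ltW.
  have := powR_ge0 d ((3 + mu%:R) / 2).
  rewrite -[(lam + 1)%N]/3%N -[lam]/2%N.
  by move: (d `^ _) (d^-1 * h ^+ 2) (d ^- 3 * h ^+ 2) => x y z; lra.
- exists 1, 1; split => // d h Pdh _; rewrite lee_fin mul1r /rate.
  by apply: lerD => //; rewrite lerDl (b0 d h Pdh).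
Qed.
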